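(* Let $G=\widetilde{\mathrm{PSL}}_2(\mathbb R)$ be the universal cover of $\mathrm{PSL}_2(\mathbb R)$, let $\mu_G$ be a Haar measure on $G$, and let $X,Y\subseteq G$ be compact sets of positive measure. Then \[ \mu_G(XY)^{1/3}\geq \mu_G(X)^{1/3}+\mu_G(Y)^{1/3}. \]
   Context: $XY=\{xy:x\in X,\ y\in Y\}$. The group $G$ is simple, hence unimodular, so $\mu_G$ is both left and right invariant. *)

(* Defs.v *)
From HB Require Import structures.
From mathcomp Require Import all_boot all_order all_algebra.
From mathcomp Require Import all_classical all_reals all_analysis.

Set Implicit Arguments.
Unset Strict Implicit.
Unset Printing Implicit Defensive.

Import Order.TTheory GRing.Theory Num.Theory.
Import numFieldNormedType.Exports.

Local Open Scope classical_set_scope.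
Local Open Scope ring_scope.
Local Open Scope quotient_scope.

HB.mixin Record isTopologicalGroup G of Group G & Topological G := {
  mulg_continuous : continuous (fun z : G * G => (z.1 * z.2)%g) ;
  invg_continuous : continuous (fun x : G => (x^-1)%g)
}.

#[short(type="topologicalGroupType")]
HB.structure Definition TopologicalGroup :=
  {G of Group G & Topological G & isTopologicalGroup G}.

Record SL2 (R : realType) := MkSL2 {
  SL2_mx :> 'M[R]_2 ;
  SL2_subproof : \det SL2_mx == 1 }.

Section SL2_group.
Variable R : realType.

HB.instance Definition _ := [isSub for @SL2_mx R].
HB.instance Definition _ := [Choice of SL2 R by <:].
HB.instance Definition _ := Topological.copy (SL2 R)
  (initial_topology (@SL2_mx R)).

Implicit Types x y : SL2 R.

Lemma det_SL2 x : \det x = 1.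
Proof. by case: x => A /= /eqP. Qed.

Lemma SL2_unitmx x : SL2_mx x \in unitmx.
Proof. by rewrite unitmxE det_SL2 unitr1. Qed.

Fact SL2_one_subproof : \det (1%:M : 'M[R]_2) == 1.
Proof. by rewrite det1. Qed.
Fact SL2_mul_subproof x y : \det (x *m y) == 1.
Proof. by rewrite det_mulmx !det_SL2 mulr1. Qed.
Fact SL2_inv_subproof x : \det (invmx x) == 1.
Proof. by rewrite det_inv det_SL2 invr1. Qed.
Fact SL2_opp_subproof x : \det (- SL2_mx x) == 1.
Proof. by rewrite -scaleN1r detZ sqrrN expr1n mul1r det_SL2. Qed.

Definition SL2_one := MkSL2 SL2_one_subproof.
Definition SL2_mul x y := MkSL2 (SL2_mul_subproof x y).
Definition SL2_inv x := MkSL2 (SL2_inv_subproof x).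
Definition SL2_opp x := MkSL2 (SL2_opp_subproof x).

Fact SL2_mulA : associative SL2_mul.
Proof. by move=> x y z; apply/val_inj/mulmxA. Qed.
Fact SL2_mul1 : left_id SL2_one SL2_mul.
Proof. by move=> x; apply/val_inj/mul1mx. Qed.
Fact SL2_mulr1 : right_id SL2_one SL2_mul.
Proof. by move=> x; apply/val_inj/mulmx1. Qed.
Fact SL2_mulV : left_inverse SL2_one SL2_inv SL2_mul.
Proof. by move=> x; apply/val_inj/mulVmx/SL2_unitmx. Qed.
Fact SL2_mulrV : right_inverse SL2_one SL2_inv SL2_mul.
Proof. by move=> x; apply/val_inj/mulmxV/SL2_unitmx. Qed.

HB.instance Definition _ := isGroup.Build (SL2 R)
  SL2_mulA SL2_mul1 SL2_mulr1 SL2_mulV SL2_mulrV.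

Lemma SL2_mx_continuous : continuous (@SL2_mx R).
Proof. exact: (@initial_continuous (SL2 R) _ (@SL2_mx R)). Qed.

Lemma SL2_continuous (T : topologicalType) (f : T -> SL2 R) :
  (forall i j, continuous (fun t => SL2_mx (f t) i j)) -> continuous f.
Proof.
move=> cf; apply: (@continuous_comp_initial (SL2 R) _ _ (@SL2_mx R)).
move=> t A [P Pn PA].
suff : \forall s \near t, forall i j, P i j (SL2_mx (f s) i j).
  by apply: filterS => s Ps; exact: PA.
by apply: filter_forall => i; apply: filter_forall => j; exact: cf.
Qed.

Lemma SL2_coord_continuous i j : continuous (fun x => SL2_mx x i j).
Proof.
move=> x; apply: (@continuous_comp _ _ _ (@SL2_mx R)
  (fun A : 'M[R]_2 => A i j)); first exact: SL2_mx_continuous.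
exact: coord_continuous.
Qed.

Lemma SL2_mulg_continuous :
  continuous (fun z : SL2 R * SL2 R => (z.1 * z.2)%g).
Proof.
apply: SL2_continuous => i j.
have -> : (fun z : SL2 R * SL2 R => SL2_mx (z.1 * z.2)%g i j) =
  (fun z => SL2_mx z.1 i 0 * SL2_mx z.2 0 j + SL2_mx z.1 i 1 * SL2_mx z.2 1 j).
  apply/funext => z; rewrite mxE !big_ord_recl big_ord0 addr0.
  by congr (_ + SL2_mx _ _ _ * SL2_mx _ _ _); exact/val_inj.
have c1 k : continuous (fun z : SL2 R * SL2 R => SL2_mx z.1 i k).
  move=> z; apply: (@continuous_comp _ _ _ fst (fun x => SL2_mx x i k)).
    exact: cvg_fst.
  exact: SL2_coord_continuous.
have c2 k : continuous (fun z : SL2 R * SL2 R => SL2_mx z.2 k j).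
  move=> z; apply: (@continuous_comp _ _ _ snd (fun x => SL2_mx x k j)).
    exact: cvg_snd.
  exact: SL2_coord_continuous.
by move=> z; apply: cvgD; apply: cvgM; [exact: c1|exact: c2|exact: c1|exact: c2].
Qed.

Lemma SL2_invg_continuous : continuous (fun x : SL2 R => (x^-1)%g).
Proof.
apply: SL2_continuous => i j.
have -> : (fun x : SL2 R => SL2_mx (x^-1)%g i j) =
    (fun x => (-1) ^+ (j + i) * SL2_mx x (lift j 0) (lift i 0)).
  apply/funext => x.
  rewrite [SL2_mx _]/(invmx x) /invmx SL2_unitmx det_SL2 invr1 scale1r mxE.
  by rewrite /cofactor det_mx11 !mxE.
move=> x; apply: (@continuousM _ (SL2 R) (fun=> _)); first exact: cst_continuous.
exact: SL2_coord_continuous.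
Qed.

HB.instance Definition _ := isTopologicalGroup.Build (SL2 R)
  SL2_mulg_continuous SL2_invg_continuous.

End SL2_group.

Section PSL2_def.
Variable R : realType.
Implicit Types x y : SL2 R.

(* PSL_2(R) = SL_2(R) / {I, -I} with the quotient topology *)
Definition PSL2_eq : rel (SL2 R) := fun x y => (x == y) || (x == SL2_opp y).

Lemma SL2_oppK : involutive (@SL2_opp R).
Proof. by move=> x; apply/val_inj; rewrite /= opprK. Qed.

Fact PSL2_eq_refl : reflexive PSL2_eq.
Proof. by move=> x; rewrite /PSL2_eq eqxx. Qed.

Fact PSL2_eq_sym : symmetric PSL2_eq.
Proof.
by move=> x y; apply/idP/idP => /orP[/eqP->|/eqP->];
  rewrite /PSL2_eq ?SL2_oppK eqxx ?orbT.
Qed.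

Fact PSL2_eq_trans : transitive PSL2_eq.
Proof.
by move=> y x z /orP[/eqP->|/eqP->] // /orP[/eqP->|/eqP->];
  rewrite /PSL2_eq ?SL2_oppK eqxx ?orbT.
Qed.

Canonical PSL2_equiv_rel :=
  EquivRel PSL2_eq PSL2_eq_refl PSL2_eq_sym PSL2_eq_trans.

Definition PSL2 : Type := quotient_topology {eq_quot PSL2_equiv_rel}.
HB.instance Definition _ := Topological.on PSL2.
HB.instance Definition _ := Quotient.on PSL2.

Lemma PSL2_piP x y : \pi_PSL2 x = \pi_PSL2 y <-> x = y \/ x = SL2_opp y.
Proof.
split => [/(@eqmodP _ PSL2_equiv_rel x y) /orP[] /eqP|xy]; [by left|by right|].
by apply/(@eqmodP _ PSL2_equiv_rel x y)/orP; case: xy => ->; rewrite eqxx; [left|right].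
Qed.

Definition PSL2_one : PSL2 := \pi_PSL2 1%g.
Definition PSL2_mul (a b : PSL2) : PSL2 := \pi_PSL2 (repr a * repr b)%g.
Definition PSL2_inv (a : PSL2) : PSL2 := \pi_PSL2 ((repr a)^-1)%g.

Lemma PSL2_reprP x : repr (\pi_PSL2 x) = x \/ repr (\pi_PSL2 x) = SL2_opp x.
Proof. by apply/PSL2_piP; rewrite reprK. Qed.

Lemma SL2_mulN x y : (x * SL2_opp y)%g = SL2_opp (x * y)%g.
Proof. by apply/val_inj; exact: mulmxN. Qed.
Lemma SL2_mulNg x y : (SL2_opp x * y)%g = SL2_opp (x * y)%g.
Proof. by apply/val_inj; exact: mulNmx. Qed.

Lemma PSL2_pi_mul x y : \pi_PSL2 (x * y)%g = PSL2_mul (\pi_PSL2 x) (\pi_PSL2 y).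
Proof.
apply/esym/PSL2_piP; case: (PSL2_reprP x) => ->; case: (PSL2_reprP y) => ->;
  rewrite ?SL2_mulN ?SL2_mulNg ?SL2_oppK; tauto.
Qed.

Lemma PSL2_pi_inv x : \pi_PSL2 (x^-1)%g = PSL2_inv (\pi_PSL2 x).
Proof.
apply/esym/PSL2_piP; case: (PSL2_reprP x) => ->; [by left|right].
apply: (@mulgI _ (SL2_opp x)); rewrite mulgV SL2_mulN SL2_mulNg SL2_oppK.
by rewrite mulgV.
Qed.

Fact PSL2_mulA : associative PSL2_mul.
Proof.
move=> a b c; rewrite -[a]reprK -[b]reprK -[c]reprK.
rewrite -(PSL2_pi_mul (repr b) (repr c)) -(PSL2_pi_mul (repr a) (repr b)).
by rewrite -(PSL2_pi_mul (repr a)) -(PSL2_pi_mul _ (repr c)) mulgA.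
Qed.
Fact PSL2_mul1 : left_id PSL2_one PSL2_mul.
Proof. by move=> a; rewrite -[a]reprK -PSL2_pi_mul mul1g. Qed.
Fact PSL2_mulr1 : right_id PSL2_one PSL2_mul.
Proof. by move=> a; rewrite -[a]reprK -PSL2_pi_mul mulg1. Qed.
Fact PSL2_mulV : left_inverse PSL2_one PSL2_inv PSL2_mul.
Proof. by move=> a; rewrite -[a]reprK -PSL2_pi_inv -PSL2_pi_mul mulVg. Qed.
Fact PSL2_mulrV : right_inverse PSL2_one PSL2_inv PSL2_mul.
Proof. by move=> a; rewrite -[a]reprK -PSL2_pi_inv -PSL2_pi_mul mulgV. Qed.

HB.instance Definition _ := isGroup.Build PSL2
  PSL2_mulA PSL2_mul1 PSL2_mulr1 PSL2_mulV PSL2_mulrV.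

Lemma SL2_opp_continuous : continuous (@SL2_opp R).
Proof.
apply: SL2_continuous => i j.
have -> : (fun x : SL2 R => SL2_mx (SL2_opp x) i j) = (fun x => - SL2_mx x i j).
  by apply/funext => x; rewrite mxE.
by move=> x; apply: continuousN; exact: SL2_coord_continuous.
Qed.

Lemma PSL2_pi_open (U : set (SL2 R)) : open U -> open (\pi_PSL2 @` U).
Proof.
move=> oU; suff : open (\pi_PSL2 @^-1` (\pi_PSL2 @` U)) by [].
have -> : \pi_PSL2 @^-1` (\pi_PSL2 @` U) = U `|` @SL2_opp R @^-1` U.
  apply/seteqP; split => [x [y Uy /esym/PSL2_piP[->|->]]|x [Ux|Ux]]; first by left.
  - by right; rewrite /= SL2_oppK.
  - by exists x.
  - by exists (SL2_opp x) => //; apply/PSL2_piP; right.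
apply: openU => //; apply: open_comp => // x _; exact: SL2_opp_continuous.
Qed.

Lemma PSL2_mulg_continuous :
  continuous (fun z : PSL2 * PSL2 => (z.1 * z.2)%g).
Proof.
move=> [a b] W; rewrite -[a]reprK -[b]reprK /=.
move: (repr a) (repr b) => {a b} x y; rewrite -[(_ * _)%g]PSL2_pi_mul => /pi_continuous/(@SL2_mulg_continuous R (x, y))[[U V]/= [xU yV UV]].
move: xU; rewrite {1}nbhsE => -[U' [oU' U'x] U'U].
move: yV; rewrite {1}nbhsE => -[V' [oV' V'y] V'V].
exists (\pi_PSL2 @` U', \pi_PSL2 @` V').
  split; apply: open_nbhs_nbhs; split; [exact: PSL2_pi_open|by exists x|
    exact: PSL2_pi_open|by exists y].
move=> [_ _] [/= [u /U'U Uu <-] [v /V'V Vv <-]].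
by rewrite -[(_ * _)%g]PSL2_pi_mul; exact: (UV (u, v)).
Qed.

Lemma PSL2_invg_continuous : continuous (fun a : PSL2 => (a^-1)%g).
Proof.
apply/quotient_continuous.
have -> : (fun a : PSL2 => (a^-1)%g) \o \pi = \pi_PSL2 \o (fun x => x^-1)%g.
  by apply/funext => x /=; rewrite PSL2_pi_inv.
move=> x; apply: continuous_comp; first exact: SL2_invg_continuous.
exact: pi_continuous.
Qed.

HB.instance Definition _ := isTopologicalGroup.Build PSL2
  PSL2_mulg_continuous PSL2_invg_continuous.

End PSL2_def.

Section covering.
Variables X Y : topologicalType.

Definition homeomorphism_on (A : set X) (B : set Y) (f : X -> Y) : Prop :=
  exists g : Y -> X,
    [/\ set_fun A B f, set_fun B A g,
        (forall x, A x -> g (f x) = x) /\ (forall y, B y -> f (g y) = y),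
        {within A, continuous f} & {within B, continuous g}].

(* The fibre over U is the disjoint union of the open sheets in F. *)
Definition evenly_covered (f : X -> Y) (U : set Y) : Prop :=
  exists F : set (set X),
    [/\ f @^-1` U = \bigcup_(V in F) V,
        trivIset F id
      & forall V, F V -> open V /\ homeomorphism_on V U f].

Definition covering_map (f : X -> Y) : Prop :=
  [/\ continuous f, (forall y, exists x, f x = y)
    & forall y, exists U : set Y, [/\ open U, U y & evenly_covered f U]].

End covering.

Section simply_connected.
Variables (R : realType) (X : topologicalType).

(* Paths are maps R -> X of which only the restriction to [0, 1] matters. *)
Definition path_connected : Prop :=
  forall x y : X, exists c : R -> X,
    [/\ {within `[0, 1], continuous c}, c 0 = x & c 1 = y].

(* The homotopy h contracts the loop c to a point, relatively to the base
   point; the first variable of h is the time of the homotopy. *)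
Definition null_homotopic (c : R -> X) : Prop :=
  exists h : R * R -> X,
    [/\ {within `[0, 1] `*` `[0, 1], continuous h},
        (forall t, t \in `[0, 1] -> h (0, t) = c t),
        (forall t, t \in `[0, 1] -> h (1, t) = c 0)
      & (forall s, s \in `[0, 1] -> h (s, 0) = c 0 /\ h (s, 1) = c 0)].

Definition simply_connected : Prop :=
  path_connected /\
  forall c : R -> X, {within `[0, 1], continuous c} -> c 0 = c 1 ->
    null_homotopic c.

End simply_connected.

(* The universal cover as a topological group: p is also a group morphism. *)
Definition universal_cover (R : realType) (G H : topologicalGroupType)
    (p : {multiplicative G -> H}) : Prop :=
  simply_connected R G /\ covering_map p.

(* G with its Borel sigma-algebra; the point required by measurable types is
   the unit of the group. *)
Definition borelType (G : topologicalGroupType) : Type := G.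

Section borel.
Variable G : topologicalGroupType.
HB.instance Definition _ := Choice.on (borelType G).
HB.instance Definition _ := isPointed.Build (borelType G) (1%g : G).
HB.instance Definition _ := @isMeasurable.Build
  (sigma_display (@open G)) (borelType G) <<s @open G >>
  (@sigma_algebra0 _ setT (@open G)) (@sigma_algebraC (borelType G) (@open G))
  (@sigma_algebra_bigcup _ setT (@open G)).
End borel.

Section haar.
Variables (R : realType) (G : topologicalGroupType).
Local Open Scope ereal_scope.

Definition left_invariant (mu : set G -> \bar R) : Prop :=
  forall (g : G) (A : set G), <<s @open G >> A ->
    mu [set (g * a)%g | a in A] = mu A.

Definition outer_regular (mu : set G -> \bar R) : Prop :=
  forall A : set G, <<s @open G >> A ->
    mu A = ereal_inf [set mu U | U in [set U | open U /\ A `<=` U]].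

Definition inner_regular_open (mu : set G -> \bar R) : Prop :=
  forall U : set G, open U ->
    mu U = ereal_sup [set mu K | K in [set K | compact K /\ K `<=` U]].

(* Right invariance is not required: it holds in unimodular groups only. *)
Definition haar_measure (mu : {measure set (borelType G) -> \bar R}) : Prop :=
  [/\ mu [set: G] != 0,
      left_invariant mu,
      (forall K : set G, compact K -> mu K < +oo),
      outer_regular mu
    & inner_regular_open mu].

End haar.

(* Main.v *)
(* The proof works in Iwasawa coordinates g = k(s) n(v) a(u) of G: k, n, a lift the
   one-parameter subgroups of PSL_2(R), and k is injective on the line because G
   is simply connected. In these coordinates the Haar measure of a slab
   {s in I, (u, v) in D} is |I| times a right Haar measure of D in the solvable
   group NA, and in the opposite coordinates g = n(v) a(u) k(t) it is |I| times a
   left Haar measure of D; the two differ by the factor e^u. X is approximated by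
   boxes in the first coordinates and Y by boxes in the opposite ones, so that
   products have the form k(s) n(x) a(u1) a(u2) n(y) k(t). The boxes of X and Y are
   cut into slabs which are matched monotonically, first along K and then along A,
   with a constant ratio of masses. Monotone matching keeps the partial products
   disjoint, and for a pair of matched boxes the factors e^u only cost a factor
   close to 1, so the bound is Hoelder's inequality
   (x1 + y1) (x2 + y2) (x3 + y3) >= ((x1 x2 x3)^(1/3) + (y1 y2 y3)^(1/3))^3.
   Outer regularity passes from neighbourhoods of XY to XY. *)

Require Import Defs.
From HB Require Import structures.
From mathcomp Require Import all_boot all_order all_algebra.
From mathcomp Require Import all_classical all_reals all_analysis.
From mathcomp Require Import measurable_realfun.
From mathcomp Require Import ring lra.

Set Implicit Arguments.
Unset Strict Implicit.
Unset Printing Implicit Defensive.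

Import Order.TTheory GRing.Theory Num.Theory.
Import numFieldNormedType.Exports.

Local Open Scope classical_set_scope.
Local Open Scope ring_scope.

(** * Lifting through coverings of topological groups *)

Section locally_constant.
Context {R : realType}.

(** The obstacle is that NA is not unimodular. Let a matched pair of boxes have lengths i and i'
    along K, and let D collect products of their parts in NA. Rotating the first factor sweeps out i
    times the right Haar measure of D, rotating the second one i' times its left Haar measure, so
    both measures of the same D must be bounded together. Near a given u, with lengths l and l'
    along A and fibres E and F in N, the sum is about (i + e^(-u) i') (|E| + e^u |F|) (l + l'). The
    exponential cancels in the product i' |F| l', so Hoelder's inequality with one factor for each
    of K, A and N sees only the masses of the two boxes; whence the exponent 1/3. Over one pair u
    varies by at most 2 d, where d is the mesh: this is the origin of the factor e^(-2 d), which
    tends to 1 with the mesh. For a fixed ratio of masses the bound for a pair is a constant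
    multiple of its mass, so adding over pairs loses nothing. Matching needs an order on the
    rotation coordinate, which is why K has to be unrolled into a line. *)

Lemma locally_constant_R (T : Type) (f : R -> T) :
  (forall x, \forall y \near x, f y = f x) -> forall x y, f x = f y.
Proof.
move=> lc x y; suff : [set z | f z = f x] = setT by move=> /seteqP[_ /(_ y I)].
have /connected_intervalP : is_interval [set: R] by [].
apply; first by exists x.
- exists [set z | f z = f x]; last by rewrite setTI.
  rewrite openE => z /= fz; rewrite /interior.
  by apply: filterS (lc z) => w /= ->.
- exists [set z | f z = f x]; last by rewrite setTI.
  rewrite -openC openE => z /= fz; rewrite /interior.
  by apply: filterS (lc z) => w /= ->.
Qed.

Lemma locally_constant_prop (P : R -> Prop) :
  (forall x, \forall y \near x, P y <-> P x) -> forall x y, P x -> P y.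
Proof.
move=> lc x y; rewrite (@locally_constant_R _ P _ x y) // => z.
by apply: filterS (lc z) => w ?; exact/propext.
Qed.

(** Paths and homotopies are continuous only within a segment or a square; composing with this
    retraction extends them continuously to the whole line or plane. *)
Definition clamp (a b t : R) : R := Num.max a (Num.min b t).

Lemma clamp_continuous a b : continuous (clamp a b).
Proof.
move=> t; apply: (@continuous_max R R (fun=> a) (fun t => Num.min b t)).
  exact: cst_continuous.
by apply: (@continuous_min R R (fun=> b) id); [exact: cst_continuous|].
Qed.

Lemma clamp_itv a b t : a <= b -> a <= clamp a b t <= b.
Proof.
by move=> ab; rewrite /clamp le_max lexx /= ge_max ab ge_min lexx.
Qed.

Lemma clamp_id a b t : a <= t <= b -> clamp a b t = t.
Proof. by move=> /andP[at_ tb]; rewrite /clamp min_r// max_r. Qed.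

Lemma normr_clamp d t : 0 <= d -> `|clamp (- d) d t| <= d.
Proof. by move=> d0; rewrite ler_norml clamp_itv// ge0_cp. Qed.

End locally_constant.

Lemma continuous_comp_within (T X Y : topologicalType) (A : set X) (f : X -> Y)
    (g : T -> X) : {within A, continuous f} -> continuous g ->
  (forall t, A (g t)) -> continuous (f \o g).
Proof.
move=> /subspace_continuousP cf cg Ag t W /= fW.
have wW : nbhs (g t) (fun x => A x -> W (f x)) := cf (g t) (Ag t) W fW.
have gW : \forall s \near t, A (g s) -> W (f (g s)) := cg t _ wW.
by apply: filterS gW => s /(_ (Ag s)).
Qed.

Lemma continuous_pair (T X Y : topologicalType) (f : T -> X) (g : T -> Y) x :
  {for x, continuous f} -> {for x, continuous g} ->
  {for x, continuous (fun t => (f t, g t))}.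
Proof. by move=> cf cg; exact: cvg_pair. Qed.

Section topological_group.
Variable G : topologicalGroupType.

Lemma continuous_mulg (T : topologicalType) (f g : T -> G) x :
  {for x, continuous f} -> {for x, continuous g} ->
  {for x, continuous (fun t => f t * g t)%g}.
Proof.
move=> cf cg; apply: (@continuous_comp _ _ _ (fun t => (f t, g t))
  (fun z : G * G => (z.1 * z.2)%g)); last exact: mulg_continuous.
exact: continuous_pair.
Qed.

Lemma continuous_invg (T : topologicalType) (f : T -> G) x :
  {for x, continuous f} -> {for x, continuous (fun t => (f t)^-1)%g}.
Proof.
move=> cf; apply: (@continuous_comp _ _ _ f (fun z : G => (z^-1)%g)) => //.
exact: invg_continuous.
Qed.

End topological_group.

Section one_parameter.
Context {R : realType} (G : groupType) (f : R -> G).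
Hypothesis fD : forall s t, f (s + t) = (f s * f t)%g.

Lemma hom0 : f 0 = 1%g.
Proof. by apply: (@mulgI _ (f 0)); rewrite -fD addr0 mulg1. Qed.

Lemma homN t : f (- t) = ((f t)^-1)%g.
Proof. by apply: (@mulgI _ (f t)); rewrite -fD subrr hom0 mulgV. Qed.

End one_parameter.

Section covering_morphism.
Context {R : realType} (G H : topologicalGroupType).
Variable p : {multiplicative G -> H}.
Hypothesis cover_p : covering_map p.

Let pM x y : p (x * y)%g = (p x * p y)%g. Proof. exact: gmulfM. Qed.

Lemma morph1 : p 1%g = 1%g.
Proof. by apply: (@mulgI _ (p 1%g)); rewrite -pM !mulg1. Qed.

Lemma morphV x : p (x^-1)%g = ((p x)^-1)%g.
Proof. by apply: (@mulgI _ (p x)); rewrite -pM !mulgV morph1. Qed.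

(** The sheet through [x] carries a section of [p]. Fibres are thus discrete, which is what all the
    lifting arguments below rest on. *)
Lemma covering_locally_injective (x : G) :
  \forall y \near x, p y = p x -> y = x.
Proof.
case: cover_p => _ _ /(_ (p x))[U [oU Ux [F [FU tF sheet]]]].
have : (\bigcup_(V in F) V) x by rewrite -FU.
case=> V FV Vx; have [oV [g [_ _ [gK _] _ _]]] := sheet _ FV.
have : \forall y \near x, V y by exact: open_nbhs_nbhs.
by apply: filterS => y Vy pyx; rewrite -(gK _ Vy) pyx gK.
Qed.

Lemma kernel_valued_constant (T : topologicalType) (c : T -> G) x :
  {for x, continuous c} -> (\forall y \near x, p (c y) = p (c x)) ->
  \forall y \near x, c y = c x.
Proof.
move=> cx pc; have := cx _ (covering_locally_injective (c x)).
by apply: filterS2 pc => y pc; exact.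
Qed.

Lemma fibre_path_constant (c : R -> G) :
  continuous c -> (forall t, p (c t) = p (c 0)) -> forall t, c t = c 0.
Proof.
move=> cc pc t; apply: locally_constant_R => x.
have near_pc : \forall y \near x, p (c y) = p (c x) by apply: filterE => y; rewrite !pc.
exact: (kernel_valued_constant (cc x) near_pc).
Qed.

Lemma local_section : exists2 U : set H, open_nbhs 1%g U & exists g : H -> G,
  [/\ g 1%g = 1%g, forall y, U y -> p (g y) = y
    & forall y, U y -> {for y, continuous g}].
Proof.
case: cover_p => _ _ /(_ 1%g)[U [oU U1 [F [FU tF sheet]]]].
have : (\bigcup_(V in F) V) 1%g by rewrite -FU /= morph1.
case=> V FV V1; have [oV [g [_ _ [gK Kg] _ cg]]] := sheet _ FV.
exists U => //; exists g; split=> [|//|y Uy]; first by rewrite -morph1 gK.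
by move: cg; rewrite continuous_open_subspace// => /(_ y); apply; rewrite inE.
Qed.

Variable f : R -> H.
Hypothesis cf : continuous f.
Hypothesis fD : forall s t, f (s + t) = (f s * f t)%g.

Let local_lift : exists2 d : R, 0 < d & exists g : R -> G,
  [/\ continuous g, g 0 = 1%g & forall t, `|t| <= d -> p (g t) = f t].
Proof.
have [U [oU U1] [g [g1 gU cg]]] := local_section.
have : nbhs (f 0) U by rewrite (hom0 fD); exact: open_nbhs_nbhs.
move=> /(cf (x := 0))/nbhs_ballP[e /= e0 eU].
have fU t : `|t| <= e / 2 -> U (f t).
  move=> te; apply: eU; rewrite /ball/= sub0r normrN.
  by rewrite (le_lt_trans te)// ltr_pdivrMr// ltr_pMr// ltr1n.
have cU t : U (f (clamp (- (e / 2)) (e / 2) t)).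
  by apply: fU; apply: normr_clamp; rewrite divr_ge0// ltW.
exists (e / 2); first by rewrite divr_gt0.
exists (fun t => g (f (clamp (- (e / 2)) (e / 2) t))); split.
- move=> t; apply: (@continuous_comp _ _ _ (f \o clamp (- (e / 2)) (e / 2)) g).
    by apply: continuous_comp; [exact: clamp_continuous|exact: cf].
  exact: cg (cU t).
- by rewrite clamp_id ?(hom0 fD)// oppr_le0 divr_ge0 ?ltW.
- by move=> t te; rewrite gU ?clamp_id -?ler_norml//; exact: fU.
Qed.

(** A local lift [g] is additive near 0 because the fibres are discrete. It is extended by F(t) =
    g(t / 2^n)^(2^n), which does not depend on n once |t| / 2^n is at most [d]. *)
Lemma one_parameter_lift : exists F : R -> G,
  [/\ continuous F, (forall s t, F (s + t) = (F s * F t)%g)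
    & forall t, p (F t) = f t].
Proof.
have [d d0 [g [cg g0 pg]]] := local_lift.
have gD s t : `|s| <= d / 2 -> `|t| <= d / 2 -> g (s + t) = (g s * g t)%g.
  move=> sd td.
  (* At [a = 1] this is the defect of additivity, at [a = 0] it is 1; as a path in the kernel of [p]
     it is constant. *)
  pose c (a : R) := ((g (clamp (- 1) 1 a * s)%R * g (clamp (- 1) 1 a * t)%R)
               * (g (clamp (- 1) 1 a * s + clamp (- 1) 1 a * t)%R)^-1)%g.
  have cc : continuous c.
    have ca x : continuous (fun a => clamp (- 1) 1 a * x).
      move=> a; apply: (@continuousM _ _ (clamp (- 1) 1) (cst x)).
        exact: clamp_continuous.
      exact: cst_continuous.
    move=> a; apply: (@continuous_mulg G R
      (fun a => g (clamp (- 1) 1 a * s)%R * g (clamp (- 1) 1 a * t)%R)%g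
      (fun a => (g (clamp (- 1) 1 a * s + clamp (- 1) 1 a * t)%R)^-1)%g).
      apply: (@continuous_mulg G R (fun a => g (clamp (- 1) 1 a * s)%R)).
        by apply: continuous_comp; [exact: ca|exact: cg].
      by apply: continuous_comp; [exact: ca|exact: cg].
    apply: continuous_invg; apply: (@continuous_comp _ _ _
      (fun a => clamp (- 1) 1 a * s + clamp (- 1) 1 a * t) g); last exact: cg.
    by apply: (@continuousD _ _ _ (fun a => clamp (- 1) 1 a * s)); exact: ca.
  have ps x a : `|x| <= d / 2 -> `|clamp (- 1) 1 a * x| <= d / 2.
    move=> xd; rewrite normrM (le_trans _ xd)// ler_piMl//.
    exact: normr_clamp.
  have pc a : p (c a) = 1%g.
    have sa := ps s a sd; have ta := ps t a td.
    have sta := ler_normD (clamp (- 1) 1 a * s) (clamp (- 1) 1 a * t).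
    by rewrite /c pM morphV pM !pg ?fD ?mulgV//; lra.
  have := fibre_path_constant cc (fun t => etrans (pc t) (esym (pc 0))) 1.
  rewrite /c (@clamp_id _ _ _ 0) ?(@clamp_id _ _ _ 1) ?lerN10 ?ler01 ?lexx ?ge0_cp//.
  by rewrite !mul1r !mul0r addr0 g0 !mulg1 mulgV => /divg1_eq.
have g2 n t : `|t| <= d -> g t = (g (t / 2 ^+ n)%R ^+ (2 ^ n)%N)%g.
  elim: n t => [|n IH] t td; first by rewrite expr0 divr1 expn0 expg1.
  rewrite IH// expnS mulnC expgnA expgnAC; congr (_ ^+ _)%g.
  have -> : t / 2 ^+ n = t / 2 ^+ n.+1 + t / 2 ^+ n.+1.
    by rewrite exprS; field; rewrite expf_neq0.
  have td' : `|t / 2 ^+ n.+1| <= d / 2.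
    have -> : t / 2 ^+ n.+1 = t / 2 / 2 ^+ n by rewrite exprS invfM mulrA.
    rewrite normrM normrM !normfV normrX (@ger0_norm _ 2)//.
    rewrite (@le_trans _ _ (`|t| / 2))//; last by lra.
    by rewrite ler_piMr ?divr_ge0// invf_le1 ?exprn_gt0// exprn_ege1// ler1n.
  by rewrite gD// expg2.
have small (t : R) : exists n, `|t| / 2 ^+ n <= d.
  have [n nt] : exists n : nat, `|t| / d < n%:R.
    by exists (Num.trunc (`|t| / d)).+1; rewrite truncnS_gt.
  exists n; rewrite ler_pdivrMr ?exprn_gt0// mulrC -ler_pdivrMr//.
  rewrite (le_trans (ltW nt))// -natrX ler_nat ltnW// ltn_expl//.
have norm_half (t : R) n m : (n <= m)%N -> `|t| / 2 ^+ n <= d -> `|t / 2 ^+ m| <= d.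
  move=> nm; apply: le_trans; rewrite normrM normfV normrX (@ger0_norm _ 2)//.
  rewrite ler_wpM2l// lef_pV2 ?posrE ?exprn_gt0//.
  by rewrite ler_weXn2l// ler1n.
have [N HN] := choice small.
pose F t := (g (t / 2 ^+ N t)%R ^+ (2 ^ N t)%N)%g.
have FE t n : (N t <= n)%N -> F t = (g (t / 2 ^+ n)%R ^+ (2 ^ n)%N)%g.
  move=> Nn; rewrite /F (g2 (n - N t)%N); last exact: (norm_half _ (N t)).
  rewrite -expgnA -expnD subnK// -mulrA -invfM -exprD.
  by rewrite addnC subnK.
have Fg t : `|t| <= d -> F t = g t by move=> td; rewrite /F -g2.
have FD s t : F (s + t) = (F s * F t)%g.
  (* The successor halves once more: [gD] needs arguments of norm at most [d / 2], whereas the [N]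
     only ensure [d]. *)
  pose n := (maxn (N (s + t)) (maxn (N s) (N t))).+1.
  rewrite (@FE (s + t) n) ?(@FE s n) ?(@FE t n)//; last first.
  - by rewrite leqW// leq_maxl.
  - by rewrite leqW// !leq_max leqnn orbT.
  - by rewrite leqW// !leq_max leqnn !orbT.
  have half (x : R) : (N x < n)%N -> `|x / 2 ^+ n| <= d / 2.
    move=> xn; rewrite /n exprSr invfM mulrA normrM normfV (@ger0_norm _ 2)//.
    by rewrite ler_pM2r// (norm_half _ (N x)).
  have sn : `|s / 2 ^+ n| <= d / 2.
    by apply: half; rewrite ltnS !leq_max leqnn !orbT.
  have tn : `|t / 2 ^+ n| <= d / 2.
    by apply: half; rewrite ltnS !leq_max leqnn !orbT.
  rewrite mulrDl gD// expgMn// /commute -!gD// addrC//.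
have pF t : p (F t) = f t.
  rewrite /F; set n := N t.
  have : `|t / 2 ^+ n| <= d by exact: (norm_half _ n).
  have [x xE] : exists x, x = t / 2 ^+ n by exists (t / 2 ^+ n).
  rewrite -xE => xd.
  have pX k : p (g x ^+ k)%g = f (k%:R * x).
    elim: k => [|k IH]; first by rewrite mul0r expg0 morph1 (hom0 fD).
    by rewrite expgS pM IH pg// -fD -natr1 mulrDl mul1r addrC.
  rewrite pX natrX xE mulrC divfK// expf_neq0//.
exists F; split => // t.
have cF0 : {for 0, continuous F}.
  suff : F @ 0 --> g 0 by rewrite -(Fg 0)// normr0 ltW.
  apply: cvg_trans (cg 0); apply: near_eq_cvg.
  have near_d : \forall x \near (0 : R), `|x| < d by exact: nbhs0_lt.
  by apply: filterS near_d => x /ltW /Fg.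
(* Translation carries continuity at 0 over to [t]. *)
have -> : F = (fun s => F t * F (s - t)%R)%g.
  by apply/funext => s; rewrite -FD addrC subrK.
apply: (@continuous_mulg G R (fun=> F t) (fun s => F (s - t)%R)).
  exact: cst_continuous.
apply: (@continuous_comp _ _ _ (fun s => s - t) F).
  by apply: continuousB; [|exact: cst_continuous].
by rewrite /= subrr.
Qed.

End covering_morphism.

(** * Iwasawa coordinates on PSL2(R) *)

Section SL2_coordinates.
Variable R : realType.

Definition mx22 (a b c d : R) : 'M[R]_2 := \matrix_(i, j)
  if i == 0 then if j == 0 then a else b else if j == 0 then c else d.

Lemma mx22P (A B : 'M[R]_2) : A 0 0 = B 0 0 -> A 0 1 = B 0 1 ->
  A 1 0 = B 1 0 -> A 1 1 = B 1 1 -> A = B.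
Proof.
move=> e00 e01 e10 e11; apply/matrixP => i j.
have ord2 (k : 'I_2) : k = 0 \/ k = 1.
  by case: k => [[|[|//]]] k2; [left|right]; exact/val_inj.
by case: (ord2 i) => ->; case: (ord2 j) => ->.
Qed.

Lemma mulmx22 (A B : 'M[R]_2) i j :
  (A *m B) i j = A i 0 * B 0 j + A i 1 * B 1 j.
Proof.
rewrite mxE !big_ord_recl big_ord0 addr0.
by congr (_ + A _ _ * B _ _); exact/val_inj.
Qed.

Lemma det22 (A : 'M[R]_2) : \det A = A 0 0 * A 1 1 - A 0 1 * A 1 0.
Proof.
rewrite (expand_det_row _ 0) !big_ord_recl big_ord0 addr0 /cofactor !det_mx11.
rewrite !mxE /= expr0 expr1 mul1r mulN1r mulrN.
by congr (_ * A _ _ - A _ _ * A _ _); exact/val_inj.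
Qed.

Lemma det_mx22 a b c d : \det (mx22 a b c d) = a * d - b * c.
Proof. by rewrite det22 !mxE. Qed.

Fact rot_subproof s : \det (mx22 (cos s) (- sin s) (sin s) (cos s)) == 1.
Proof. by rewrite det_mx22 mulNr opprK -!expr2 cos2Dsin2. Qed.
Definition rot s := MkSL2 (rot_subproof s).

Fact uni_subproof v : \det (mx22 1 v 0 1) == 1.
Proof. by rewrite det_mx22 mulr0 subr0 mulr1. Qed.
Definition uni v := MkSL2 (uni_subproof v).

Fact dia_subproof u : \det (mx22 (expR (u / 2)) 0 0 (expR (- (u / 2)))) == 1.
Proof. by rewrite det_mx22 mul0r subr0 -expRD subrr expR0. Qed.
(** The halves normalise the conjugation action on [uni] to multiplication by [expR u]. *)
Definition dia u := MkSL2 (dia_subproof u).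

Lemma rotD s t : rot (s + t) = (rot s * rot t)%g.
Proof.
apply/val_inj/mx22P; rewrite [RHS]mulmx22 !mxE/= ?cosD ?sinD; ring.
Qed.

Lemma uniD s t : uni (s + t) = (uni s * uni t)%g.
Proof. by apply/val_inj/mx22P; rewrite [RHS]mulmx22 !mxE/=; ring. Qed.

Lemma diaD s t : dia (s + t) = (dia s * dia t)%g.
Proof.
apply/val_inj/mx22P; rewrite [RHS]mulmx22 !mxE/= ?mulr0 ?mul0r ?addr0 ?add0r//.
- by rewrite -expRD mulrDl.
- by rewrite -expRD mulrDl opprD.
Qed.

Lemma dia_uni u v : (dia u * uni v)%g = (uni (expR u * v) * dia u)%g.
Proof.
apply/val_inj/mx22P; rewrite [LHS]mulmx22 [RHS]mulmx22 !mxE/=;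
  rewrite ?(mulr0, mul0r, addr0, add0r, mulr1, mul1r)//.
rewrite mulrAC -expRD; congr (expR _ * _); lra.
Qed.

(** The quarter turn is a Weyl element: it inverts the diagonal subgroup, which will force the
    modular function to be trivial there. *)
Lemma rotpi2_dia u : (rot (pi / 2) * dia u)%g = (dia (- u) * rot (pi / 2))%g.
Proof.
apply/val_inj/mx22P; rewrite [LHS]mulmx22 [RHS]mulmx22 !mxE/=;
  rewrite cos_pihalf sin_pihalf ?(mulr0, mul0r, addr0, add0r, mulr1, mul1r)//.
- by rewrite mulN1r mulrN1 mulNr.
- by rewrite mulNr opprK.
Qed.

(** The first column of k(s) n(v) a(u) is e^(u/2) (cos s, sin s), so its squared norm is e^u, and
    the inner product of the two columns is v. Only functions even in the matrix descend to PSL_2,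
    so the angle is visible through its double, by [cos2] and [sin2], or through its tangent
    [ratio]. *)
Definition lnr (x : SL2 R) : R := ln (x 0 0 ^+ 2 + x 1 0 ^+ 2).
Definition shear (x : SL2 R) : R := x 0 0 * x 0 1 + x 1 0 * x 1 1.
Definition ratio (x : SL2 R) : R := x 1 0 / x 0 0.
Definition cos2 (x : SL2 R) : R :=
  (x 0 0 ^+ 2 - x 1 0 ^+ 2) / (x 0 0 ^+ 2 + x 1 0 ^+ 2).
Definition sin2 (x : SL2 R) : R :=
  (2 * x 0 0 * x 1 0) / (x 0 0 ^+ 2 + x 1 0 ^+ 2).

Lemma column_gt0 (x : SL2 R) : 0 < x 0 0 ^+ 2 + x 1 0 ^+ 2.
Proof.
rewrite lt_neqAle addr_ge0 ?sqr_ge0// andbT eq_sym paddr_eq0 ?sqr_ge0//.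
rewrite !sqrf_eq0; apply/negP => /andP[/eqP x0 /eqP x1].
have := det_SL2 x; rewrite det22 x0 x1 mul0r mulr0 subr0 => /eqP.
by rewrite eq_sym oner_eq0.
Qed.

Lemma SL2_mulE (x y : SL2 R) i j :
  (x * y)%g i j = x i 0 * y 0 j + x i 1 * y 1 j.
Proof. exact: mulmx22. Qed.

Lemma iwasawaE s v u (x := (rot s * (uni v * dia u))%g) :
  [/\ x 0 0 = cos s * expR (u / 2), x 1 0 = sin s * expR (u / 2),
      x 0 1 = (cos s * v - sin s) * expR (- (u / 2))
    & x 1 1 = (sin s * v + cos s) * expR (- (u / 2))].
Proof.
by split; rewrite /x !SL2_mulE !mxE/=; ring.
Qed.

Lemma iwasawa_coordinates s v u (x := (rot s * (uni v * dia u))%g) :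
  [/\ lnr x = u, shear x = v, ratio x = tan s,
      cos2 x = cos (2 * s) & sin2 x = sin (2 * s)].
Proof.
have [e00 e10 e01 e11] := iwasawaE s v u; rewrite -/x in e00 e01 e10 e11.
have sq : x 0 0 ^+ 2 + x 1 0 ^+ 2 = expR u.
  rewrite e00 e10 !exprMn -mulrDl cos2Dsin2 mul1r expr2 -expRD.
  by congr expR; lra.
have ee : expR (u / 2) * expR (- (u / 2)) = 1 by rewrite -expRD subrr expR0.
have e2 : expR (u / 2) ^+ 2 = expR u by rewrite expr2 -expRD; congr expR; lra.
have tr := cos2Dsin2 s.
split.
- by rewrite /lnr sq expRK.
- rewrite /shear e00 e10 e01 e11.
  transitivity ((cos s ^+ 2 + sin s ^+ 2) * v
    * (expR (u / 2) * expR (- (u / 2)))); first by ring.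
  by rewrite tr ee; ring.
- by rewrite /ratio e00 e10 /tan -mulf_div divff ?mulr1// gt_eqF ?expR_gt0.
- rewrite /cos2 sq e00 e10 !exprMn e2 -mulrBl mulfK ?gt_eqF ?expR_gt0//.
  by rewrite mulrC mulr_natr cos_mulr2n sin2cos2; ring.
- have -> : sin2 x = 2 * cos s * sin s * expR (u / 2) ^+ 2 / expR u.
    by rewrite /sin2 sq e00 e10; congr (_ / _); ring.
  by rewrite e2 mulfK ?gt_eqF ?expR_gt0// (mulrC 2 s) mulr_natr sin_mulr2n; ring.
Qed.

(** The normalised first column is a unit vector and gives the angle; the second column is then
    determined by its inner product with the first one and by the determinant. *)
Lemma iwasawa (x : SL2 R) :
  exists s, x = (rot s * (uni (shear x) * dia (lnr x)))%g.
Proof.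
pose S := x 0 0 ^+ 2 + x 1 0 ^+ 2.
have S0 : 0 < S := column_gt0 x.
pose r := Num.sqrt S.
have r0 : 0 < r by rewrite sqrtr_gt0.
have r2 : r ^+ 2 = S by rewrite sqr_sqrtr// ltW.
have er : expR (lnr x / 2) = r.
  apply: (@pexpIrn _ 2); rewrite ?nnegrE ?expR_ge0 ?ltW//.
  by rewrite r2 expr2 -expRD -splitr lnK.
have [s cs ss] : exists2 s, cos s = x 0 0 / r & sin s = x 1 0 / r.
  have c2 : (x 0 0 / r) ^+ 2 + (x 1 0 / r) ^+ 2 = 1.
    by rewrite !expr_div_n -mulrDl r2 divff// gt_eqF.
  have c1 : -1 <= x 0 0 / r <= 1.
    by rewrite -ler_norml -(@expr_le1 _ 2)// real_normK ?num_real// -c2 lerDl sqr_ge0.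
  have sa : sin (acos (x 0 0 / r)) = `|x 1 0 / r|.
    by rewrite sin_acos// -c2 addrAC subrr add0r sqrtr_sqr.
  case: (lerP 0 (x 1 0 / r)) => x10.
    exists (acos (x 0 0 / r)); first by rewrite acosK.
    by rewrite sa ger0_norm.
  exists (- acos (x 0 0 / r)); first by rewrite cosN acosK.
  by rewrite sinN sa ltr0_norm// opprK.
exists s; have := iwasawaE s (shear x) (lnr x).
rewrite expRN er cs ss !divfK ?gt_eqF// => -[e00 e10 e01 e11].
have dx : x 0 0 * x 1 1 - x 0 1 * x 1 0 = 1 by rewrite -det22 det_SL2.
have rn0 : r != 0 by rewrite gt_eqF.
apply/val_inj/mx22P => /=; rewrite ?e00 ?e10 ?e01 ?e11//.
- have -> : (x 0 0 / r * shear x - x 1 0 / r) / r =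
    (x 0 0 * shear x - x 1 0) / r ^+ 2 by field.
  rewrite r2 /S /shear -[X in _ - X](mulr1 (x 1 0)) -dx.
  apply/(canRL (mulfK _)); rewrite ?gt_eqF//; ring.
- have -> : (x 1 0 / r * shear x + x 0 0 / r) / r =
    (x 1 0 * shear x + x 0 0) / r ^+ 2 by field.
  rewrite r2 /S /shear -[X in _ + X](mulr1 (x 0 0)) -dx.
  apply/(canRL (mulfK _)); rewrite ?gt_eqF//; ring.
Qed.


(** The tangent determines the angle modulo pi, that is, the rotation up to sign. *)
Lemma rot_atan_tan s : cos s != 0 ->
  rot (atan (tan s)) = rot s \/ rot (atan (tan s)) = SL2_opp (rot s).
Proof.
move=> c0; set t := atan (tan s).
have tt : tan t = tan s by rewrite /t atanK.
have ct0 : 0 < cos t.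
  by rewrite cos_gt0_pihalf// atan_gtNpi2 atan_ltpi2.
have cc : cos t ^+ 2 = cos s ^+ 2.
  apply/invr_inj; rewrite cos2_tan2 ?gt_eqF// tt -cos2_tan2//.
have st : sin t = tan s * cos t by rewrite -tt /tan divfK ?gt_eqF.
have ss : sin s = tan s * cos s by rewrite /tan divfK.
move/eqP: cc; rewrite eqf_sqr => /orP[]/eqP cE; [left|right].
  by apply/val_inj/mx22P; rewrite !mxE/= ?st ?ss cE.
apply/val_inj/mx22P; rewrite !mxE/= ?st ?ss cE//; ring.
Qed.

Lemma mx22_continuous (T : topologicalType) (a b c d : T -> R) (f : T -> SL2 R) :
  (forall t, SL2_mx (f t) = mx22 (a t) (b t) (c t) (d t)) ->
  continuous a -> continuous b -> continuous c -> continuous d -> continuous f.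
Proof.
move=> fE ca cb cc cd; apply: SL2_continuous => i j.
have -> : (fun t => f t i j) = (fun t => if i == 0 then
    if j == 0 then a t else b t else if j == 0 then c t else d t).
  by apply/funext => t; rewrite fE mxE.
by case: (i == 0); case: (j == 0).
Qed.

Lemma rot_continuous : continuous rot.
Proof.
apply: (@mx22_continuous _ cos (fun s => - sin s) sin cos) => //.
- exact: continuous_cos.
- by move=> s; apply: continuousN; exact: continuous_sin.
- exact: continuous_sin.
- exact: continuous_cos.
Qed.

Lemma uni_continuous : continuous uni.
Proof.
apply: (@mx22_continuous _ (fun=> 1) id (fun=> 0) (fun=> 1)) => // v;
  by [exact: cst_continuous|exact: cvg_id].
Qed.

Lemma dia_continuous : continuous dia.
Proof.
have c2 : continuous (fun u : R => u / 2).
  by move=> u; apply: (@continuousM _ _ id (cst 2^-1)) => //; exact: cst_continuous.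
apply: (@mx22_continuous R (fun u : R => expR (u / 2)) (fun=> 0) (fun=> 0)
  (fun u : R => expR (- (u / 2)))) => //.
- by move=> u; apply: continuous_comp; [exact: c2|exact: continuous_expR].
- by move=> u; exact: cst_continuous.
- by move=> u; exact: cst_continuous.
- move=> u; apply: (@continuous_comp _ _ _ (fun u : R => - (u / 2)) expR).
    by apply: continuousN; exact: c2.
  exact: continuous_expR.
Qed.

Lemma lnr_continuous : continuous lnr.
Proof.
move=> x; apply: (@continuous_comp (SL2 R) R R
  (fun x : SL2 R => x 0 0 ^+ 2 + x 1 0 ^+ 2) (@ln R)).
  by apply: continuousD; apply: continuousM; exact: SL2_coord_continuous.
exact/continuous_ln/column_gt0.
Qed.

Lemma shear_continuous : continuous shear.
Proof.
move=> x; apply: (@continuousD _ R (SL2 R) (fun x : SL2 R => x 0 0 * x 0 1)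
    (fun x : SL2 R => x 1 0 * x 1 1));
  by apply: continuousM; exact: SL2_coord_continuous.
Qed.

Let column_inv_continuous :
  continuous (fun x : SL2 R => (x 0 0 ^+ 2 + x 1 0 ^+ 2)^-1 : R).
Proof.
move=> x; apply: (@continuousV _ (SL2 R) (fun x : SL2 R => x 0 0 ^+ 2 + x 1 0 ^+ 2)).
  by rewrite gt_eqF// column_gt0.
by apply: continuousD; apply: continuousM; exact: SL2_coord_continuous.
Qed.

Lemma cos2_continuous : continuous cos2.
Proof.
move=> x; apply: (@continuousM _ (SL2 R) (fun x : SL2 R => x 0 0 ^+ 2 - x 1 0 ^+ 2)
    (fun x : SL2 R => (x 0 0 ^+ 2 + x 1 0 ^+ 2)^-1)).
  by apply: continuousB; apply: continuousM; exact: SL2_coord_continuous.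
exact: column_inv_continuous.
Qed.

Lemma sin2_continuous : continuous sin2.
Proof.
move=> x; apply: (@continuousM _ (SL2 R) (fun x : SL2 R => 2 * x 0 0 * x 1 0)
    (fun x : SL2 R => (x 0 0 ^+ 2 + x 1 0 ^+ 2)^-1)).
  apply: (@continuousM _ (SL2 R) (fun x : SL2 R => 2 * x 0 0)).
    apply: (@continuousM _ (SL2 R) (fun=> 2)); first exact: cst_continuous.
    exact: SL2_coord_continuous.
  exact: SL2_coord_continuous.
exact: column_inv_continuous.
Qed.

Lemma ratio_continuous (x : SL2 R) : x 0 0 != 0 -> {for x, continuous ratio}.
Proof.
move=> x0; apply: (@continuousM _ (SL2 R) (fun x : SL2 R => x 1 0)
    (fun x : SL2 R => (x 0 0)^-1)); first exact: SL2_coord_continuous.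
by apply: continuousV => //; exact: SL2_coord_continuous.
Qed.

Lemma coordinates_opp x : [/\ lnr (SL2_opp x) = lnr x,
  shear (SL2_opp x) = shear x, ratio (SL2_opp x) = ratio x,
  cos2 (SL2_opp x) = cos2 x & sin2 (SL2_opp x) = sin2 x].
Proof.
have E i j : SL2_opp x i j = - x i j by rewrite mxE.
rewrite /lnr /shear /ratio /cos2 /sin2 !E; split.
- by rewrite !sqrrN.
- by rewrite !mulrNN.
- by rewrite invrN mulrNN.
- by rewrite !sqrrN.
- by rewrite !sqrrN; congr (_ / _); ring.
Qed.

End SL2_coordinates.

(** * Coordinates on the quotient by the sign *)

Section PSL2_coordinates.
Variable R : realType.
Local Open Scope quotient_scope.
Local Notation proj := (fun x : SL2 R => \pi_(PSL2 R) x).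

Definition even (f : SL2 R -> R) := forall x, f (SL2_opp x) = f x.

Definition descend (f : SL2 R -> R) (a : PSL2 R) : R := f (repr a).

Lemma descendE f x : even f -> descend f (\pi_(PSL2 R) x) = f x.
Proof. by move=> fN; rewrite /descend; case: (PSL2_reprP x) => ->. Qed.

Lemma descend_continuous f : even f -> continuous f -> continuous (descend f).
Proof.
move=> fN cf; apply/(@quotient_continuous _ (PSL2 R)).
by have -> : descend f \o \pi_(PSL2 R) = f
  by apply/funext => x; exact: descendE.
Qed.

Definition pu (a : PSL2 R) := descend (@lnr R) a.
Definition pv (a : PSL2 R) := descend (@shear R) a.
Definition pcos (a : PSL2 R) := descend (@cos2 R) a.
Definition psin (a : PSL2 R) := descend (@sin2 R) a.
(** A local angle with values in the open interval from - pi / 2 to pi / 2, to be used only where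
    [cos s != 0]. *)
Definition pangle (a : PSL2 R) := atan (descend (@ratio R) a).

Lemma pu_continuous : continuous pu.
Proof.
by apply: descend_continuous => [x|]; [case: (coordinates_opp x)|exact: lnr_continuous].
Qed.

Lemma pv_continuous : continuous pv.
Proof.
by apply: descend_continuous => [x|]; [case: (coordinates_opp x)|exact: shear_continuous].
Qed.

Lemma pcos_continuous : continuous pcos.
Proof.
by apply: descend_continuous => [x|]; [case: (coordinates_opp x)|exact: cos2_continuous].
Qed.

Lemma psin_continuous : continuous psin.
Proof.
by apply: descend_continuous => [x|]; [case: (coordinates_opp x)|exact: sin2_continuous].
Qed.

Definition pk (s : R) : PSL2 R := \pi_(PSL2 R) (rot s).
Definition pn (v : R) : PSL2 R := \pi_(PSL2 R) (uni v).
Definition pa (u : R) : PSL2 R := \pi_(PSL2 R) (dia u).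

Lemma pkD s t : pk (s + t) = (pk s * pk t)%g.
Proof. by rewrite /pk rotD; exact: PSL2_pi_mul. Qed.

Lemma pnD s t : pn (s + t) = (pn s * pn t)%g.
Proof. by rewrite /pn uniD; exact: PSL2_pi_mul. Qed.

Lemma paD s t : pa (s + t) = (pa s * pa t)%g.
Proof. by rewrite /pa diaD; exact: PSL2_pi_mul. Qed.

Lemma pk_continuous : continuous pk.
Proof.
move=> s; apply: (@continuous_comp _ _ _ (@rot R) proj); first exact: rot_continuous.
exact: pi_continuous.
Qed.

Lemma pn_continuous : continuous pn.
Proof.
move=> s; apply: (@continuous_comp _ _ _ (@uni R) proj); first exact: uni_continuous.
exact: pi_continuous.
Qed.

Lemma pa_continuous : continuous pa.
Proof.
move=> s; apply: (@continuous_comp _ _ _ (@dia R) proj); first exact: dia_continuous.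
exact: pi_continuous.
Qed.

Lemma pa_pn u v : (pa u * pn v)%g = (pn (expR u * v) * pa u)%g.
Proof.
rewrite -[LHS]PSL2_pi_mul -[RHS]PSL2_pi_mul; congr (\pi_(PSL2 R) _).
exact: dia_uni.
Qed.

Lemma pk_pihalf_pa u : (pk (pi / 2) * pa u)%g = (pa (- u) * pk (pi / 2))%g.
Proof.
rewrite -[LHS]PSL2_pi_mul -[RHS]PSL2_pi_mul; congr (\pi_(PSL2 R) _).
exact: rotpi2_dia.
Qed.

Lemma pE s v u :
  (pk s * (pn v * pa u))%g = \pi_(PSL2 R) (rot s * (uni v * dia u))%g.
Proof.
rewrite PSL2_pi_mul; congr (_ * _)%g; exact/esym/PSL2_pi_mul.
Qed.

Lemma PSL2_coordinates s v u (a := (pk s * (pn v * pa u))%g) :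
  [/\ pu a = u, pv a = v, pcos a = cos (2 * s), psin a = sin (2 * s)
    & cos s != 0 -> pk (pangle a) = pk s].
Proof.
rewrite /a pE; set x := (rot s * _)%g.
have [oe1 oe2 oe3 oe4 oe5] : [/\ even (@lnr R), even (@shear R),
    even (@ratio R), even (@cos2 R) & even (@sin2 R)].
  by split => y; case: (coordinates_opp y).
have [e1 e2 e3 e4 e5] := iwasawa_coordinates s v u.
rewrite /pu /pv /pcos /psin !descendE//; split => // c0.
rewrite /pangle descendE// e3; apply/PSL2_piP; exact: rot_atan_tan.
Qed.

Lemma PSL2_iwasawa (a : PSL2 R) :
  exists s, a = (pk s * (pn (pv a) * pa (pu a)))%g.
Proof.
rewrite -[a]reprK; set x := repr a; have [s xE] := iwasawa x.
exists s; rewrite pE.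
have := PSL2_coordinates s (shear x) (lnr x); rewrite pE -xE => -[e1 e2 _ _ _].
by rewrite e1 e2 -xE.
Qed.

Lemma pangle_continuous s v u (a := (pk s * (pn v * pa u))%g) :
  cos s != 0 -> {for a, continuous pangle}.
Proof.
move=> c0; rewrite /a pE; set x := (rot s * _)%g.
have x00 : x 0 0 != 0.
  by have [-> _ _ _] := iwasawaE s v u; rewrite mulf_neq0// gt_eqF ?expR_gt0.
have eN : even (@ratio R) by move=> y; case: (coordinates_opp y).
apply: (@continuous_comp _ _ _ (descend (@ratio R)) (@atan R)); last first.
  exact: continuous_atan.
move=> W /= ; rewrite descendE// => /(ratio_continuous x00).
rewrite nbhsE => -[V [oV Vx] VW].
have : nbhs (\pi_(PSL2 R) x : PSL2 R) ((\pi_(PSL2 R) : _ -> PSL2 R) @` V).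
  by apply: open_nbhs_nbhs; split; [exact: PSL2_pi_open|exists x].
apply: filterS => _ [y Vy <-] /=; rewrite descendE//; exact: VW.
Qed.

Lemma pangle0 v u : pangle (pk 0 * (pn v * pa u))%g = 0.
Proof.
rewrite pE /pangle descendE; last by move=> y; case: (coordinates_opp y).
by have [_ _ -> _ _] := iwasawa_coordinates 0 v u; rewrite tan0 atan0.
Qed.

Lemma pcos2Dpsin2 (a : PSL2 R) : pcos a ^+ 2 + psin a ^+ 2 = 1.
Proof.
have [s ->] := PSL2_iwasawa a.
by have [_ _ -> -> _] := PSL2_coordinates s (pv a) (pu a); rewrite cos2Dsin2.
Qed.

(** Conjugation by the quarter turn makes [pn v] lower triangular with corner entry - v up to sign,
    while the right-hand side is upper triangular. *)
Lemma lower_unipotent v v' u' :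
  (pk (pi / 2) * (pn v * pk (- (pi / 2))))%g = (pn v' * pa u')%g -> v = 0.
Proof.
rewrite -[(pn v * _)%g]PSL2_pi_mul -[(pk _ * _)%g]PSL2_pi_mul.
rewrite -[(pn _ * _)%g]PSL2_pi_mul => /PSL2_piP.
have E : (uni v' * dia u')%g 1 0 = 0 by rewrite SL2_mulE !mxE/=; ring.
have F : (rot (pi / 2) * (uni v * rot (- (pi / 2))))%g 1 0 = - v.
  rewrite !SL2_mulE !mxE/= sinN cosN sin_pihalf cos_pihalf; ring.
move=> [] xE; move: F; rewrite xE; last rewrite [LHS]mxE.
  by rewrite E => /esym/eqP; rewrite oppr_eq0 => /eqP.
by rewrite E oppr0 => /esym/eqP; rewrite oppr_eq0 => /eqP.
Qed.

End PSL2_coordinates.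

(** * The global chart of the universal cover *)

Section winding.
Variable R : realType.

(* A homotopy of loops on the unit circle that is constant at the end points
   rotates each loop by an angle that depends continuously on time. *)
Lemma circle_homotopy_lift (X Y : R * R -> R) :
  continuous X -> continuous Y -> (forall z, X z ^+ 2 + Y z ^+ 2 = 1) ->
  (forall s, (X (s, 0) = 1 /\ Y (s, 0) = 0) /\ (X (s, 1) = 1 /\ Y (s, 1) = 0)) ->
  exists L : R -> R, [/\ continuous L, L 0 = 0, L 1 = 0
    & forall t : R, 0 <= t <= 1 ->
      X (1, t) = X (0, t) * cos (L t) - Y (0, t) * sin (L t) /\
      Y (1, t) = X (0, t) * sin (L t) + Y (0, t) * cos (L t)].
Proof.
move=> cX cY XY1 endpoints.
pose rel s s' := exists L : R -> R, [/\ continuous L, L 0 = 0, L 1 = 0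
    & forall t : R, 0 <= t <= 1 ->
      X (s', t) = X (s, t) * cos (L t) - Y (s, t) * sin (L t) /\
      Y (s', t) = X (s, t) * sin (L t) + Y (s, t) * cos (L t)].
have rel_refl s : rel s s.
  exists (fun=> 0); split => // [x|t _]; first exact: cst_continuous.
  by rewrite cos0 sin0 !mulr1 !mulr0 subr0 add0r.
have rel_sym s s' : rel s s' -> rel s' s.
  move=> [L [cL L0 L1 LE]]; exists (fun t => - L t); split.
  - by move=> t; apply: continuousN; exact: cL.
  - by rewrite L0 oppr0.
  - by rewrite L1 oppr0.
  - move=> t /LE[-> ->]; rewrite cosN sinN.
    have c1 := cos2Dsin2 (L t); split.
      rewrite -[LHS]mulr1 -{1}c1; ring.
    rewrite -[LHS]mulr1 -{1}c1; ring.
have rel_trans s s' s'' : rel s s' -> rel s' s'' -> rel s s''.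
  move=> [L [cL L0 L1 LE]] [L' [cL' L0' L1' LE']].
  exists (fun t => L t + L' t); split.
  - by move=> t; apply: continuousD; [exact: cL|exact: cL'].
  - by rewrite L0 L0' addr0.
  - by rewrite L1 L1' addr0.
  - by move=> t t01; have [-> ->] := LE' _ t01; have [-> ->] := LE _ t01;
      rewrite cosD sinD; split; ring.
(* These are the cosine and the sine of the angle from loop [s] to loop [s']. Where the cosine is
   positive, the angle is the arctangent of their quotient, so it is continuous without any
   lifting. *)
pose dot s s' t := X (s, t) * X (s', t) + Y (s, t) * Y (s', t).
pose cross s s' t := X (s, t) * Y (s', t) - Y (s, t) * X (s', t).
have ct (F : R * R -> R) s : continuous F -> continuous (fun t => F (s, t)).
  move=> cF t; apply: (@continuous_comp _ _ _ (fun t => (s, t)) F); last exact: cF.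
  by apply: (@continuous_pair _ _ _ (fun=> s) id); [exact: cst_continuous|exact: cvg_id].
have dot_rel s s' : (forall t : R, 0 <= t <= 1 -> 0 < dot s s' t) -> rel s s'.
  move=> dot0; pose u (t : R) : R := clamp 0 1 t.
  have u01 t : 0 <= u t <= 1 by exact: clamp_itv.
  exists (fun t => atan (cross s s' (u t) / dot s s' (u t))); split.
  - have cu : continuous u by exact: clamp_continuous.
    have cF (F : R * R -> R) r : continuous F -> continuous (fun t => F (r, u t)).
      move=> cF t; apply: (@continuous_comp _ _ _ u (fun t => F (r, t))).
        exact: cu.
      exact: (ct F r cF).
    move=> t; apply: (@continuous_comp _ _ _
      (fun t => cross s s' (u t) / dot s s' (u t)) (@atan R)); last first.
      exact: continuous_atan.
    apply: (@continuousM _ _ (fun t => cross s s' (u t))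
      (fun t => (dot s s' (u t))^-1)).
      apply: (@continuousB _ _ _ (fun t => X (s, u t) * Y (s', u t))
        (fun t => Y (s, u t) * X (s', u t))).
        by apply: continuousM; exact: cF.
      by apply: continuousM; exact: cF.
    apply: continuousV; first by rewrite gt_eqF// dot0.
    apply: (@continuousD _ _ _ (fun t => X (s, u t) * X (s', u t))
        (fun t => Y (s, u t) * Y (s', u t))).
      by apply: continuousM; exact: cF.
    by apply: continuousM; exact: cF.
  - rewrite /u clamp_id ?lexx ?ler01// /cross.
    have [[-> ->] _] := endpoints s; have [[-> ->] _] := endpoints s'.
    by rewrite mulr0 mul0r subrr mul0r atan0.
  - rewrite /u clamp_id ?lexx ?ler01// /cross.
    have [_ [-> ->]] := endpoints s; have [_ [-> ->]] := endpoints s'.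
    by rewrite mulr0 mul0r subrr mul0r atan0.
  - move=> t t01; rewrite /u clamp_id//.
    have d0 := dot0 _ t01.
    have dc : dot s s' t ^+ 2 + cross s s' t ^+ 2 = 1.
      transitivity ((X (s, t) ^+ 2 + Y (s, t) ^+ 2) *
                    (X (s', t) ^+ 2 + Y (s', t) ^+ 2)).
        by rewrite /dot /cross; ring.
      by rewrite !XY1 mulr1.
    set a := atan _.
    have ca : cos a = dot s s' t.
      rewrite /a cos_atan expr_div_n.
      have -> : 1 + cross s s' t ^+ 2 / dot s s' t ^+ 2 = (dot s s' t)^-1 ^+ 2.
        rewrite exprVn -[RHS]mul1r -[in RHS]dc mulrDl divff// expf_neq0// gt_eqF//.
      by rewrite sqrtr_sqr gtr0_norm ?invr_gt0// invrK.
    have sa : sin a = cross s s' t.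
      have : tan a = cross s s' t / dot s s' t by rewrite /a atanK.
      by rewrite /tan ca => /(congr1 ( *%R^~ (dot s s' t))); rewrite !divfK// gt_eqF.
    rewrite ca sa /dot /cross; have := XY1 (s, t) => e1; split.
      rewrite -[LHS]mulr1 -{1}e1; ring.
    rewrite -[LHS]mulr1 -{1}e1; ring.
(* Compactness of the segment makes the neighbourhood of [s] uniform in [t]. *)
have near_dot s : \forall s' \near s, forall t : R, 0 <= t <= 1 -> 0 < dot s s' t.
  have := @segment_compact R 0 1 => /compact_near_coveringP.
  move=> /(_ R (nbhs s) (fun s' t => 0 < dot s s' t) _)[].
    move=> t _.
    have cd : {for (t, s), continuous (fun z : R * R => dot s z.2 z.1)}.
      have cs (F : R * R -> R) : continuous F ->
          {for (t, s), continuous (fun z : R * R => F (z.2, z.1))}.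
        move=> cF; apply: (@continuous_comp _ _ _ (fun z : R * R => (z.2, z.1)) F).
          by apply: (@continuous_pair _ _ _ snd fst); [exact: cvg_snd|exact: cvg_fst].
        exact: cF.
      have cs' (F : R * R -> R) : continuous F ->
          {for (t, s), continuous (fun z : R * R => F (s, z.1))}.
        move=> cF; apply: (@continuous_comp _ _ _ (fun z : R * R => (s, z.1)) F).
          by apply: (@continuous_pair _ _ _ (fun=> s) fst); [exact: cst_continuous|exact: cvg_fst].
        exact: cF.
      apply: (@continuousD _ _ _ (fun z : R * R => X (s, z.1) * X (z.2, z.1))
        (fun z : R * R => Y (s, z.1) * Y (z.2, z.1))).
        by apply: continuousM; [exact: cs'|exact: cs].
      by apply: continuousM; [exact: cs'|exact: cs].
    have d1 : dot s s t = 1 by rewrite /dot -!expr2 XY1.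
    have d0 : \forall x \near dot s s t, 0 < x.
      by apply: lt_nbhsr; rewrite d1.
    exact: (cd _ d0).
  move=> e e0 H; exists e => // s' /H H' t t01; apply: H'.
(* [rel] is an equivalence relation with open classes, so all times are related. *)
change (rel 0 1).
apply: (@locally_constant_prop R (rel 0) _ 0) => [s|]; last exact: rel_refl.
apply: filterS (near_dot s) => s' /dot_rel ss'.
by split; [move/rel_trans; apply; exact: rel_sym|move/rel_trans; apply].
Qed.

End winding.

(** * Lifting the Iwasawa decomposition to the universal cover *)

Section chart.
Context (R : realType) (G : topologicalGroupType) (p : {multiplicative G -> PSL2 R}).
Hypothesis Gp : universal_cover R p.

Let cover_p : covering_map p. Proof. by case: Gp. Qed.
Let cp : continuous p. Proof. by case: cover_p. Qed.
Let pM x y : p (x * y)%g = (p x * p y)%g. Proof. exact: gmulfM. Qed.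
Let p1 : p 1%g = 1%g. Proof. exact: morph1. Qed.
Let pV x : p (x^-1)%g = ((p x)^-1)%g. Proof. exact: morphV. Qed.

Variables k n a : R -> G.
Hypotheses (ck : continuous k) (cn : continuous n) (ca : continuous a).
Hypothesis kD : forall s t, k (s + t) = (k s * k t)%g.
Hypothesis nD : forall s t, n (s + t) = (n s * n t)%g.
Hypothesis aD : forall s t, a (s + t) = (a s * a t)%g.
Hypotheses (pkE : forall s, p (k s) = pk s) (pnE : forall s, p (n s) = pn s)
  (paE : forall s, p (a s) = pa s).

Let k0 := hom0 kD.
Let n0 := hom0 nD.
Let a0 := hom0 aD.
Let pn0 := hom0 (@pnD R).
Let pa0 := hom0 (@paD R).

(** The quotient of the two sides is a path in the kernel that starts at 1, hence constant.
    Relations between one-parameter subgroups of PSL_2 are transferred to [G] in this way. *)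
Lemma eq_lift (f g : R -> G) : continuous f -> continuous g ->
  (forall t, p (f t) = p (g t)) -> f 0 = g 0 -> forall t, f t = g t.
Proof.
move=> cf cg pfg fg0 t; pose c t := (f t * (g t)^-1)%g.
have cc : continuous c.
  move=> s; apply: (@continuous_mulg G R f (fun t => (g t)^-1)%g); first exact: cf.
  by apply: continuous_invg; exact: cg.
have pc s : p (c s) = 1%g by rewrite pM pV pfg mulgV.
have := fibre_path_constant cover_p cc (fun s => etrans (pc s) (esym (pc 0))) t.
by rewrite /c fg0 mulgV => /divg1_eq.
Qed.

Let cst_cont (g : G) : continuous (fun _ : R => g).
Proof. by move=> t; exact: cst_continuous. Qed.

Let cmul (f g : R -> G) : continuous f -> continuous g ->
  continuous (fun t => f t * g t)%g.
Proof. by move=> cf cg t; apply: continuous_mulg; [exact: cf|exact: cg]. Qed.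

Lemma lift_an u v : (a u * n v)%g = (n (expR u * v) * a u)%g.
Proof.
have cexp : continuous (fun u => n (expR u * v)).
  move=> t; apply: (@continuous_comp _ _ _ (fun u => expR u * v) n); last exact: cn.
  apply: (@continuousM _ _ expR (fun=> v)); first exact: continuous_expR.
  exact: cst_continuous.
apply: (@eq_lift (fun u => a u * n v)%g (fun u => n (expR u * v) * a u)%g).
- exact: cmul.
- exact: cmul.
- by move=> t; rewrite !pM !pnE !paE pa_pn.
- by rewrite expR0 mul1r a0 mulg1 mul1g.
Qed.

Lemma lift_wa u : (k (pi / 2) * a u)%g = (a (- u) * k (pi / 2))%g.
Proof.
have caN : continuous (fun u => a (- u)).
  move=> t; apply: (@continuous_comp _ _ _ -%R a); last exact: ca.
  exact: continuousN.
apply: (@eq_lift (fun u => k (pi / 2) * a u)%g (fun u => a (- u) * k (pi / 2))%g).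
- exact: cmul.
- exact: cmul.
- by move=> t; rewrite !pM !pkE !paE pk_pihalf_pa.
- by rewrite oppr0 a0 mulg1 mul1g.
Qed.

Lemma kernel_commutes (f : R -> G) z : continuous f -> f 0 = 1%g -> p z = 1%g ->
  forall t, (z * f t)%g = (f t * z)%g.
Proof.
move=> cf f0 z1; apply: eq_lift; [exact: cmul|exact: cmul| |].
- by move=> t; rewrite !pM z1 mul1g mulg1.
- by rewrite f0 mul1g mulg1.
Qed.

(** Translating by [k (- s0)] brings the angle near 0, where [pangle] is continuous. The resulting
    product [r] has the same image as the identity map near [g0] and agrees with it at [g0];
    discreteness of the fibres makes them agree nearby. *)
Lemma chart_local s0 v0 u0 (g0 := (k s0 * (n v0 * a u0))%g) :
  exists2 th : G -> R, {for g0, continuous th} /\ th g0 = s0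
  & \forall g \near g0, g = (k (th g) * (n (pv (p g)) * a (pu (p g))))%g.
Proof.
pose y (g : G) := p (k (- s0) * g)%g.
have cy : continuous y.
  move=> g; apply: (@continuous_comp _ _ _ (fun g => k (- s0) * g)%g p); last exact: cp.
  apply: (@continuous_mulg G G (fun=> k (- s0)) id); first exact: cst_continuous.
  exact: cvg_id.
have yE s v u : y (k s * (n v * a u))%g = (pk (s - s0) * (pn v * pa u))%g.
  by rewrite /y !pM !pkE pnE paE mulgA -pkD addrC.
have y0 : y g0 = (pk 0 * (pn v0 * pa u0))%g by rewrite /g0 yE subrr.
pose th g := s0 + pangle (y g).
have cth : {for g0, continuous th}.
  apply: (@continuousD _ _ _ (fun=> s0) (fun g => pangle (y g))).
    exact: cst_continuous.
  apply: (@continuous_comp _ _ _ y (@pangle R)); first exact: cy.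
  by rewrite y0; apply: pangle_continuous; rewrite cos0 oner_neq0.
have th0 : th g0 = s0 by rewrite /th y0 pangle0 addr0.
exists th => //.
pose r g := (k (th g) * (n (pv (p g)) * a (pu (p g))))%g.
have [pu0 pv0 _ _ _] := PSL2_coordinates s0 v0 u0.
have pg0 : p g0 = (pk s0 * (pn v0 * pa u0))%g by rewrite /g0 !pM pkE pnE paE.
have r0 : r g0 = g0 by rewrite /r th0 pg0 pu0 pv0.
have cr : {for g0, continuous r}.
  apply: (@continuous_mulg G G (fun g => k (th g))
    (fun g => n (pv (p g)) * a (pu (p g)))%g).
    by apply: (@continuous_comp _ _ _ th k); [exact: cth|exact: ck].
  apply: (@continuous_mulg G G (fun g => n (pv (p g))) (fun g => a (pu (p g)))).
    apply: (@continuous_comp _ _ _ (@pv R \o p) n); last exact: cn.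
    by apply: continuous_comp; [exact: cp|exact: pv_continuous].
  apply: (@continuous_comp _ _ _ (@pu R \o p) a); last exact: ca.
  by apply: continuous_comp; [exact: cp|exact: pu_continuous].
(* A positive cosine of the double angle is an open condition that keeps the angle itself away from
   the zeros of the cosine. *)
have near_cos : \forall g \near g0, 0 < pcos (y g).
  have cc : {for g0, continuous (fun g => pcos (y g))}.
    apply: (@continuous_comp _ _ _ y (@pcos R)); first exact: cy.
    exact: pcos_continuous.
  apply: (cc [set x | 0 < x]); rewrite /= y0.
  have [_ _ -> _ _] := PSL2_coordinates 0 v0 u0.
  by apply: lt_nbhsr; rewrite mulr0 cos0.
pose c g := (g^-1 * r g)%g.
have cc : {for g0, continuous c}.
  apply: (@continuous_mulg G G (fun g => g^-1)%g r) => //.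
  by apply: continuous_invg; exact: cvg_id.
have c0 : c g0 = 1%g by rewrite /c r0 mulVg.
have pc : \forall g \near g0, p (c g) = p (c g0).
  apply: filterS near_cos => g cosg; rewrite c0 p1 pM pV.
  have [s pgE] := PSL2_iwasawa (p g).
  have yg : y g = (pk (s - s0) * (pn (pv (p g)) * pa (pu (p g))))%g.
    by rewrite /y pM pkE {1}pgE mulgA -pkD addrC.
  have [_ _ cE _ angleE] := PSL2_coordinates (s - s0) (pv (p g)) (pu (p g)).
  have cos_neq0 : cos (s - s0) != 0.
    apply: contraTneq cosg => cos0; rewrite yg cE mulrC mulr_natr cos_mulr2n cos0.
    by rewrite expr0n mul0rn sub0r -leNgt lerN10.
  have -> : p (r g) = p g.
    rewrite /r !pM pkE pnE paE /th pkD yg angleE// -pkD addrC subrK.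
    by rewrite -pgE.
  by rewrite mulVg.
have := kernel_valued_constant cover_p cc pc.
apply: filterS => g cg1; have : (g * c g)%g = g by rewrite cg1 c0 mulg1.
by rewrite {1}/c mulgA mulgV mul1g => rg; exact: (esym rg).
Qed.

Let connG : path_connected R G. Proof. by case: Gp => -[]. Qed.

(** The set [S] of products is open by [chart_local]. Its complement is open too: any point is h0 z
    with h0 in [S] and z in the kernel, and if S z meets [S] then z is some [k d] that commutes with
    [n] and [a], so that S z is contained in [S]. A path from 1 to [g] then never leaves [S]. *)
Lemma chart_surjective g : exists s v u, g = (k s * (n v * a u))%g.
Proof.
pose S (g : G) := exists s v u, g = (k s * (n v * a u))%g.
have S1 : S 1%g by exists 0, 0, 0; rewrite k0 n0 a0 !mulg1.
have near_S h : S h -> \forall h' \near h, S h'.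
  move=> [s [v [u ->]]]; have [th _] := chart_local s v u.
  by apply: filterS => h' ->; exists (th h'), (pv (p h')), (pu (p h')).
have S_kernel h z : S h -> S (h * z)%g -> p z = 1%g -> forall h', S h' -> S (h' * z)%g.
  move=> [s [v [u hE]]] [s' [v' [u' hzE]]] z1.
  have pE : (pk s * (pn v * pa u))%g = (pk s' * (pn v' * pa u'))%g.
    have : p h = p (h * z)%g by rewrite pM z1 mulg1.
    by rewrite hE -hE hzE hE !pM !pkE !pnE !paE.
  have [e1 e2 _ _ _] := PSL2_coordinates s v u.
  have [e1' e2' _ _ _] := PSL2_coordinates s' v' u'.
  move: e1 e2; rewrite pE e1' e2' => u_eq v_eq; subst v' u'.
  have pd : p (k (s' - s)) = 1%g.
    have kk : pk s = pk s' := @mulIg _ (pn v * pa u)%g _ _ pE.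
    by rewrite pkE pkD (homN (@pkD R)) kk mulgV.
  have comm v1 u1 : (n v1 * a u1 * k (s' - s) = k (s' - s) * (n v1 * a u1))%g.
    rewrite -mulgA -(kernel_commutes ca a0 pd) mulgA -(kernel_commutes cn n0 pd).
    by rewrite mulgA.
  have zE : z = k (s' - s).
    apply: (@mulgI _ h); rewrite hzE hE -[RHS]mulgA comm.
    by rewrite [RHS]mulgA -kD addrC subrK.
  move=> _ [s1 [v1 [u1 ->]]]; exists (s1 + (s' - s)), v1, u1.
  by rewrite zE -[LHS]mulgA comm [LHS]mulgA -kD.
have S_locally_constant h : \forall h' \near h, S h' <-> S h.
  have [Sh|nSh] := pselect (S h); first by apply: filterS (near_S _ Sh).
  have [s phE] := PSL2_iwasawa (p h).
  pose h0 := (k s * (n (pv (p h)) * a (pu (p h))))%g.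
  have Sh0 : S h0 by exists s, (pv (p h)), (pu (p h)).
  pose z := (h0^-1 * h)%g.
  have hE : h = (h0 * z)%g by rewrite /z mulgA mulgV mul1g.
  have z1 : p z = 1%g.
    by rewrite /z pM pV /h0 !pM pkE pnE paE -phE mulVg.
  have cz : {for h, continuous (fun g => g * z^-1)%g}.
    apply: (@continuous_mulg G G id (fun=> z^-1)%g); first exact: cvg_id.
    exact: cst_continuous.
  have hz : (h * z^-1)%g = h0 by rewrite hE mulgK.
  have nS : nbhs (h * z^-1)%g S by rewrite hz; exact: near_S.
  have Shz : \forall g \near h, S (g * z^-1)%g := cz S nS.
  apply: filterS Shz => h' Sh'; split=> // Sh'z; exfalso; apply: nSh.
  rewrite hE; apply: (S_kernel (h' * z^-1)%g) => //.
  by rewrite mulgVK.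
have [c [cc c0 c1]] := connG 1%g g.
pose d (t : R) := c (clamp 0 1 t).
have cd : continuous d.
  have cl01 t : `[0, 1]%classic (clamp 0 1 t : R) by rewrite /= in_itv/= clamp_itv.
  exact: (@continuous_comp_within R R G _ c (@clamp R 0 1) cc (@clamp_continuous R 0 1) cl01).
suff : S (d 1) by rewrite /d clamp_id ?lexx ?ler01// c1.
apply: (@locally_constant_prop R (fun t => S (d t)) _ 0).
  move=> t; exact: (cd t _ (S_locally_constant (d t))).
by rewrite /d clamp_id ?lexx ?ler01// c0.
Qed.

(** Otherwise t -> k(t d) would be a loop, contractible in [G]. Its image on the unit circle has
    angle 2 t d, and the contraction corrects this angle by a continuous L that vanishes at both
    ends, so that cos(2 t d + L(t)) = 1 on [0, 1]. But this angle runs from 0 to 2 d and has to pass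
    through small positive values. *)
Lemma rotation_lift_injective d : k d = 1%g -> d = 0.
Proof.
wlog d0 : d / 0 < d => [hw|kd1].
  case: (ltgtP d 0) => // dN kd; last exact: hw.
  apply/eqP; rewrite -oppr_eq0; apply/eqP/hw; first by rewrite oppr_gt0.
  by rewrite (homN kD) kd invg1.
exfalso.
pose c (t : R) := k (t * d).
have cc : continuous c.
  move=> t; apply: (@continuous_comp _ _ _ (fun t : R => t * d : R) k); last exact: ck.
  by apply: (@continuousM _ _ id (fun=> d)); [exact: cvg_id|exact: cst_continuous].
have c01 : c 0 = c 1 by rewrite /c mul0r mul1r k0 kd1.
have [_ /(_ c)] : simply_connected R G by case: Gp.
have cwc : {within `[0, 1], continuous c} by exact: continuous_subspaceT.
move=> /(_ cwc c01)[h [ch h0 h1 hs]].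
pose cl := @clamp R 0 1.
pose H z := h (cl z.1, cl z.2).
have cl01 t : cl t \in `[0, 1] by rewrite in_itv/= clamp_itv.
have clid (t : R) : 0 <= t <= 1 -> cl t = t by exact: clamp_id.
have cl0 : cl 0 = 0 by rewrite clid// lexx ler01.
have cl1 : cl 1 = 1 by rewrite clid// lexx ler01.
have cH : continuous H.
  apply: (@continuous_comp_within (R * R)%type _ _ _ _
    (fun z : R * R => (cl z.1, cl z.2)) ch).
    move=> z; apply: (@continuous_pair _ _ _ (fun z => cl z.1) (fun z => cl z.2)).
      apply: (@continuous_comp _ _ _ fst cl); first exact: cvg_fst.
      exact: clamp_continuous.
    apply: (@continuous_comp _ _ _ snd cl); first exact: cvg_snd.
    exact: clamp_continuous.
  by move=> z; split; exact: cl01.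
pose X z := pcos (p (H z)); pose Y z := psin (p (H z)).
have cX : continuous X.
  move=> z; apply: (@continuous_comp _ _ _ (p \o H) (@pcos R)).
    by apply: continuous_comp; [exact: cH|exact: cp].
  exact: pcos_continuous.
have cY : continuous Y.
  move=> z; apply: (@continuous_comp _ _ _ (p \o H) (@psin R)).
    by apply: continuous_comp; [exact: cH|exact: cp].
  exact: psin_continuous.
have pcsE s : pcos (p (k s)) = cos (2 * s) /\ psin (p (k s)) = sin (2 * s).
  have [_ _ <- <- _] := PSL2_coordinates s 0 0.
  by rewrite pn0 pa0 !mulg1 pkE.
have pcs1 : pcos (p 1%g) = 1 /\ psin (p 1%g) = 0.
  by have := pcsE 0; rewrite k0 mulr0 cos0 sin0.
have [] := circle_homotopy_lift cX cY.
- by move=> z; exact: pcos2Dpsin2.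
- move=> s; rewrite /X /Y /H /= cl0 cl1.
  have [-> ->] := hs _ (cl01 s).
  by rewrite /c mul0r k0.
move=> L [cL L0 L1 LE].
have cos1 (t : R) : 0 <= t <= 1 -> cos (2 * (t * d) + L t) = 1.
  move=> t01; have [+ _] := LE _ t01.
  rewrite /X /Y /H /= cl0 cl1 h1; last exact: cl01.
  rewrite h0; last exact: cl01.
  rewrite clid// /c mul0r k0 (pcsE (t * d)).1 (pcsE (t * d)).2 pcs1.1 cosD.
  by move=> <-.
have cf : continuous (fun t : R => 2 * (t * d) + L t : R).
  move=> t; apply: (@continuousD _ _ _ (fun t : R => 2 * (t * d) : R)); last exact: cL.
  apply: (@continuousM _ _ (fun=> 2) (fun t : R => t * d)); first exact: cst_continuous.
  by apply: (@continuousM _ _ id (fun=> d)); [exact: cvg_id|exact: cst_continuous].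
(* A positive value that the angle attains and that is below pi, where the cosine is less than 1. *)
pose v := Num.min (2 * d) 1.
have v0 : 0 < v by rewrite /v lt_min mulr_gt0// ltr01.
have v1 : v <= 1 by rewrite /v ge_min lexx orbT.
have [] := @IVT R (fun t : R => 2 * (t * d) + L t : R) 0 1 v ler01.
- exact: continuous_subspaceT.
- rewrite mul0r mulr0 mul1r L0 L1 !addr0.
  by rewrite min_l ?max_r ?mulr_ge0 ?(ltW d0)// ltW//= /v ge_min lexx.
move=> t; rewrite in_itv /= => t01 fv; have := cos1 _ t01; rewrite fv => cv1.
have : cos v < cos 0.
  rewrite ltr_cos// ?in_itv/= ?lexx ?pi_ge0// (ltW v0)/=.
  by rewrite (le_trans v1)// (le_trans _ (pi_ge2 R))// ler1n.
by rewrite cos0 cv1 ltxx.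
Qed.

End chart.

(* The global Iwasawa coordinates g = k(s) n(v) a(u); cw stands for a Weyl
   element. *)
Record iwasawa_chart (R : realType) (G : topologicalGroupType) := IwasawaChart {
  ck : R -> G ; cn : R -> G ; ca : R -> G ; cw : G ;
  cs : G -> R ; cv : G -> R ; cu : G -> R ;
  ck_continuous : continuous ck ;
  cn_continuous : continuous cn ;
  ca_continuous : continuous ca ;
  cs_continuous : continuous cs ;
  cv_continuous : continuous cv ;
  cu_continuous : continuous cu ;
  ckD : forall s t, ck (s + t) = (ck s * ck t)%g ;
  cnD : forall s t, cn (s + t) = (cn s * cn t)%g ;
  caD : forall s t, ca (s + t) = (ca s * ca t)%g ;
  ca_cn : forall u v, (ca u * cn v)%g = (cn (expR u * v)%R * ca u)%g ;
  cw_ca : forall u, (cw * ca u)%g = (ca (- u) * cw)%g ;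
  cw_cn : forall v, v != 0 -> cs (cw * cn v * cw^-1)%g != 0 ;
  chartE : forall g, g = (ck (cs g) * (cn (cv g) * ca (cu g)))%g ;
  csE : forall s v u, cs (ck s * (cn v * ca u))%g = s ;
  cvE : forall s v u, cv (ck s * (cn v * ca u))%g = v ;
  cuE : forall s v u, cu (ck s * (cn v * ca u))%g = u }.

(** The coordinates v and u are pulled back from PSL_2. The rotation coordinate is obtained by
    choice: it is unique because the lifted rotations are injective, and continuous because near
    each point it agrees with the function of [chart_local]. *)
Lemma universal_cover_chart (R : realType) (G : topologicalGroupType)
    (p : {multiplicative G -> PSL2 R}) :
  universal_cover R p -> inhabited (iwasawa_chart R G).
Proof.
move=> Gp; have [_ cover_p] := Gp; have [cp _ _] := cover_p.
have [k [ck kD pkE]] := one_parameter_lift cover_p (@pk_continuous R) (@pkD R).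
have [n [cn nD pnE]] := one_parameter_lift cover_p (@pn_continuous R) (@pnD R).
have [a [ca aD paE]] := one_parameter_lift cover_p (@pa_continuous R) (@paD R).
have pM x y : p (x * y)%g = (p x * p y)%g by exact: gmulfM.
have pchart s v u : p (k s * (n v * a u))%g = (pk s * (pn v * pa u))%g.
  by rewrite !pM pkE pnE paE.
have surj g : exists s, g = (k s * (n (pv (p g)) * a (pu (p g))))%g.
  have [s [v [u gE]]] := chart_surjective Gp ck cn ca kD nD aD pkE pnE paE g.
  exists s; rewrite {2 3}gE pchart.
  by have [-> -> _ _ _] := PSL2_coordinates s v u.
have [cs csP] := choice surj.
have k_inj s s' g g' : p g = p g' ->
    (k s * (n (pv (p g)) * a (pu (p g))))%g =
    (k s' * (n (pv (p g')) * a (pu (p g'))))%g -> s = s'.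
  move=> -> /mulIg kk; apply/eqP; rewrite -subr_eq0; apply/eqP.
  apply: (rotation_lift_injective Gp ck kD pkE).
  by rewrite kD (homN kD) kk mulgV.
have csE s v u : cs (k s * (n v * a u))%g = s.
  set g := (k s * _)%g; apply: (@k_inj _ _ g g) => //; rewrite -csP.
  by rewrite {1}/g pchart; have [-> -> _ _ _] := PSL2_coordinates s v u.
have cs_cont : continuous cs.
  move=> g0.
  have [th [cth th0 near_th]] :=
    chart_local Gp ck cn ca pkE pnE paE (cs g0) (pv (p g0)) (pu (p g0)).
  move: cth th0 near_th; rewrite -csP => cth th0 near_th.
  have cs_th : \forall g \near g0, th g = cs g.
    by apply: filterS near_th => g gE; rewrite [in RHS]gE csE.
  suff : cs @ g0 --> th g0 by rewrite th0.
  by apply: cvg_trans cth; apply: near_eq_cvg.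
have pkN : ((p (k (pi / 2)%R))^-1)%g = pk (- (pi / 2)) by rewrite pkE (homN (@pkD R)).
have cv_cont : continuous (@pv R \o p).
  by move=> g; apply: continuous_comp; [exact: cp|exact: pv_continuous].
have cu_cont : continuous (@pu R \o p).
  by move=> g; apply: continuous_comp; [exact: cp|exact: pu_continuous].
have wn v : v != 0 -> cs (k (pi / 2)%R * n v * (k (pi / 2)%R)^-1)%g != 0.
  move=> v0; apply: contra_neq v0 => cs0.
  set g := (k (pi / 2)%R * n v * (k (pi / 2)%R)^-1)%g in cs0.
  have := congr1 p (csP g); rewrite cs0 (hom0 kD) mul1g /g !pM pnE paE.
  rewrite morphV pkN pkE pnE -mulgA => /lower_unipotent; exact.
have cvE s v u : (@pv R \o p) (k s * (n v * a u))%g = v.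
  by rewrite /= pchart; have [_ -> _ _ _] := PSL2_coordinates s v u.
have cuE s v u : (@pu R \o p) (k s * (n v * a u))%g = u.
  by rewrite /= pchart; have [-> _ _ _ _] := PSL2_coordinates s v u.
refine (inhabits (IwasawaChart ck cn ca cs_cont cv_cont cu_cont kD nD aD
  (lift_an Gp cn ca aD pnE paE) (lift_wa Gp ca aD pkE paE) wn csP csE cvE cuE)).
Qed.

Section chart_theory.
Context (R : realType) (G : topologicalGroupType) (c : iwasawa_chart R G).
Local Notation k := (ck c).
Local Notation n := (cn c).
Local Notation a := (ca c).
Local Notation s := (cs c).
Local Notation v := (cv c).
Local Notation u := (cu c).

Lemma ck0 : k 0 = 1%g. Proof. exact: hom0 (ckD c). Qed.
Lemma cn0 : n 0 = 1%g. Proof. exact: hom0 (cnD c). Qed.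
Lemma ca0 : a 0 = 1%g. Proof. exact: hom0 (caD c). Qed.
Lemma ckN x : k (- x) = ((k x)^-1)%g. Proof. exact: homN (ckD c) _. Qed.
Lemma cnN x : n (- x) = ((n x)^-1)%g. Proof. exact: homN (cnD c) _. Qed.
Lemma caN x : a (- x) = ((a x)^-1)%g. Proof. exact: homN (caD c) _. Qed.

Lemma cs_mulk x g : s (k x * g)%g = x + s g.
Proof. by rewrite {1}(chartE c g) mulgA -ckD csE. Qed.

Lemma cv_mulk x g : v (k x * g)%g = v g.
Proof. by rewrite {1}(chartE c g) mulgA -ckD cvE. Qed.

Lemma cu_mulk x g : u (k x * g)%g = u g.
Proof. by rewrite {1}(chartE c g) mulgA -ckD cuE. Qed.

Lemma cs_mulna g x y : s (g * (n x * a y))%g = s g.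
Proof.
rewrite {1}(chartE c g) -!mulgA (mulgA (a _)) ca_cn -!mulgA (mulgA (n _) (n _)).
by rewrite -cnD -caD csE.
Qed.

Lemma cs_k x : s (k x) = x.
Proof. by have := csE c x 0 0; rewrite cn0 ca0 !mulg1. Qed.

(* The rotations move the base point of the universal cover of the circle
   upwards, and q preserves the half line above its fixed base point. *)
Lemma cs_na_k_gt0 x y t : 0 < t -> 0 < s (n x * a y * k t)%g.
Proof.
move=> t0; pose f (z : R) := s (n (z * x)%R * a (z * y)%R * k t)%g.
have cf : continuous f.
  have cl (x0 : R) : continuous (fun z : R => z * x0).
    move=> z; apply: (@continuousM _ _ id (fun=> x0)); first exact: cvg_id.
    exact: cst_continuous.
  move=> z; apply: (@continuous_comp _ _ _
    (fun z : R => n (z * x)%R * a (z * y)%R * k t)%g s); last exact: cs_continuous.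
  apply: (@continuous_mulg G R (fun z : R => n (z * x)%R * a (z * y)%R)%g (fun=> k t)).
    apply: (@continuous_mulg G R (fun z : R => n (z * x)%R) (fun z : R => a (z * y)%R)).
      by apply: (@continuous_comp _ _ _ (fun z : R => z * x) n);
        [exact: cl|exact: cn_continuous].
    by apply: (@continuous_comp _ _ _ (fun z : R => z * y) a);
      [exact: cl|exact: ca_continuous].
  exact: cst_continuous.
(* If the coordinate vanished, [k t] would be a product of elements of NA and have rotation
   coordinate 0 instead of [t]. So [f] keeps its sign while n(x) a(y) is deformed to 1. *)
have f_neq0 z : f z != 0.
  apply/negP => /eqP fz0.
  pose q := (n (z * x)%R * a (z * y)%R)%g.
  have sq : s (q * k t)%g = 0 := fz0.
  have qk : (q * k t = n (v (q * k t)) * a (u (q * k t)))%g.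
    by rewrite [LHS](chartE c) sq ck0 mul1g.
  have : s (k t) = 0.
    have -> : k t = (q^-1 * (n (v (q * k t)) * a (u (q * k t))))%g.
      by rewrite -qk mulKg.
    rewrite cs_mulna /q invgM -caN -cnN ca_cn -[X in s X]mul1g -ck0 csE//.
  by rewrite cs_k; apply/eqP; rewrite gt_eqF.
rewrite ltNge; apply/negP => f1.
have [] := @IVT R f 0 1 0 ler01.
- exact: continuous_subspaceT.
- have -> : f 0 = t by rewrite /f !mul0r cn0 ca0 !mul1g cs_k.
  have f1' : f 1 <= 0 by rewrite /f !mul1r.
  by rewrite ge_min le_max f1' orbT (ltW t0).
by move=> z _ /eqP; apply/negP; exact: f_neq0.
Qed.

End chart_theory.

(** * Haar measures and Borel sets *)

Definition countable_base (T : topologicalType) (b : nat -> set T) :=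
  (forall i, open (b i)) /\
  forall x W, nbhs x W -> exists2 i, b i x & b i `<=` W.

Definition push_measure d d' (T1 : measurableType d) (T2 : measurableType d')
    (R : realFieldType) (m : {measure set T1 -> \bar R}) (f : T1 -> T2)
    (mf : measurable_fun setT f) : {measure set T2 -> \bar R} :=
  measure_function_pushforward__canonical__measure_function_Measure m mf.

(* The proof argument only lets the instance below be inferred. *)
Definition sigma_finite_of d (T : measurableType d) (R : realType)
    (m : {measure set T -> \bar R}) (sf : sigma_finite setT m) : set T -> \bar R := m.

Section sigma_finite_of.
Context d (T : measurableType d) (R : realType) (m : {measure set T -> \bar R}).
Variable sf : sigma_finite setT m.
HB.instance Definition _ := Measure.on (sigma_finite_of sf).
HB.instance Definition _ := @Measure_isSigmaFinite.Build _ _ _ (sigma_finite_of sf) sf.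
End sigma_finite_of.

Section borel_group.
Variables (G : topologicalGroupType) (b : nat -> set G).
Hypothesis base_b : countable_base b.
Local Notation T := (borelType G).

Lemma open_borel (U : set G) : open U -> measurable (U : set T).
Proof. exact: sub_sigma_algebra. Qed.

Lemma closed_borel (U : set G) : closed U -> measurable (U : set T).
Proof.
move=> cU; have mC : measurable (~` U : set T) by apply: open_borel; rewrite openC.
by rewrite -(setCK U); exact: measurableC mC.
Qed.

Lemma continuous_borelR (R : realType) (f : G -> R) :
  continuous f -> measurable_fun setT (f : T -> R).
Proof.
move=> /continuousP cf; apply: (measurability _ (measurable_realfun.RGenOpens.measurableE R)).
move=> _ [_ [x [y ->]] <-]; rewrite setTI; apply: open_borel; apply: cf.
exact: interval_open.
Qed.

Lemma continuous_borel d (S : measurableType d) (f : S -> T) :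
  (forall U : set G, open U -> measurable (f @^-1` U)) -> measurable_fun setT f.
Proof.
move=> mf; apply: (@measurability _ _ S T setT f (@open G)) => //.
by move=> _ [U oU <-]; rewrite setTI; exact: mf.
Qed.

(** A countable base makes [W] a countable union of open rectangles; this gives the measurability of
    multiplication for the product sigma-algebra, which Fubini requires. *)
Lemma open_borel2 (W : set (G * G)) : open W -> measurable (W : set (T * T)).
Proof.
move=> oW.
pose F i j : set (T * T) := if `[< b i `*` b j `<=` W >] then b i `*` b j else set0.
suff -> : W = \bigcup_i \bigcup_j F i j.
  apply: bigcupT_measurable => i; apply: bigcupT_measurable => j.
  rewrite /F; case: ifP => // _; apply: measurableX; apply: open_borel;
  exact: base_b.1.
apply/seteqP; split=> [[x y] Wxy|[x y] [i _ [j _]]]; last first.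
  by rewrite /F; case: ifPn => // /asboolP; apply.
have : nbhs (x, y) W by exact: open_nbhs_nbhs.
move=> [[/= P Q] [xP yQ] PQW].
have [i bx bP] := base_b.2 _ _ xP; have [j jy bQ] := base_b.2 _ _ yQ.
exists i => //; exists j => //; rewrite /F; case: ifPn => // /asboolP; case.
by move=> [x' y'] [/= /bP Px' /bQ Qy']; exact: PQW.
Qed.

Lemma lmulg_measurable (g : G) : measurable_fun setT (fun x : T => (g * x)%g : T).
Proof.
apply: continuous_borel => U oU; apply: open_borel; apply: open_comp oU => z _.
by apply: (@continuous_mulg G G (fun=> g) id); [exact: cst_continuous|exact: cvg_id].
Qed.

Lemma rmulg_measurable (g : G) : measurable_fun setT (fun x : T => (x * g)%g : T).
Proof.
apply: continuous_borel => U oU; apply: open_borel; apply: open_comp oU => z _.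
by apply: (@continuous_mulg G G id (fun=> g)); [exact: cvg_id|exact: cst_continuous].
Qed.

Lemma invg_measurable : measurable_fun setT (fun x : T => (x^-1)%g : T).
Proof.
apply: continuous_borel => U oU; apply: open_borel; apply: open_comp oU => z _.
exact: invg_continuous.
Qed.

Lemma mulVg_measurable : measurable_fun setT (fun z : T * T => (z.1^-1 * z.2)%g : T).
Proof.
apply: continuous_borel => U oU; apply: open_borel2; apply: open_comp oU => z _.
apply: (@continuous_mulg G (G * G)%type (fun z => z.1^-1)%g snd); last exact: cvg_snd.
by apply: continuous_invg; exact: cvg_fst.
Qed.

Local Open Scope ereal_scope.
Context {R : realType}.
Implicit Types mu nu : {sigma_finite_measure set T -> \bar R}.

Lemma left_invariant_preimage (mu : {measure set T -> \bar R}) (g : G) (A : set T) :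
  left_invariant mu -> measurable A -> mu ((fun x => g * x)%g @^-1` A) = mu A.
Proof.
move=> li mA; rewrite -(li g^-1%g A mA); congr (mu _); apply/seteqP; split.
  by move=> x Ax; exists (g * x)%g => //; rewrite mulKg.
by move=> _ [x Ax <-]; rewrite /= mulVKg.
Qed.

Lemma integral_left_invariant (mu : {measure set T -> \bar R}) (g : G)
    (f : T -> \bar R) :
  left_invariant mu -> measurable_fun setT f -> (forall x, 0 <= f x) ->
  \int[mu]_x f (g * x)%g = \int[mu]_x f x.
Proof.
move=> li mf f0.
transitivity (\int[pushforward mu (fun x : T => (g * x)%g : T)]_x f x).
  rewrite [RHS]ge0_integral_pushforward//; exact: lmulg_measurable.
apply: eq_measure_integral => [|? A mA _]; first exact: lmulg_measurable.
by rewrite -[RHS](left_invariant_preimage g li mA).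
Qed.

(* Both sides are the integral of f(x) 1_B(y x): substitute x by y^-1 x, then
   y by x y. *)
Lemma haar_fubini mu nu (f : T -> \bar R) (B : set T) :
  left_invariant mu -> left_invariant nu ->
  measurable_fun setT f -> (forall x, 0 <= f x) -> measurable B ->
  \int[mu]_x (f x * nu [set y | B (y * x)%g]) =
  mu B * \int[nu]_y f (y^-1)%g.
Proof.
move=> lmu lnu mf f0 mB.
pose F (z : T * T) : \bar R := f z.1 * (\1_B (z.2 * z.1)%g)%:E.
have mulC_measurable : measurable_fun setT (fun z : T * T => (z.2 * z.1)%g : T).
  apply: continuous_borel => U oU; apply: open_borel2; apply: open_comp oU => z _.
  by apply: (@continuous_mulg G (G * G)%type snd fst); [exact: cvg_snd|exact: cvg_fst].
have m1B : measurable_fun setT (\1_B : T -> R) by exact: measurable_indic.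
have mF : measurable_fun setT F.
  apply: emeasurable_funM; first exact: measurableT_comp.
  by apply/measurable_EFinP; exact: (measurableT_comp m1B mulC_measurable).
pose H (z : T * T) : \bar R := f (z.1^-1 * z.2)%g * (\1_B z.2)%:E.
have mH : measurable_fun setT H.
  apply: emeasurable_funM; first exact: (measurableT_comp mf mulVg_measurable).
  by apply/measurable_EFinP; exact: (measurableT_comp m1B measurable_snd).
have F0 z : 0 <= F z by rewrite mule_ge0// lee_fin.
have H0 z : 0 <= H z by rewrite mule_ge0// lee_fin.
transitivity (\int[mu]_x \int[nu]_y F (x, y)).
  apply: eq_integral => x _; rewrite /F /= ge0_integralZl//; last first.
    apply/measurable_EFinP; exact: (measurableT_comp m1B (rmulg_measurable x)).
  congr (_ * _).
  rewrite (eq_integral (fun y : T => (\1_[set y | B (y * x)%g] y)%:E)); last first.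
    by [].
  rewrite integral_indic ?setIT// -[X in measurable X]setTI.
  exact: rmulg_measurable.
rewrite (@fubini_tonelli _ _ _ _ _ mu nu F)//.
transitivity (\int[nu]_y \int[mu]_x H (y, x)).
  apply: eq_integral => y _.
  rewrite -[RHS](integral_left_invariant y lmu)//; last first.
    exact: (measurable_fun_pair2 y mH).
  apply: eq_integral => x _; rewrite /H /F /= mulKg.
  by [].
rewrite (@fubini_tonelli _ _ _ _ _ nu mu H)//.
transitivity (\int[mu]_x ((\1_B x)%:E * \int[nu]_y f (y^-1)%g)).
  apply: eq_integral => x _; rewrite -[LHS](integral_left_invariant x lnu)//; last first.
    exact: (measurable_fun_pair1 x mH).
  rewrite -ge0_integralZl//; last first.
    exact: (measurableT_comp mf invg_measurable).
  apply: eq_integral => y _.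
  by rewrite /H /= invgM mulgVK muleC.
rewrite ge0_integralZr//.
- by rewrite integral_indic// setIT.
- exact/measurable_EFinP.
- by apply: integral_ge0.
Qed.

(* Apply haar_fubini to f = 1_A / D with D(x) = mu(B x^-1): both mu and its
   right translate are multiples of the same functional of A. *)
Lemma right_translate_proportional mu (B : set T) (g : G) (A : set T) :
  left_invariant mu -> measurable B ->
  (forall x, 0 < mu [set y | B (y * x)%g] < +oo) -> measurable A ->
  mu [set x | A (x * g)%g] * mu B = mu A * mu [set x | B (x * g)%g].
Proof.
move=> lmu mB B0 mA.
pose D (x : T) := mu [set y | B (y * x)%g].
have mD : measurable_fun setT D.
  have mM : measurable [set z : T * T | B (z.2 * z.1)%g].
    rewrite -[X in measurable X]setTI.
    suff mul_m : measurable_fun setT (fun z : T * T => (z.2 * z.1)%g : T) by exact: mul_m.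
    apply: continuous_borel => U oU; apply: open_borel2; apply: open_comp oU => z _.
    by apply: (@continuous_mulg G (G * G)%type snd fst); [exact: cvg_snd|exact: cvg_fst].
  have := measurable_fun_xsection mu mM.
  rewrite (_ : mu \o _ = D)//; apply/funext => x /=; congr (mu _).
  by apply/seteqP; split => y; rewrite /xsection /= inE.
pose h (x : T) : \bar R := (\1_A x * (fine (D x)) `^ (- 1))%:E.
have mh : measurable_fun setT h.
  apply/measurable_EFinP; apply: measurable_funM; first exact: measurable_indic.
  apply: (@measurableT_comp _ _ _ _ _ _ (fun x : R => x `^ (- 1))%R _ (fine \o D)) => //.
  exact: (measurableT_comp (fine_measurable measurableT)).
have h0 x : 0 <= h x by rewrite lee_fin mulr_ge0// powR_ge0.
have hD x : h x * D x = (\1_A x)%:E.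
  have /andP[D0 Dy] := B0 x; rewrite -/(D x) in D0 Dy.
  have Df : D x \is a fin_num by rewrite ge0_fin_numE// ltW.
  rewrite /h -[X in _ * X]fineK// -EFinM powRN powRr1 ?fine_ge0 ?ltW//.
  by rewrite -mulrA mulVf ?mulr1// gt_eqF// fine_gt0// D0.
have mr : measurable_fun setT (fun x : T => (x * g)%g : T) by exact: rmulg_measurable.
pose mug := push_measure mu mr.
have mrC (C : set T) k : measurable C -> measurable [set x : T | C (x * k)%g].
  move=> mC; rewrite -[X in measurable X]setTI; exact: (rmulg_measurable k).
have lmug : left_invariant mug.
  move=> k C mC.
  transitivity (mu ((fun x => k^-1 * x)%g @^-1` [set x | C (x * g)%g])).
    congr (mu _); apply/seteqP; split => [x [y Cy kyE]|x Cx] /=.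
      by rewrite -mulgA -kyE mulKg.
    by exists (k^-1 * x * g)%g => //; rewrite -mulgA mulVKg.
  by rewrite left_invariant_preimage//; exact: mrC.
have sfg : sigma_finite setT mug.
  have [F FT mF] := sigma_finiteT mu.
  exists (fun i => [set x | F i (x * g^-1)%g]).
    apply/seteqP; split => // x _.
    have : (\bigcup_i F i) (x * g^-1)%g by rewrite -FT.
    by move=> [i _ Fi]; exists i.
  move=> i; split; first by apply: mrC; case: (mF i).
  rewrite /mug /= /pushforward (_ : _ @^-1` _ = F i); first by case: (mF i).
  by apply/seteqP; split => x; rewrite /= mulgK.
have key (m : {sigma_finite_measure set T -> \bar R}) : left_invariant m ->
    m A = m B * \int[mu]_y h (y^-1)%g.
  move=> lm; rewrite -(haar_fubini lm lmu mh h0 mB).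
  under eq_integral do rewrite -/(D _) hD.
  by rewrite integral_indic// setIT.
have e1 : mug A = mug B * \int[mu]_y h (y^-1)%g := key (sigma_finite_of sfg) lmug.
have e2 : mu A = mu B * \int[mu]_y h (y^-1)%g := key mu lmu.
have -> : mu [set x | A (x * g)%g] = mug A by [].
have -> : mu [set x | B (x * g)%g] = mug B by [].
by rewrite e1 e2 muleAC [RHS]muleAC; congr (_ * _); rewrite muleC.
Qed.
End borel_group.

(** * Topology and Haar measure of the group seen in the chart *)

Section chart_measure.
Context (R : realType) (G : topologicalGroupType) (c : iwasawa_chart R G).
Local Notation k := (ck c).
Local Notation n := (cn c).
Local Notation a := (ca c).
Local Notation T := (borelType G).

Definition from_chart (z : R * (R * R)) : G := (k z.1 * (n z.2.2 * a z.2.1))%g.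
Definition to_chart (g : G) : R * (R * R) := (cs c g, (cu c g, cv c g)).

Lemma to_chartK : cancel to_chart from_chart.
Proof. by move=> g; rewrite /from_chart /to_chart /= -chartE. Qed.

Lemma from_chart_continuous : continuous from_chart.
Proof.
move=> z.
apply: (@continuous_mulg G (R * (R * R))%type (fun z => k z.1)
  (fun z => (n z.2.2 * a z.2.1)%g)).
  by apply: (@continuous_comp _ _ _ fst k); [exact: cvg_fst|exact: ck_continuous].
have c2 : {for z, continuous (fun z : R * (R * R) => z.2)} by exact: cvg_snd.
apply: (@continuous_mulg G (R * (R * R))%type (fun z => n z.2.2) (fun z => a z.2.1)).
  apply: (@continuous_comp _ _ _ (fun z : R * (R * R) => z.2.2) n).
    by apply: (@continuous_comp _ _ _ snd snd) => //; exact: cvg_snd.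
  exact: cn_continuous.
apply: (@continuous_comp _ _ _ (fun z : R * (R * R) => z.2.1) a).
  by apply: (@continuous_comp _ _ _ snd fst) => //; exact: cvg_fst.
exact: ca_continuous.
Qed.

Definition chart_box (s u v e : R) : set G :=
  [set g | [/\ `|s - cs c g| < e, `|u - cu c g| < e & `|v - cv c g| < e]].

Lemma chart_box_open s u v e : open (chart_box s u v e).
Proof.
have op (f : G -> R) x : continuous f -> open [set g | `|x - f g| < e].
  move=> cf; have -> : [set g | `|x - f g| < e] = f @^-1` ball x e by [].
  by apply: open_comp => [y _|]; [exact: cf|exact: ball_open].
have -> : chart_box s u v e = [set g | `|s - cs c g| < e] `&`
    ([set g | `|u - cu c g| < e] `&` [set g | `|v - cv c g| < e]).
  by apply/seteqP; split => [g [? ? ?]|g [? [? ?]]].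
by apply: openI; [|apply: openI]; apply: op; [exact: cs_continuous|
  exact: cu_continuous|exact: cv_continuous].
Qed.

Lemma chart_box_nbhs x W : nbhs x W ->
  exists2 e : R, 0 < e & chart_box (cs c x) (cu c x) (cv c x) e `<=` W.
Proof.
move=> xW; have : nbhs (to_chart x) (from_chart @^-1` W).
  by apply: from_chart_continuous; rewrite to_chartK.
move=> /nbhs_ballP[e /= e0 eW]; exists e => // g [gs gu gv].
by rewrite -(to_chartK g); apply: eW; split => //; split.
Qed.

Definition rat_box (q : rat * rat * rat * nat) : set G :=
  chart_box (ratr q.1.1.1) (ratr q.1.1.2) (ratr q.1.2) (q.2.+1%:R^-1).

Definition chart_base (i : nat) : set G :=
  if unpickle i is Some q then rat_box q else set0.

Lemma chart_baseP : countable_base chart_base.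
Proof.
split=> [i|x W xW].
  by rewrite /chart_base; case: unpickle => [q|]; [exact: chart_box_open|exact: open0].
have [e e0 eW] := chart_box_nbhs xW.
pose m := Num.trunc (2 / e); pose d : R := m.+1%:R^-1.
have d0 : 0 < d by rewrite invr_gt0 ltr0n.
have de : d + d <= e.
  have : 2 / e < m.+1%:R by rewrite truncnS_gt.
  rewrite ltr_pdivrMr// mulrC -ltr_pdivrMr ?ltr0n// => /ltW.
  by rewrite -/d; lra.
have app (y : R) : exists q : rat, `|ratr q - y| < d.
  have /rat_in_itvoo[q] : y - d < y + d by lra.
  by rewrite in_itv/= => /andP[? ?]; exists q; rewrite ltr_norml; apply/andP; lra.
have [q1 h1] := app (cs c x); have [q2 h2] := app (cu c x).
have [q3 h3] := app (cv c x).
exists (pickle (q1, q2, q3, m)); rewrite /chart_base pickleK.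
  by split.
apply: subset_trans eW => g [/= g1 g2 g3].
have tri (q y z : R) : `|q - y| < d -> `|q - z| < d -> `|y - z| < e.
  move=> qy qz; rewrite (lt_le_trans _ de)// -(subrKA q).
  by rewrite (le_lt_trans (ler_normD _ _))// (distrC y) ltrD.
by split; [exact: tri h1 g1|exact: tri h2 g2|exact: tri h3 g3].
Qed.

Lemma cs_measurable : measurable_fun setT (cs c : T -> R).
Proof. by apply: continuous_borelR; exact: cs_continuous. Qed.
Lemma cu_measurable : measurable_fun setT (cu c : T -> R).
Proof. by apply: continuous_borelR; exact: cu_continuous. Qed.
Lemma cv_measurable : measurable_fun setT (cv c : T -> R).
Proof. by apply: continuous_borelR; exact: cv_continuous. Qed.

Variable mu : {measure set T -> \bar R}.
Hypothesis Hmu : haar_measure mu.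

Let lmu : left_invariant mu. Proof. by case: Hmu. Qed.

Definition closed_box (e : R) : set T :=
  [set g | [/\ `|cs c g| <= e, `|cu c g| <= e & `|cv c g| <= e]].

Lemma closed_box_compact e : compact (closed_box e : set G).
Proof.
have cK : compact (`[- e, e]%classic `*` (`[- e, e]%classic `*` `[- e, e]%classic)
    : set (R * (R * R))).
  by apply: compact_setX; [|apply: compact_setX]; exact: segment_compact.
suff -> : closed_box e = from_chart @` (`[- e, e] `*` (`[- e, e] `*` `[- e, e])).
  apply: continuous_compact cK; apply: continuous_subspaceT.
  exact: from_chart_continuous.
apply/seteqP; split => [g [g1 g2 g3]|_ [[s [u v]] [/= s1 [u1 v1]] <-]].
  exists (to_chart g); last exact: to_chartK.
  by rewrite /= !in_itv/= -!ler_norml.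
rewrite /closed_box /= /from_chart /= csE cuE cvE !ler_norml.
by move: s1 u1 v1; rewrite !in_itv.
Qed.

Lemma closed_box_measurable e : measurable (closed_box e).
Proof.
have mf (f : T -> R) : measurable_fun setT f -> measurable [set g | `|f g| <= e].
  move=> mf; rewrite -[X in measurable X]setTI.
  have -> : [set g | `|f g| <= e] = f @^-1` `[- e, e].
    by apply/seteqP; split => g; rewrite /= in_itv/= ler_norml.
  by apply: mf => //; exact: measurable_itv.
have -> : closed_box e = [set g | `|cs c g| <= e] `&`
    ([set g | `|cu c g| <= e] `&` [set g | `|cv c g| <= e]).
  by apply/seteqP; split => [g [? ? ?]|g [? [? ?]]].
by apply: measurableI; [|apply: measurableI]; apply: mf; [exact: cs_measurable|
  exact: cu_measurable|exact: cv_measurable].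
Qed.

Lemma haar_compact_lty (K : set G) : compact K -> (mu K < +oo)%E.
Proof. by case: Hmu => _ _ + _ _; exact. Qed.

Lemma haar_sigma_finite : sigma_finite setT mu.
Proof.
exists (fun i => closed_box i%:R).
  apply/seteqP; split => // g _.
  pose m := (Num.trunc `|cs c g| + Num.trunc `|cu c g| + Num.trunc `|cv c g|).+1.
  exists m => //.
  have le_m (x : R) i : (Num.trunc `|x| <= i)%N -> `|x| <= i.+1%:R.
    by move=> xi; rewrite (le_trans (ltW (truncnS_gt _)))// ler_nat.
  by split; apply: le_m; rewrite ?leq_addl// -addnA ?leq_addr// addnCA leq_addr.
move=> i; split; first exact: closed_box_measurable.
by apply: haar_compact_lty; exact: closed_box_compact.
Qed.

(** If [U] were null, so would be its translates, which cover [G]; countably many null basic open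
    sets would then cover [G], whose measure is not 0. *)
Lemma haar_open_gt0 (U : set G) : open U -> U !=set0 -> (0 < mu U)%E.
Proof.
move=> oU [x Ux]; rewrite lt_neqAle measure_ge0 andbT; apply/negP => /eqP mU0.
have mU : measurable (U : set T) by exact: open_borel.
pose F i : set T := if mu (chart_base i) == 0%E then chart_base i else set0.
have mF i : measurable (F i).
  rewrite /F; case: ifP => // _; apply: open_borel; exact: chart_baseP.1.
have F0 i : mu (F i) = 0%E by rewrite /F; case: ifPn => [/eqP//|_]; rewrite measure0.
have FT : \bigcup_i F i = setT.
  apply/seteqP; split => // y _.
  pose V := ((fun z => x * y^-1 * z)%g @^-1` U).
  have cl : continuous (fun z : G => x * y^-1 * z)%g.
    move=> z; apply: (@continuous_mulg G G (fun=> x * y^-1)%g id).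
      exact: cst_continuous.
    exact: cvg_id.
  have oV : open V by apply: open_comp oU => z _; exact: cl.
  have Vy : V y by rewrite /V /= mulgVK.
  have [i yi iV] := chart_baseP.2 _ _ (open_nbhs_nbhs (conj oV Vy)).
  exists i => //; rewrite /F ifT//.
  have mV : mu V = 0%E by rewrite /V left_invariant_preimage.
  rewrite eq_le measure_ge0 andbT -mV le_measure// inE.
  - by apply: open_borel; exact: chart_baseP.1.
  - exact: open_borel.
case: Hmu => /eqP mT0 _ _ _ _; apply: mT0.
apply/eqP; rewrite eq_le measure_ge0 andbT -FT.
rewrite (le_trans (measure_sigma_subadditive _ mF _ _))//.
- by rewrite FT; exact: measurableT.
- by rewrite eseries0// => i _ _; exact: F0.
Qed.

End chart_measure.

(** * Unimodularity *)

Section unimodular.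
Context (R : realType) (G : topologicalGroupType) (c : iwasawa_chart R G).
Local Notation k := (ck c).
Local Notation n := (cn c).
Local Notation a := (ca c).
Local Notation T := (borelType G).
Variable mu : {measure set T -> \bar R}.
Hypothesis Hmu : haar_measure mu.

Let lmu : left_invariant mu. Proof. by case: Hmu. Qed.
Let smu := sigma_finite_of (haar_sigma_finite c Hmu).
Let B : set T := chart_box c 0 0 0 1.

Let mr (C : set T) g : measurable C -> measurable [set x : T | C (x * g)%g].
Proof.
move=> mC; rewrite -[X in measurable X]setTI; exact: (rmulg_measurable g).
Qed.

Let mB : measurable B. Proof. by apply: open_borel; exact: chart_box_open. Qed.

Let coord1 : [/\ cs c 1%g = 0, cu c 1%g = 0 & cv c 1%g = 0].
Proof.
have <- : (k 0 * (n 0 * a 0))%g = 1%g by rewrite ck0 cn0 ca0 !mulg1.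
by rewrite csE cuE cvE.
Qed.

Lemma unit_box_translate (g : G) : (0 < mu [set x | B (x * g)%g] < +oo)%E.
Proof.
have cr (h : G) : continuous (fun x : G => x * h)%g.
  move=> x; apply: (@continuous_mulg G G id (fun=> h)); first exact: cvg_id.
  exact: cst_continuous.
apply/andP; split.
  apply: (haar_open_gt0 c Hmu).
    apply: (@open_comp _ _ (fun x : G => x * g)%g B) => [x _|]; first exact: cr.
    exact: chart_box_open.
  exists (g^-1)%g; rewrite /= mulVg; have [e1 e2 e3] := coord1.
  by rewrite /B /chart_box /= e1 e2 e3 !subrr normr0.
pose K : set T := [set x | closed_box c 1 (x * g)%g].
have mK : measurable K by apply: mr; exact: closed_box_measurable.
have cK : compact (K : set G).
  have -> : K = (fun x : G => x * g^-1)%g @` closed_box c 1.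
    apply/seteqP; split => [x Kx|_ [x Kx <-]]; last by rewrite /K /= mulgVK.
    by exists (x * g)%g => //; rewrite mulgK.
  apply: (@continuous_compact G G (fun x : G => x * g^-1)%g (closed_box c 1));
    last exact: closed_box_compact.
  by apply: continuous_subspaceT; exact: cr.
apply: le_lt_trans (haar_compact_lty Hmu cK); apply: le_measure; rewrite ?inE//.
  exact: mr.
by move=> x [/= h1 h2 h3]; move: h1 h2 h3; rewrite !sub0r !normrN => /ltW ? /ltW ? /ltW ?.
Qed.

Let mB_gt0 : (0 < mu B < +oo)%E.
Proof.
have := unit_box_translate 1%g; suff -> : [set x | B (x * 1)%g] = B by [].
by apply/seteqP; split => x /=; rewrite mulg1.
Qed.

(** The factor by which right translation by the inverse of [g] scales [mu], read off one test box;
    by [right_translate_proportional] it is the same for every Borel set. *)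
Definition modular (g : G) : R := fine (mu [set x | B (x * g)%g]) / fine (mu B).

Lemma modular_gt0 g : 0 < modular g.
Proof. by rewrite divr_gt0// fine_gt0// unit_box_translate. Qed.

Lemma right_translateE g (A : set T) : measurable A ->
  mu [set x | A (x * g)%g] = (mu A * (modular g)%:E)%E.
Proof.
move=> mA.
have := @right_translate_proportional _ _ (chart_baseP c) R smu B g A lmu mB
  unit_box_translate mA.
rewrite /smu /sigma_finite_of.
have /andP[B0 By] := mB_gt0; have /andP[Bg0 Bgy] := unit_box_translate g.
have fB : mu B \is a fin_num by rewrite ge0_fin_numE// ltW.
have fBg : mu [set x | B (x * g)%g] \is a fin_num by rewrite ge0_fin_numE// ltW.
have B_neq0 : fine (mu B) != 0 by rewrite gt_eqF// fine_gt0// B0.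
have eB : mu B = (fine (mu B))%:E by rewrite fineK.
have eBg : mu [set x | B (x * g)%g] = (fine (mu [set x | B (x * g)%g]))%:E.
  by rewrite fineK.
rewrite eB eBg => E; rewrite /modular EFinM muleA -E -muleA -EFinM divff//.
by rewrite mule1.
Qed.

Lemma modularM g h : modular (g * h)%g = modular g * modular h.
Proof.
have : mu [set x | B (x * (g * h))%g] = (mu B * (modular h)%:E * (modular g)%:E)%E.
  rewrite -right_translateE// -right_translateE; last exact: mr.
  by congr (mu _); apply/seteqP; split => x; rewrite /= mulgA.
move=> E; have /andP[B0 By] := mB_gt0.
have fB : mu B \is a fin_num by rewrite ge0_fin_numE// ltW.
have B_neq0 : fine (mu B) != 0 by rewrite gt_eqF// fine_gt0// B0.
rewrite [LHS]/modular E -(fineK fB) -!EFinM /=.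
by field.
Qed.

Lemma modular1 : modular 1%g = 1.
Proof.
have := modularM 1%g 1%g; rewrite mulg1 => /eqP; rewrite -subr_eq0.
rewrite -{1}[modular 1%g]mulr1 -mulrBr mulf_eq0 gt_eqF ?modular_gt0//=.
by rewrite subr_eq0 => /eqP.
Qed.

Lemma modularV g : modular (g^-1)%g = (modular g)^-1.
Proof.
have g0 : modular g != 0 by rewrite gt_eqF ?modular_gt0.
by apply: (mulfI g0); rewrite -modularM mulgV modular1 divff.
Qed.

Lemma modularJ g h : modular (h * g * h^-1)%g = modular g.
Proof.
rewrite !modularM modularV mulrAC divff ?mul1r//.
by rewrite gt_eqF ?modular_gt0.
Qed.

(** Conjugation by a(ln 2) turns n(v) into n(2 v) = n(v)^2, so the modulus equals its own square. *)
Lemma modular_n v : modular (n v) = 1.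
Proof.
have : modular (n (2 * v)) = modular (n v).
  rewrite -[RHS](modularJ _ (a (ln 2))) ca_cn lnK ?posrE// mulgK//.
rewrite mulrDl mul1r cnD modularM => /eqP; rewrite -subr_eq0.
rewrite -{3}[modular (n v)]mulr1 -mulrBr mulf_eq0 gt_eqF ?modular_gt0//=.
by rewrite subr_eq0 => /eqP.
Qed.

(** The Weyl element conjugates a(u) into its inverse, so the modulus is its own inverse, and it is
    positive. *)
Lemma modular_a u : modular (a u) = 1.
Proof.
have : modular (a (- u)) = modular (a u).
  by rewrite -[RHS](modularJ _ (cw c)) cw_ca mulgK.
rewrite caN modularV => /(congr1 (fun x => x * modular (a u))).
rewrite mulVf ?gt_eqF ?modular_gt0// -expr2 => /esym/eqP.
rewrite sqrf_eq1 => /orP[/eqP//|/eqP e].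
by have := modular_gt0 (a u); rewrite e oppr_gt0 ltr10.
Qed.

(* The unipotent w n(v) w^-1 = k(s) n a has modulus 1, so k(s) does too; s
   depends continuously on v and is not constant. *)
Lemma modular_k s : modular (k s) = 1.
Proof.
pose w := cw c; pose f v := cs c (w * n v * w^-1)%g.
have kf v : modular (k (f v)) = 1.
  have := modularJ (n v) w; rewrite {1}(chartE c (w * n v * w^-1)%g) -/(f v).
  by rewrite !modularM !modular_n modular_a !mulr1.
have cf : continuous f.
  move=> v; apply: (@continuous_comp _ _ _ (fun v => w * n v * w^-1)%g (cs c));
    last exact: cs_continuous.
  apply: (@continuous_mulg G R (fun v => w * n v)%g (fun=> w^-1)%g); last first.
    exact: cst_continuous.
  by apply: (@continuous_mulg G R (fun=> w) n); [exact: cst_continuous|exact: cn_continuous].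
have f0 : f 0 = 0 by rewrite /f cn0 mulg1 mulgV; case: coord1.
have f1 : f 1 != 0 by exact/cw_cn/oner_neq0.
have kV t : modular (k t) = 1 -> modular (k (- t)) = 1.
  by rewrite ckN modularV => ->; rewrite invr1.
have small t : `|t| <= `|f 1| -> modular (k t) = 1.
  have between x : Num.min (f 0) (f 1) <= x <= Num.max (f 0) (f 1) -> modular (k x) = 1.
    move=> xf; have [] := @IVT R f 0 1 x ler01 _ xf.
      exact: continuous_subspaceT.
    by move=> v _ <-.
  rewrite f0 in between; move=> tf.
  have [f1_gt0|f1_lt0|f1_eq0] := ltgtP 0 (f 1); last by rewrite -f1_eq0 eqxx in f1.
    rewrite min_l ?max_r ?(ltW f1_gt0)// in between.
    rewrite (gtr0_norm f1_gt0) in tf.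
    have [t0|t0] := lerP 0 t; first by apply: between; rewrite t0 -(ger0_norm t0).
    rewrite -[t]opprK; apply: kV; apply: between.
    by rewrite -(ltr0_norm t0) normr_ge0.
  rewrite min_r ?max_l ?(ltW f1_lt0)// in between.
  rewrite (ltr0_norm f1_lt0) in tf.
  have [t0|t0] := lerP t 0.
    by apply: between; rewrite t0 andbT -lerN2 -(ler0_norm t0).
  rewrite -[t]opprK; apply: kV; apply: between.
  by rewrite lerNr -(gtr0_norm t0) tf (gtr0_norm t0) oppr_le0 ltW.
(* [s / N] is small enough to be, up to sign, a value of [f]; [s] follows by taking powers. *)
pose N := (Num.trunc (`|s| / `|f 1|)).+1.
have kN t m : modular (k (m%:R * t)) = modular (k t) ^+ m.
  elim: m => [|m IH]; first by rewrite mul0r ck0 modular1 expr0.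
  by rewrite -natr1 mulrDl mul1r ckD modularM IH exprSr.
have sE : s = N%:R * (s / N%:R) by rewrite mulrC divfK// pnatr_eq0.
rewrite sE kN small ?expr1n// normrM normfV (@ger0_norm _ N%:R)//.
rewrite ler_pdivrMr ?ltr0n// mulrC -ler_pdivrMr ?normr_gt0//.
by rewrite ltW// truncnS_gt.
Qed.

Lemma right_invariant g (A : set T) : measurable A -> mu [set x | A (x * g)%g] = mu A.
Proof.
move=> mA; rewrite right_translateE// {1}(chartE c g) !modularM.
by rewrite modular_k modular_n modular_a !mulr1 mule1.
Qed.

(** By right invariance the left side of [haar_fubini] for the indicator of [A] is mu(A) mu(B), and
    the finite positive factor mu(B) cancels. *)
Lemma inverse_invariant (A : set T) : measurable A -> mu [set x | A (x^-1)%g] = mu A.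
Proof.
move=> mA.
have m1A : measurable_fun setT (fun x : T => (\1_A x : R)%:E).
  by apply/measurable_EFinP; exact: measurable_indic.
have mAV : measurable [set x : T | A (x^-1)%g].
  by rewrite -[X in measurable X]setTI; exact: invg_measurable.
have E : (\int[mu]_x ((\1_A x)%:E * mu [set y | B (y * x)%g]) =
    mu B * \int[mu]_y (\1_A (y^-1)%g)%:E)%E.
  exact: (@haar_fubini _ _ (chart_baseP c) R smu smu _ B lmu lmu m1A _ mB).
have IV : (\int[mu]_y (\1_A (y^-1)%g)%:E = mu [set x | A (x^-1)%g])%E.
  rewrite (eq_integral (fun y : T => (\1_[set x | A (x^-1)%g] y)%:E))//.
  by rewrite integral_indic// setIT.
have IA : (\int[mu]_x ((\1_A x)%:E * mu [set y | B (y * x)%g]) = mu A * mu B)%E.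
  under eq_integral do rewrite (right_invariant _ mB).
  by rewrite ge0_integralZr// integral_indic// setIT.
have /andP[B0 By] := mB_gt0.
have fB : mu B \is a fin_num by rewrite ge0_fin_numE// ltW.
have B_neq0 : fine (mu B) != 0 by rewrite gt_eqF// fine_gt0// B0.
have eB : mu B = (fine (mu B))%:E by rewrite fineK.
move: E; rewrite IA IV muleC => /(congr1 (fun x => (fine (mu B))^-1%:E * x)%E).
by rewrite eB !muleA -!EFinM mulVf// !mul1e => ->.
Qed.

End unimodular.

Lemma fubini_set d1 d2 (T1 : measurableType d1) (T2 : measurableType d2)
    (R : realType) (m1 : {sigma_finite_measure set T1 -> \bar R})
    (m2 : {sigma_finite_measure set T2 -> \bar R}) (S : set (T1 * T2)) :
  measurable S ->
  (\int[m1]_x m2 [set y | S (x, y)] = \int[m2]_y m1 [set x | S (x, y)])%E.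
Proof.
move=> mS.
have mf : measurable_fun setT (fun z : T1 * T2 => (\1_S z : R)%:E).
  by apply/measurable_EFinP; exact: measurable_indic.
transitivity (\int[m1]_x \int[m2]_y (\1_S (x, y) : R)%:E)%E.
  apply: eq_integral => x _.
  rewrite (eq_integral (fun y => (\1_[set y | S (x, y)] y : R)%:E))//.
  rewrite integral_indic ?setIT//.
  by have := measurable_xsection x mS; rewrite xsectionE.
rewrite (@fubini_tonelli _ _ _ _ _ m1 m2 (fun z => (\1_S z : R)%:E))//.
apply: eq_integral => y _.
rewrite (eq_integral (fun x => (\1_[set x | S (x, y)] x : R)%:E))//.
rewrite integral_indic ?setIT//.
by have := measurable_ysection y mS; rewrite ysectionE.
Qed.

(** * Translation-invariant measures on the line *)

Section translation_invariant.
Context {R : realType}.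
Local Open Scope ereal_scope.
Local Notation leb := (@lebesgue_measure R).

Local Notation RR := (measurableTypeR R).

Lemma measurable_shift (x : R) : measurable_fun setT (fun y : RR => (x + y)%R : RR).
Proof. exact: (@measurable_funD _ RR R setT (cst x) id). Qed.

Lemma lebesgue_shift (x : R) (A : set RR) : measurable A ->
  leb [set y | A (x + y)%R] = leb A.
Proof.
move=> mA; pose m := push_measure leb (measurable_shift x).
have -> : leb [set y | A (x + y)%R] = m A by [].
apply/esym; apply: (lebesgue_measure_unique (mu := m)) => // _ [[a b] _ <-].
rewrite /m /= /pushforward.
have -> : (fun y => (x + y)%R) @^-1` `]a, b]%classic = `](a - x)%R, (b - x)%R]%classic.
  by apply/seteqP; split => y; rewrite /= !in_itv/= ltrBlDl lerBrDl.
rewrite !lebesgue_measure_itv/= !lte_fin ltrD2r; case: ifP => // _.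
by rewrite -!EFinB; congr EFin; ring.
Qed.

(** Fubini for [m] and Lebesgue measure on the pairs (x, y) with x in A and y - x in [-1, 0[.
    Integrating over y gives m(A); substituting y + x for x turns the conditions into y + x in A and
    x in ]0, 1], which gives the right side. *)
Lemma translation_invariant_unique (m : {measure set RR -> \bar R}) :
  (forall x (A : set RR), measurable A -> m [set y | A (x + y)%R] = m A) ->
  m `]0%R, 1%R]%classic < +oo ->
  forall A, measurable A -> m A = m `]0%R, 1%R]%classic * leb A.
Proof.
move=> mD m1 A mA.
have sf : sigma_finite setT m.
  exists (fun i : nat => `](- i%:R)%R, i%:R]%classic).
    apply/seteqP; split => // x _; exists (Num.trunc `|x|).+1 => //=.
    have := truncnS_gt `|x|; rewrite in_itv/= ltr_norml => /andP[-> /ltW]; exact.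
  move=> i; split; first exact: measurable_itv.
  have unit_lty (x : R) : m `]x, (x + 1)%R]%classic < +oo.
    rewrite -(mD x); last exact: measurable_itv.
    have -> // : [set y : RR | `]x, (x + 1)%R]%classic (x + y)%R] = `]0%R, 1%R]%classic.
    by apply/seteqP; split => y; rewrite /= !in_itv/= ltrDl lerD2l.
  have up_lty (j : nat) : m `](- i%:R)%R, (- i%:R + j%:R)%R]%classic < +oo.
    elim: j => [|j IH]; first by rewrite addr0 set_itvoc0 measure0.
    pose x : R := (- i%:R + j%:R)%R.
    have -> : `](- i%:R)%R, (- i%:R + j.+1%:R)%R]%classic =
        `](- i%:R)%R, x]%classic `|` `]x, (x + 1)%R]%classic :> set R.
      have -> : (- i%:R + j.+1%:R = x + 1 :> R)%R by rewrite /x -addrA natr1.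
      have ix : (- i%:R <= x)%R by rewrite lerDl.
      apply/seteqP; split => y; rewrite /= !in_itv/=.
        move=> /andP[y1 y2]; have [yj|yj] := lerP y x; first by left; rewrite y1.
        by right; rewrite y2.
      move=> [/andP[-> y2]|/andP[y1 ->]]; last by rewrite andbT (le_lt_trans _ y1).
      by rewrite (le_trans y2)// lerDl.
    rewrite (le_lt_trans (measureU2 _ _ _))// lte_add_pinfty//; exact: unit_lty.
  by have := up_lty (i + i)%N; rewrite natrD addrA addNr add0r.
pose sm := sigma_finite_of sf.
pose I1 : set RR := `]0%R, 1%R]%classic.
(* The mirror image of [I1], half-open on the other side, so that - x lies in [J1] exactly when x
   lies in [I1]. *)
pose J1 : set RR := `[(-1)%R, 0%R[%classic.
have mI1 : measurable I1 by exact: measurable_itv.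
have mJ1 : measurable J1 by exact: measurable_itv.
have lebJ : leb J1 = 1 by rewrite lebesgue_measure_itv/= lte_fin ltrN10 -EFinB sub0r opprK.
have mpre (f : RR * RR -> RR) (C : set RR) : measurable_fun setT f -> measurable C ->
    measurable (f @^-1` C) by move=> mf mC; rewrite -[X in measurable X]setTI; exact: mf.
have msub : measurable_fun setT (fun z : RR * RR => (z.2 - z.1)%R : RR).
  exact: (@measurable_funB _ (RR * RR)%type R setT snd fst measurable_snd measurable_fst).
have madd : measurable_fun setT (fun z : RR * RR => (z.2 + z.1)%R : RR).
  exact: (@measurable_funD _ (RR * RR)%type R setT snd fst measurable_snd measurable_fst).
pose S1 : set (RR * RR) := [set z | A z.1 /\ J1 (z.2 - z.1)%R].
pose S2 : set (RR * RR) := [set z | A (z.2 + z.1)%R /\ I1 z.1].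
have mS1 : measurable S1.
  exact: measurableI (mpre _ _ measurable_fst mA) (mpre _ _ msub mJ1).
have mS2 : measurable S2.
  exact: measurableI (mpre _ _ madd mA) (mpre _ _ measurable_fst mI1).
transitivity (\int[m]_x leb [set y | S1 (x, y)]).
  rewrite -[LHS]mul1e -{1}lebJ -(setIT A) -integral_indic// -ge0_integralZl//; last first.
    by apply/measurable_EFinP; exact: measurable_indic.
  apply: eq_integral => x _.
  rewrite indicE; have [xA|xA] := boolP (x \in A).
    rewrite mule1 -(lebesgue_shift (- x) mJ1); congr (leb _).
    apply/seteqP; split => [y|y [_]]; rewrite /S1 /= (addrC _ y)//.
    by move=> Jy; split => //; exact: set_mem.
  rewrite mule0 (_ : [set y | _] = set0) ?measure0//.
  by apply/seteqP; split => y // [/= Ax _]; move/negP: xA; apply; exact/mem_set.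
transitivity (\int[m]_x leb [set y | S2 (x, y)]).
  rewrite (@fubini_set _ _ _ _ _ sm leb)// (@fubini_set _ _ _ _ _ sm leb)//.
  apply: eq_integral => y _.
  have mS1y : measurable [set x | S1 (x, y)].
    by have := measurable_ysection y mS1; rewrite ysectionE.
  rewrite /sm /sigma_finite_of -(mD y _ mS1y); congr (m _).
  apply/seteqP; split => x; rewrite /S1 /S2 /J1 /I1 /= !in_itv/=;
    rewrite (_ : (y - (y + x) = - x)%R); try ring;
    by rewrite lerN2 oppr_lt0 andbC.
transitivity (\int[m]_x (leb A * (\1_I1 x)%:E)).
  apply: eq_integral => x _; rewrite indicE; have [xI|xI] := boolP (x \in I1).
    rewrite mule1 -(lebesgue_shift x mA); congr (leb _).
    apply/seteqP; split => [y [/= Ay _]|y /= Ay]; first by rewrite addrC.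
    by split; [rewrite /= addrC|exact: set_mem].
  rewrite mule0 (_ : [set y | _] = set0) ?measure0//.
  by apply/seteqP; split => y // [/= _ Ix]; move/negP: xI; apply; exact/mem_set.
rewrite ge0_integralZl//; last by apply/measurable_EFinP; exact: measurable_indic.
by rewrite integral_indic// setIT muleC.
Qed.

End translation_invariant.

(** * Haar measure in coordinates *)

Section coordinate_measures.
Context (R : realType) (G : topologicalGroupType) (c : iwasawa_chart R G).
Local Notation k := (ck c).
Local Notation n := (cn c).
Local Notation a := (ca c).
Local Notation T := (borelType G).
Local Notation RR := (measurableTypeR R).
Local Notation leb := (@lebesgue_measure R).
Variable mu : {measure set T -> \bar R}.
Hypothesis Hmu : haar_measure mu.
Let lmu : left_invariant mu. Proof. by case: Hmu. Qed.

(* The opposite coordinates g = n(kv) a(ku) k(kt) = a(ku) n(kw) k(kt). *)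
Definition kt (g : G) : R := - cs c (g^-1)%g.
Definition ku (g : G) : R := - cu c (g^-1)%g.
Definition kw (g : G) : R := - cv c (g^-1)%g.
Definition kv (g : G) : R := expR (ku g) * kw g.

Lemma ankE u w t (g := (a u * n w * k t)%g) : [/\ kt g = t, ku g = u & kw g = w].
Proof.
have gV : (g^-1 = k (- t) * (n (- w) * a (- u)))%g.
  by rewrite /g !invgM ckN cnN caN.
by rewrite /kt /ku /kw gV csE cuE cvE !opprK.
Qed.

Lemma ank_coordinates g : g = (a (ku g) * n (kw g) * k (kt g))%g.
Proof.
rewrite /kt /ku /kw caN cnN ckN -!invgM.
by rewrite -[LHS]invgK; congr (_^-1)%g; exact: chartE.
Qed.

Lemma mulk_coordinates g x :
  [/\ kt (g * k x)%g = kt g + x, ku (g * k x)%g = ku g & kw (g * k x)%g = kw g].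
Proof.
rewrite {1 3 5}(ank_coordinates g) -!mulgA -ckD !mulgA.
by have [-> -> ->] := ankE (ku g) (kw g) (kt g + x).
Qed.

Lemma mula_coordinates g x :
  [/\ kt (a x * g)%g = kt g, ku (a x * g)%g = x + ku g & kw (a x * g)%g = kw g].
Proof.
rewrite {1 3 5}(ank_coordinates g) !mulgA -caD.
by have [-> -> ->] := ankE (x + ku g) (kw g) (kt g).
Qed.

Lemma muln_coordinates g x :
  [/\ kt (n x * g)%g = kt g, ku (n x * g)%g = ku g & kv (n x * g)%g = x + kv g].
Proof.
have e : (n x * g = a (ku g) * n (expR (- ku g) * x + kw g) * k (kt g))%g.
  rewrite {1}(ank_coordinates g) !mulgA cnD !mulgA; congr (_ * _ * _)%g.
  rewrite ca_cn mulrA -expRD subrr expR0 mul1r//.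
have [e1 e2 e3] := ankE (ku g) (expR (- ku g) * x + kw g) (kt g).
rewrite /kv e e1 e2 e3 mulrDr mulrA -expRD subrr expR0 mul1r//.
Qed.

Lemma kt_measurable : measurable_fun setT (kt : T -> RR).
Proof.
apply: (@measurable_funN _ T R setT (fun g : T => cs c (g^-1)%g)).
exact: (measurableT_comp (cs_measurable c) (@invg_measurable G)).
Qed.
Lemma ku_measurable : measurable_fun setT (ku : T -> RR).
Proof.
apply: (@measurable_funN _ T R setT (fun g : T => cu c (g^-1)%g)).
exact: (measurableT_comp (cu_measurable c) (@invg_measurable G)).
Qed.
Lemma kw_measurable : measurable_fun setT (kw : T -> RR).
Proof.
apply: (@measurable_funN _ T R setT (fun g : T => cv c (g^-1)%g)).
exact: (measurableT_comp (cv_measurable c) (@invg_measurable G)).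
Qed.
Lemma kv_measurable : measurable_fun setT (kv : T -> RR).
Proof.
apply: (@measurable_funM _ T R setT (fun g : T => expR (ku g)) kw).
  exact: (measurableT_comp (@measurable_expR R) ku_measurable).
exact: kw_measurable.
Qed.

Let I1 : set RR := `]0, 1]%classic.
Let mI1 : measurable I1. Proof. exact: measurable_itv. Qed.

Lemma measurable_preimage d d' (T1 : measurableType d) (T2 : measurableType d')
    (f : T1 -> T2) (A : set T2) :
  measurable_fun setT f -> measurable A -> measurable (f @^-1` A).
Proof. by move=> mf mA; rewrite -[X in measurable X]setTI; exact: mf. Qed.

(** The image under [f] of [mu] restricted to [S] is a translation-invariant measure on the line.
    Each coordinate is handled in this way, by a one-parameter subgroup that shifts it and fixes
    [S]. *)
Lemma haar_translation_unique (S : set T) (f : T -> RR) (A : set RR) :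
  measurable S -> measurable_fun setT f -> measurable A ->
  (forall x (B : set RR), measurable B ->
    mu [set g | S g /\ B (x + f g)] = mu [set g | S g /\ B (f g)]) ->
  (mu [set g | S g /\ I1 (f g)] < +oo)%E ->
  mu [set g | S g /\ A (f g)] = (mu [set g | S g /\ I1 (f g)] * leb A)%E.
Proof.
move=> mS mf mA fD flty.
have sE (B : set RR) : mrestr mu mS (f @^-1` B) = mu [set g | S g /\ B (f g)].
  by rewrite /mrestr setIC.
pose m : {measure set RR -> \bar R} := push_measure (mrestr mu mS) mf.
have mE (B : set RR) : m B = mu [set g | S g /\ B (f g)] by rewrite -sE.
rewrite -!mE; apply: translation_invariant_unique => //; last by rewrite mE.
move=> x B mB; rewrite !mE; exact: fD.
Qed.

Lemma haar_bounded_lty (S : set T) M : measurable S ->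
  (forall g, S g -> [/\ `|cs c g| <= M, `|cu c g| <= M & `|cv c g| <= M]) ->
  (mu S < +oo)%E.
Proof.
move=> mS SM; have K_lty : (mu (closed_box c M) < +oo)%E.
  exact: (haar_compact_lty Hmu (@closed_box_compact R G c M)).
apply: le_lt_trans K_lty; apply: le_measure; rewrite ?inE//.
exact: closed_box_measurable.
Qed.

Lemma haar_bounded_lty' (S : set T) M : measurable S ->
  (forall g, S g -> [/\ `|kt g| <= M, `|ku g| <= M & `|kw g| <= M]) ->
  (mu S < +oo)%E.
Proof.
move=> mS SM; rewrite -(inverse_invariant c Hmu mS).
apply: (@haar_bounded_lty _ M).
  exact: (measurable_preimage (@invg_measurable G) mS).
by move=> g /SM; rewrite /kt /ku /kw invgK !normrN.
Qed.

Let I1_bound x : I1 x -> `|x| <= 1.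
Proof. by rewrite /I1 /= in_itv/= => /andP[x0 x1]; rewrite gtr0_norm. Qed.

Definition bounded_by (M : R) (D : set (RR * RR)) : Prop :=
  forall u v, D (u, v) -> `|u| <= M /\ `|v| <= M.

Let cuv_measurable : measurable_fun setT (fun g : T => (cu c g, cv c g) : RR * RR).
Proof. exact: measurable_fun_pair (cu_measurable c) (cv_measurable c). Qed.

Let kuv_measurable : measurable_fun setT (fun g : T => (ku g, kv g) : RR * RR).
Proof. exact: measurable_fun_pair ku_measurable kv_measurable. Qed.

Definition left_slab (D : set (RR * RR)) (I : set RR) : set T :=
  [set g | D (cu c g, cv c g) /\ I (cs c g)].
Definition right_slab (D : set (RR * RR)) (I : set RR) : set T :=
  [set g | D (ku g, kv g) /\ I (kt g)].

Lemma left_slab_measurable D I : measurable D -> measurable I -> measurable (left_slab D I).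
Proof.
move=> mD mI; exact: measurableI (measurable_preimage cuv_measurable mD)
  (measurable_preimage (cs_measurable c) mI).
Qed.

Lemma right_slab_measurable D I : measurable D -> measurable I -> measurable (right_slab D I).
Proof.
move=> mD mI; exact: measurableI (measurable_preimage kuv_measurable mD)
  (measurable_preimage kt_measurable mI).
Qed.

Lemma haar_left_slab D M I : measurable D -> bounded_by M D -> measurable I ->
  mu (left_slab D I) = (mu (left_slab D I1) * leb I)%E.
Proof.
move=> mD DM mI; apply: haar_translation_unique => //.
- exact: (measurable_preimage cuv_measurable mD).
- exact: cs_measurable.
- move=> x B mB.
  rewrite -[RHS](left_invariant_preimage (k x) lmu); last exact: left_slab_measurable.
  by congr (mu _); apply/seteqP; split => g; rewrite /= cs_mulk cu_mulk cv_mulk.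
- apply: (@haar_bounded_lty _ (Num.max 1 M)); first exact: left_slab_measurable.
  by move=> g [/DM[uM vM] /I1_bound sM]; split; rewrite le_max ?uM ?vM ?sM ?orbT.
Qed.

(** Right translation by rotations shifts [kt] and fixes [ku] and [kv]; this is where unimodularity
    enters. *)
Lemma haar_right_slab D M I : measurable D -> bounded_by M D -> measurable I ->
  mu (right_slab D I) = (mu (right_slab D I1) * leb I)%E.
Proof.
move=> mD DM mI; apply: haar_translation_unique => //.
- exact: (measurable_preimage kuv_measurable mD).
- exact: kt_measurable.
- move=> x B mB.
  rewrite -[RHS](right_invariant c Hmu (k x)); last exact: right_slab_measurable.
  congr (mu _); apply/seteqP; split => g; rewrite /right_slab /kv /=;
    by have [-> -> ->] := mulk_coordinates g x; rewrite (addrC x).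
- apply: (@haar_bounded_lty' _ (Num.max 1 (Num.max M (expR M * M)))).
    exact: right_slab_measurable.
  move=> g [/DM[uM vM] /I1_bound tM]; split; rewrite !le_max ?uM ?vM ?tM ?orbT//.
  have -> : kw g = expR (- ku g) * kv g by rewrite /kv mulrA -expRD addNr expR0 mul1r.
  rewrite normrM (gtr0_norm (expR_gt0 _)) ler_pM ?expR_ge0// ?orbT// ler_expR.
  by rewrite (le_trans _ uM)// -normrN ler_norm.
Qed.

Section window.
Variable M : R.
Let W : set RR := `[- M, M]%classic.
Let mW : measurable W. Proof. exact: measurable_itv. Qed.
Let Wb u : W u -> `|u| <= M. Proof. by rewrite /W /= in_itv/= ler_norml. Qed.

Let base : set T := [set g | W (ku g) /\ I1 (kt g)].
Lemma mbase : measurable base.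
Proof.
exact: measurableI (measurable_preimage ku_measurable mW) (measurable_preimage kt_measurable mI1).
Qed.

Lemma base_v_lty (a b : R) (S : set T) : measurable S ->
  (forall g, S g -> base g /\ `]a, b]%classic (kv g)) -> (mu S < +oo)%E.
Proof.
move=> mS Sb.
pose N := Num.max 1 (Num.max M (expR M * Num.max `|a| `|b|)).
apply: (@haar_bounded_lty' _ N) => //.
move=> g /Sb[[/Wb uM /I1_bound tM]]; rewrite /= in_itv/= => /andP[av vb].
have kvM : `|kv g| <= Num.max `|a| `|b|.
  rewrite ler_norml; apply/andP; split; last first.
    by rewrite le_max (le_trans vb (ler_norm _)) orbT.
  rewrite lerNl le_max; apply/orP; left.
  by rewrite (le_trans (_ : _ <= - a))// ?lerN2 ?(ltW av)// -normrN ler_norm.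
have kwM : `|kw g| <= expR M * Num.max `|a| `|b|.
  have -> : kw g = expR (- ku g) * kv g by rewrite /kv mulrA -expRD addNr expR0 mul1r.
  rewrite normrM (gtr0_norm (expR_gt0 _)) ler_pM ?expR_ge0// ler_expR.
  by rewrite (le_trans _ uM)// -normrN ler_norm.
by split; rewrite /N !le_max ?uM ?tM ?kwM ?orbT.
Qed.

Definition hset (U : set RR) : set T := [set g | (base g /\ U (ku g)) /\ I1 (kv g)].

Lemma haar_rect (U V : set RR) : measurable U -> measurable V ->
  mu [set g | (base g /\ U (ku g)) /\ V (kv g)] = (mu (hset U) * leb V)%E.
Proof.
move=> mU mV; apply: haar_translation_unique => //.
- exact: measurableI mbase (measurable_preimage ku_measurable mU).
- exact: kv_measurable.
- move=> x B mB.
  rewrite -[RHS](left_invariant_preimage (n x) lmu); last first.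
    apply: measurableI; last exact: (measurable_preimage kv_measurable mB).
    exact: measurableI mbase (measurable_preimage ku_measurable mU).
  congr (mu _); apply/seteqP; split => g; rewrite /base /=;
    by have [-> -> ->] := muln_coordinates g x.
- apply: (@base_v_lty 0 1); last by move=> g [[]].
  apply: measurableI; last exact: (measurable_preimage kv_measurable mI1).
  exact: measurableI mbase (measurable_preimage ku_measurable mU).
Qed.

Lemma mbase1 : measurable (base `&` [set g | I1 (kv g)]).
Proof. exact: measurableI mbase (measurable_preimage kv_measurable mI1). Qed.

(** The distribution of u over the window when t and v range over unit intervals. The window keeps
    it finite. Its density, a multiple of e^(-u), is never made explicit; only the integrals of 1
    and of e^u against it are compared. *)
Definition hW : {measure set RR -> \bar R} := push_measure (mrestr mu mbase1) ku_measurable.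

Lemma hWE U : hW U = mu [set g | U (ku g) /\ (base g /\ I1 (kv g))].
Proof. by []. Qed.

Lemma hW_sigma_finite : sigma_finite setT hW.
Proof.
apply: fin_num_fun_sigma_finite; first by rewrite measure0.
move=> U mU; rewrite ge0_fin_numE// hWE; apply: (@base_v_lty 0 1).
  exact: measurableI (measurable_preimage ku_measurable mU) mbase1.
by move=> g [_ []].
Qed.

Let hWs := sigma_finite_of hW_sigma_finite.

(** Left translation by n shifts v alone, so on rectangles the measure is [hW] times Lebesgue
    measure, and a product measure is determined by rectangles. *)
Lemma haar_tonelli (S : set (RR * RR)) : measurable S ->
  mu [set g | S (ku g, kv g) /\ base g] = (\int[hWs]_u leb (xsection S u))%E.
Proof.
move=> mS.
pose lam : {measure set (RR * RR) -> \bar R} :=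
  push_measure (mrestr mu mbase) kuv_measurable.
transitivity (lam S) => //.
rewrite -(@product_measure_unique _ _ _ _ _ hWs leb lam)// => U V mU mV.
have -> : lam (U `*` V) = mu [set g | (base g /\ U (ku g)) /\ V (kv g)].
  rewrite [LHS](_ : _ = mu ([set g | (U `*` V) (ku g, kv g)] `&` base))//.
  by congr (mu _); apply/seteqP; split => g [[? ?] ?].
rewrite haar_rect//; congr (_ * _)%E; rewrite [RHS]hWE; congr (mu _).
by apply/seteqP; split => g [] => [[? ?] ?|? [? ?]].
Qed.

Lemma haar_tonelli_slab (Z : set RR) (S : set (RR * RR)) : measurable Z ->
  Z `<=` W -> measurable S -> (forall u v, S (u, v) -> Z u) ->
  mu (right_slab S I1) = (\int[hWs]_(u in Z) leb (xsection S u))%E.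
Proof.
move=> mZ ZW mS SZ.
transitivity (mu [set g | S (ku g, kv g) /\ base g]).
  by congr (mu _); apply/seteqP; split => g [Sg]; [move=> ?; split => //; split => //;
    exact/ZW/(SZ _ _ Sg)|case].
rewrite haar_tonelli// [RHS]integral_mkcond; apply: eq_integral => u _.
rewrite patchE; case: ifPn => // uZ; rewrite (_ : xsection S u = set0) ?measure0//.
apply/seteqP; split => // v; rewrite /xsection /= inE => /SZ Zu.
by move/negP: uZ; apply; exact/mem_set.
Qed.

End window.

(** Up to the constant [unit_vol], [mu] is Lebesgue measure in the coordinates ([ku], [kw], [kt])
    and has density e^(-u) in ([ku], [kv], [kt]). Hence [unit_vol] is taken with [kw], while
    [hvol Z] stands for the integral of that density over [Z]. *)
Definition hvol (Z : set RR) : \bar R := mu (right_slab (Z `*` I1) I1).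
Definition unit_vol : \bar R := mu [set g | (I1 (kt g) /\ I1 (kw g)) /\ I1 (ku g)].

Lemma unit_vol_lty : (unit_vol < +oo)%E.
Proof.
apply: (@haar_bounded_lty' _ 1).
  apply: measurableI; last exact: (measurable_preimage ku_measurable mI1).
  exact: measurableI (measurable_preimage kt_measurable mI1)
    (measurable_preimage kw_measurable mI1).
by move=> g [[/I1_bound ? /I1_bound ?] /I1_bound ?].
Qed.

Lemma lebesgue_scale (r : R) (F : set RR) : 0 < r -> measurable F ->
  leb [set v | F (r * v)] = ((r^-1)%:E * leb F)%E.
Proof.
move=> r0 mF.
have mr : measurable_fun setT (fun v : RR => r * v : RR).
  exact: (@measurable_funM _ RR R setT (cst r) id).
pose m := push_measure leb mr.
have mE A : m A = leb [set v | A (r * v)] by [].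
have m1 : m I1 = (r^-1)%:E.
  rewrite mE (_ : [set v | I1 (r * v)] = `]0, r^-1]%classic).
    by rewrite lebesgue_measure_itv/= lte_fin invr_gt0 r0 sube0.
  apply/seteqP; split => v; rewrite /I1 /= !in_itv/= pmulr_rgt0//;
  by rewrite -[r^-1]mul1r ler_pdivlMr// mulrC.
rewrite -mE translation_invariant_unique//; last by rewrite m1 ltry.
  by rewrite m1.
move=> x A mA; rewrite !mE -[RHS](lebesgue_shift (x / r)); last first.
  exact: (measurable_preimage mr mA).
by congr (leb _); apply/seteqP; split => v; rewrite /= mulrDr mulrCA divff ?mulr1 ?gt_eqF.
Qed.

(** A shear only translates each section over u. *)
Lemma haar_right_slab_shear M (Z E : set RR) (th : RR -> RR) : measurable Z -> measurable E ->
  (forall u, Z u -> `|u| <= M) -> measurable_fun setT th ->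
  mu (right_slab [set z | Z z.1 /\ E (z.2 + th z.1)] I1) = (hvol Z * leb E)%E.
Proof.
move=> mZ mE ZM mth.
have ZW : Z `<=` `[- M, M]%classic by move=> u /ZM; rewrite /= in_itv/= ler_norml.
have key (F : set RR) (t : RR -> RR) : measurable F -> measurable_fun setT t ->
    mu (right_slab [set z | Z z.1 /\ F (z.2 + t z.1)] I1) =
    (leb F * \int[sigma_finite_of (hW_sigma_finite M)]_(u in Z) 1)%E.
  move=> mF mt.
  have mS : measurable [set z : RR * RR | Z z.1 /\ F (z.2 + t z.1)].
    apply: measurableI; first exact: (measurable_preimage measurable_fst mZ).
    suff : measurable_fun setT (fun z : RR * RR => z.2 + t z.1 : RR).
      by move/measurable_preimage; exact.
    apply: (@measurable_funD _ (RR * RR)%type R setT snd (t \o fst)).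
      exact: measurable_snd.
    exact: (measurableT_comp mt measurable_fst).
  rewrite (@haar_tonelli_slab M Z)//; last by move=> u v [].
  rewrite -ge0_integralZl//; apply: eq_integral => u uZ.
  rewrite mule1 -(lebesgue_shift (t u) mF); congr (leb _).
  apply/seteqP; split => v; rewrite /xsection /= inE /= (addrC v); first by case.
  by move=> ?; split => //; exact: set_mem.
rewrite (key E th)// /hvol.
have -> : Z `*` I1 = [set z | Z z.1 /\ I1 (z.2 + cst 0 z.1)].
  by apply/seteqP; split => z; rewrite /= addr0.
rewrite (key I1 (cst 0))//.
by rewrite [leb I1]lebesgue_measure_itv/= lte_fin ltr01 sube0 mul1e muleC.
Qed.

Let scale_measurable e :
  measurable_fun setT (fun z : RR * RR => expR (- z.1) * (z.2 - e) : RR).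
Proof.
apply: (@measurable_funM _ (RR * RR)%type R setT (fun z => expR (- z.1))
    (fun z => z.2 - e)).
  apply: (measurableT_comp (@measurable_expR R)).
  exact: (@measurable_funN _ (RR * RR)%type R setT fst measurable_fst).
exact: (@measurable_funB _ (RR * RR)%type R setT snd (cst e) measurable_snd).
Qed.

Let scale_set_measurable (Z F : set RR) e : measurable Z -> measurable F ->
  measurable [set z : RR * RR | Z z.1 /\ F (expR (- z.1) * (z.2 - e))].
Proof.
move=> mZ mF; exact: measurableI (measurable_preimage measurable_fst mZ)
  (measurable_preimage (scale_measurable e) mF).
Qed.

(** The section over u is e + e^u F, of length e^u |F|. *)
Lemma haar_right_slab_scale_integral M (Z F : set RR) e : measurable Z -> measurable F ->
  (forall u, Z u -> `|u| <= M) ->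
  mu (right_slab [set z | Z z.1 /\ F (expR (- z.1) * (z.2 - e))] I1) =
  (leb F * \int[sigma_finite_of (hW_sigma_finite M)]_(u in Z) (expR u)%:E)%E.
Proof.
move=> mZ mF ZM.
have ZW : Z `<=` `[- M, M]%classic by move=> u /ZM; rewrite /= in_itv/= ler_norml.
rewrite (@haar_tonelli_slab M Z)//; last first.
- by move=> u v [].
- exact: scale_set_measurable.
rewrite -ge0_integralZl//; last first.
  by apply/measurable_EFinP; apply: measurable_funTS; exact: measurable_expR.
apply: eq_integral => u uZ.
have mv : measurable [set v : RR | F (expR (- u) * v)].
  suff : measurable_fun setT (fun v : RR => expR (- u) * v : RR).
    by move/measurable_preimage; exact.
  exact: (@measurable_funM _ RR R setT (cst (expR (- u))) id).
have -> : (leb F * (expR u)%:E = leb [set v | F (expR (- u) * v)%R])%E.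
  by rewrite lebesgue_scale ?expR_gt0// expRN invrK muleC.
rewrite -(lebesgue_shift (- e) mv); congr (leb _).
apply/seteqP; split => v; rewrite /xsection /= inE /= (addrC _ v); first by case.
by move=> ?; split => //; exact: set_mem.
Qed.

(** The integral does not depend on [F] and [e]. For the unit interval and e = 0 the condition on v
    becomes one on [kw], and left translation by a shifts [ku] while fixing [kw] and [kt]. *)
Lemma haar_right_slab_scale M (Z F : set RR) e : measurable Z -> measurable F ->
  (forall u, Z u -> `|u| <= M) ->
  mu (right_slab [set z | Z z.1 /\ F (expR (- z.1) * (z.2 - e))] I1) =
  (unit_vol * leb Z * leb F)%E.
Proof.
move=> mZ mF ZM; rewrite (haar_right_slab_scale_integral e mZ mF ZM) muleC; congr (_ * _)%E.
transitivity (mu (right_slab [set z | Z z.1 /\ I1 (expR (- z.1) * (z.2 - 0))] I1)).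
  rewrite (haar_right_slab_scale_integral 0 mZ mI1 ZM).
  by rewrite [leb I1]lebesgue_measure_itv/= lte_fin ltr01 sube0 mul1e.
have -> : right_slab [set z | Z z.1 /\ I1 (expR (- z.1) * (z.2 - 0))] I1 =
    [set g | (I1 (kt g) /\ I1 (kw g)) /\ Z (ku g)].
  apply/seteqP; split => g; rewrite /right_slab /= /kv subr0 mulrA -expRD addNr expR0 mul1r.
    by move=> [[? ?] ?].
  by move=> [[? ?] ?].
apply: haar_translation_unique => //.
- exact: measurableI (measurable_preimage kt_measurable mI1)
    (measurable_preimage kw_measurable mI1).
- exact: ku_measurable.
- move=> x B mB.
  rewrite -[RHS](left_invariant_preimage (a x) lmu); last first.
    apply: measurableI; last exact: (measurable_preimage ku_measurable mB).
    exact: measurableI (measurable_preimage kt_measurable mI1)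
      (measurable_preimage kw_measurable mI1).
  congr (mu _); apply/seteqP; split => g /=;
    by have [-> -> ->] := mula_coordinates g x.
- exact: unit_vol_lty.
Qed.

Lemma hvol_ge M (Z : set RR) z1 : measurable Z -> (forall u, Z u -> `|u| <= M) ->
  (forall u, Z u -> u <= z1) ->
  (unit_vol * leb Z <= (expR z1)%:E * hvol Z)%E.
Proof.
move=> mZ ZM Zz1.
have e1 := haar_right_slab_scale_integral 0 mZ mI1 ZM.
rewrite (haar_right_slab_scale 0 mZ mI1 ZM) in e1.
have l1 : leb I1 = 1%E by rewrite lebesgue_measure_itv/= lte_fin ltr01 sube0.
rewrite l1 mule1 mul1e in e1; rewrite e1.
have -> : hvol Z = (\int[sigma_finite_of (hW_sigma_finite M)]_(u in Z) 1)%E.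
  rewrite integral_cst// mul1e /hvol /sigma_finite_of.
  have ZW : Z `<=` `[- M, M]%classic by move=> u /ZM; rewrite /= in_itv/= ler_norml.
  rewrite [RHS](_ : _ = mu [set g | Z (ku g) /\ (([set g | `[- M, M]%classic (ku g)
    /\ I1 (kt g)] g) /\ I1 (kv g))])//; congr (mu _).
  apply/seteqP; split => g; rewrite /right_slab /=.
    by move=> [[Zg ?] ?]; split => //; split => //; split => //; exact: ZW.
  by move=> [? [[]]].
rewrite -ge0_integralZl//; apply: ge0_le_integral => //.
  by apply/measurable_EFinP; apply: measurable_funTS; exact: measurable_expR.
by move=> u Zu; rewrite mule1 lee_fin ler_expR Zz1.
Qed.

Definition negate (Z : set RR) : set RR := (fun x : RR => - x : RR) @^-1` Z.

Lemma negate_measurable Z : measurable Z -> measurable (negate Z).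
Proof.
apply: measurable_preimage.
exact: (@measurable_funN _ RR R setT id (@measurable_id _ RR setT)).
Qed.

Lemma lebesgue_negate Z : measurable Z -> leb (negate Z) = leb Z.
Proof. exact: lebesgue_measureN. Qed.

(** Inversion preserves [mu] and exchanges the two coordinate systems, sending (u, v) to (- u, -
    e^(-u) v) and reversing the rotation interval. *)
Lemma haar_inverse_slab (D : set (RR * RR)) M : measurable D -> bounded_by M D ->
  measurable [set z : RR * RR | D (- z.1, - (expR (- z.1) * z.2))] ->
  mu (left_slab D I1) = mu (right_slab [set z | D (- z.1, - (expR (- z.1) * z.2))] I1).
Proof.
move=> mD DM mD'.
rewrite -(inverse_invariant c Hmu (left_slab_measurable mD mI1)).
rewrite (_ : [set x | _] =
    right_slab [set z | D (- z.1, - (expR (- z.1) * z.2))] (negate I1)); last first.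
  apply/seteqP; split => g; rewrite /left_slab /right_slab /negate /=;
  by rewrite /kv mulrA -expRD addNr expR0 mul1r /kt /ku /kw !opprK.
rewrite (@haar_right_slab _ (Num.max M (expR M * M)))//.
- by rewrite lebesgue_negate// [leb I1]lebesgue_measure_itv/= lte_fin ltr01 sube0 mule1.
- move=> u v /DM /=; rewrite !normrN => -[uM vM]; rewrite !le_max uM; split => //.
  apply/orP; right.
  have -> : v = expR u * (expR (- u) * v) by rewrite mulrA -expRD subrr expR0 mul1r.
  rewrite normrM (gtr0_norm (expR_gt0 _)) ler_pM ?expR_ge0// ler_expR.
  by rewrite (le_trans (ler_norm _)).
- exact: negate_measurable.
Qed.

(** Inversion turns a shear of a left slab into a scaling of a right slab; in [haar_left_slab_scale]
    it does the converse, and the density appears on the reflected set. *)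
Lemma haar_left_slab_shear M (Z E : set RR) f : measurable Z -> measurable E ->
  (forall u, Z u -> `|u| <= M) -> (forall v, E v -> `|v| <= M) ->
  mu (left_slab [set z | Z z.1 /\ E (z.2 - expR z.1 * f)] I1) =
  (unit_vol * leb Z * leb E)%E.
Proof.
move=> mZ mE ZM EM.
pose D : set (RR * RR) := [set z | Z z.1 /\ E (z.2 - expR z.1 * f)].
have mD : measurable D.
  apply: measurableI; first exact: (measurable_preimage measurable_fst mZ).
  suff : measurable_fun setT (fun z : RR * RR => z.2 - expR z.1 * f : RR).
    by move/measurable_preimage; exact.
  apply: (@measurable_funB _ (RR * RR)%type R setT snd (fun z => expR z.1 * f)).
    exact: measurable_snd.
  apply: (@measurable_funM _ (RR * RR)%type R setT (fun z => expR z.1) (cst f)) => //.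
  exact: (measurableT_comp (@measurable_expR R) measurable_fst).
pose D' : set (RR * RR) := [set z | negate Z z.1 /\
  negate E (expR (- z.1) * (z.2 - (- f)))].
have mD' : measurable D' by apply: scale_set_measurable; exact: negate_measurable.
have DE : [set z : RR * RR | D (- z.1, - (expR (- z.1) * z.2))] = D'.
  apply/seteqP; split => z; rewrite /D /D' /negate /= mulrDr opprD opprK;
  by rewrite mulrC.
rewrite (@haar_inverse_slab D (Num.max M (M + expR M * `|f|)))//.
- rewrite DE (@haar_right_slab_scale M)//.
  + by rewrite !lebesgue_negate.
  + exact: negate_measurable.
  + exact: negate_measurable.
  + by move=> u /ZM; rewrite normrN.
- move=> u v [/= /ZM uM /EM vM]; rewrite !le_max uM; split => //.
  apply/orP; right; rewrite -[v](subrK (expR u * f)).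
  rewrite (le_trans (ler_normD _ _))// lerD// normrM (gtr0_norm (expR_gt0 _)).
  by rewrite ler_wpM2r// ler_expR (le_trans (ler_norm _)).
- by rewrite DE.
Qed.

Lemma haar_left_slab_scale M (Z F : set RR) e : measurable Z -> measurable F ->
  (forall u, Z u -> `|u| <= M) -> (forall v, F v -> `|v| <= M) ->
  mu (left_slab [set z | Z z.1 /\ F (expR (- z.1) * (z.2 - e))] I1) =
  (hvol (negate Z) * leb F)%E.
Proof.
move=> mZ mF ZM FM.
pose D : set (RR * RR) := [set z | Z z.1 /\ F (expR (- z.1) * (z.2 - e))].
have mD : measurable D by exact: scale_set_measurable.
pose th (u : RR) : RR := expR u * e.
have mth : measurable_fun setT th.
  exact: (@measurable_funM _ RR R setT expR (cst e)).
pose D' : set (RR * RR) := [set z | negate Z z.1 /\ negate F (z.2 + th z.1)].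
have DE : [set z : RR * RR | D (- z.1, - (expR (- z.1) * z.2))] = D'.
  apply/seteqP; split => z; rewrite /D /D' /negate /th /= opprK;
  by rewrite mulrBr mulrN mulrA -expRD subrr expR0 mul1r opprD.
have mD' : measurable D'.
  apply: measurableI.
    exact: (measurable_preimage measurable_fst (negate_measurable mZ)).
  suff : measurable_fun setT (fun z : RR * RR => z.2 + th z.1 : RR).
    by move/measurable_preimage => /(_ _ (negate_measurable mF)).
  apply: (@measurable_funD _ (RR * RR)%type R setT snd (th \o fst)).
    exact: measurable_snd.
  exact: (measurableT_comp mth measurable_fst).
rewrite (@haar_inverse_slab D (Num.max M (expR M * M + `|e|)))//.
- rewrite DE (@haar_right_slab_shear M)//.
  + by rewrite lebesgue_negate.
  + exact: negate_measurable.
  + exact: negate_measurable.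
  + by move=> u /ZM; rewrite normrN.
- move=> u v [/= /ZM uM /FM vM]; rewrite !le_max uM; split => //.
  apply/orP; right; rewrite -[v](subrK e).
  rewrite (le_trans (ler_normD _ _))// lerD//.
  have -> : v - e = expR u * (expR (- u) * (v - e)).
    by rewrite mulrA -expRD subrr expR0 mul1r.
  rewrite normrM (gtr0_norm (expR_gt0 _)) ler_pM ?expR_ge0// ler_expR.
  by rewrite (le_trans (ler_norm _)).
- by rewrite DE.
Qed.

End coordinate_measures.

(** * Monotone matching of step functions *)

Section staircase.
Variables (R : realType) (T1 T2 : Type).

(* Step functions with values in T: lists of (left end, length, value). *)
Fixpoint slabs_from T (ok : T -> Prop) (w : T -> R) (d a : R)
    (l : seq (R * R * T)) : Prop :=
  if l is (x, len, E) :: l' then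
    [/\ a <= x, 0 < len <= d, ok E, 0 < w E & slabs_from ok w d (x + len) l']
  else True.

Fixpoint mass T (w : T -> R) (l : seq (R * R * T)) : R :=
  if l is (_, len, E) :: l' then len * w E + mass w l' else 0.

(** Slabs of the first factor contain their right end, slabs of the second one their left end. This
    separates matched pieces strictly and keeps available the two end points used below: the last
    one of the first factor and the first one of the second. *)
Definition slab_oc T (x len : R) (E : T) : set (R * T) :=
  [set z | x < z.1 <= x + len /\ z.2 = E].
Definition slab_co T (x len : R) (E : T) : set (R * T) :=
  [set z | x <= z.1 < x + len /\ z.2 = E].

Fixpoint graph_oc T (l : seq (R * R * T)) : set (R * T) :=
  if l is (x, len, E) :: l' then slab_oc x len E `|` graph_oc l' else set0.
Fixpoint graph_co T (l : seq (R * R * T)) : set (R * T) :=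
  if l is (x, len, E) :: l' then slab_co x len E `|` graph_co l' else set0.

Lemma graph_oc_gt T ok w d a (l : seq (R * R * T)) z :
  slabs_from ok w d a l -> graph_oc l z -> a < z.1.
Proof.
elim: l a => [//|[[x len] E] l IH] a /= [ax /andP[l0 _] _ _ fl] [[/andP[xz _] _]|lz].
  exact: le_lt_trans xz.
by apply: le_lt_trans (IH _ fl lz); rewrite (le_trans ax)// lerDl ltW.
Qed.

Lemma graph_co_ge T ok w d a (l : seq (R * R * T)) z :
  slabs_from ok w d a l -> graph_co l z -> a <= z.1.
Proof.
elim: l a => [//|[[x len] E] l IH] a /= [ax /andP[l0 _] _ _ fl] [[/andP[xz _] _]|lz].
  exact: le_trans xz.
by apply: le_trans (IH _ fl lz); rewrite (le_trans ax)// lerDl ltW.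
Qed.

Lemma mass_ge0 T ok w d a (l : seq (R * R * T)) : slabs_from ok w d a l -> 0 <= mass w l.
Proof.
elim: l a => [//|[[x len] E] l IH] a /= [_ /andP[l0 _] _ w0 fl].
by rewrite addr_ge0 ?(IH _ fl)// mulr_ge0 ?ltW.
Qed.

Variables (ok1 : T1 -> Prop) (ok2 : T2 -> Prop) (w1 : T1 -> R) (w2 : T2 -> R).
(** [Val S U m] is meant as: the products of [S] and [U] fill a set of measure at least [m]. It is
    abstract because the same matching is used along A, with values the fibres, and along K, with
    values whole step functions. [K] is the gain per unit of mass. *)
Variables (r K d : R) (Val : set (R * T1) -> set (R * T2) -> R -> Prop).
Hypothesis r0 : 0 < r.
Hypothesis Val0 : Val set0 set0 0.
Hypothesis ValU : forall (S S' : set (R * T1)) (U U' : set (R * T2)) x y m m',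
  (forall z, S z -> z.1 <= x) -> (forall z, S' z -> x < z.1) ->
  (forall z, U z -> z.1 < y) -> (forall z, U' z -> y <= z.1) ->
  Val S U m -> Val S' U' m' -> Val (S `|` S') (U `|` U') (m + m').
Hypothesis Val_slab : forall x len E y len' F, ok1 E -> ok2 F ->
  0 < len <= d -> 0 < len' <= d -> 0 < w1 E -> 0 < w2 F ->
  len' * w2 F = r * (len * w1 E) ->
  Val (slab_oc x len E) (slab_co y len' F) (K * (len * w1 E)).

(* Two step functions whose masses are in the ratio r are cut simultaneously
   into slabs that match pairwise with the same ratio. *)
Lemma staircase l1 l2 a b : slabs_from ok1 w1 d a l1 -> slabs_from ok2 w2 d b l2 ->
  mass w2 l2 = r * mass w1 l1 -> Val (graph_oc l1) (graph_co l2) (K * mass w1 l1).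
Proof.
(* Induction on the total number of slabs: each round uses up at least one slab, and a cut only puts
   back the remainder of the other. *)
move: {2}(size l1 + size l2)%N (leqnn (size l1 + size l2)%N) => N.
elim: N l1 l2 a b => [|N IH] [|[[x l] E] t1] [|[[y l'] F] t2] a b //=.
- by move=> *; rewrite mulr0; exact: Val0.
- by move=> *; rewrite mulr0; exact: Val0.
- move=> _ _ [_ /andP[l0 _] _ w0 ft] /eqP; rewrite mulr0 gt_eqF//.
  by rewrite ltr_pwDl ?mulr_gt0// (mass_ge0 ft).
- move=> _ [_ /andP[l0 _] _ w0 ft] _ /esym/eqP; rewrite gt_eqF// mulr_gt0//.
  by rewrite ltr_pwDl ?mulr_gt0// (mass_ge0 ft).
rewrite addSn addnS ltnS => sN [ax /andP[l0 ld] okE wE ft1] [by_ /andP[l'0 l'd] okF wF ft2] mm.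
have le_oc z : slab_oc x l E z -> z.1 <= x + l by move=> [/andP[]].
have lt_co z : slab_co y l' F z -> z.1 < y + l' by move=> [/andP[]].
(* The head that is lighter, after rescaling by [r], is consumed whole; the other head is cut at the
   matching mass. *)
have [AB|AB|AB] := ltgtP (r * (l * w1 E)) (l' * w2 F).
- pose l'' := r * (l * w1 E) / w2 F.
  have l''E : l'' * w2 F = r * (l * w1 E) by rewrite divfK// gt_eqF.
  have l''0 : 0 < l'' by rewrite divr_gt0// !mulr_gt0.
  have l''l' : l'' < l' by rewrite ltr_pdivrMr.
  have -> : slab_co y l' F = slab_co y l'' F `|` slab_co (y + l'') (l' - l'') F.
    apply/seteqP; split => [z [/andP[yz zl] zF]|z [[/andP[yz zl] zF]|[/andP[yz zl] zF]]].
    + have [zy|zy] := ltrP z.1 (y + l''); [left|right]; split => //; first by rewrite yz.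
      by rewrite zy /= -addrA subrKC.
    + by split => //; rewrite yz (lt_le_trans zl)// lerD2l ltW.
    + split => //; rewrite (le_trans _ yz) ?lerDl ?(ltW l''0)//.
      by rewrite -addrA subrKC in zl.
  rewrite -setUA mulrDr.
  have ft2' : slabs_from ok2 w2 d (y + l'') ((y + l'', l' - l'', F) :: t2).
    split => //=; first by rewrite subr_gt0 l''l' (le_trans _ l'd)// gerBl ltW.
    by rewrite -addrA subrKC.
  apply: (@ValU _ _ _ _ (x + l) (y + l'')).
  + exact: le_oc.
  + by move=> z; apply: graph_oc_gt ft1.
  + by move=> z [/andP[]].
  + by move=> z; apply: (graph_co_ge (l := (y + l'', l' - l'', F) :: t2) ft2').
  + by apply: Val_slab => //; [rewrite l0|rewrite l''0 (le_trans (ltW l''l'))].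
  + apply: (IH t1 ((y + l'', l' - l'', F) :: t2) _ _ _ ft1 ft2'); first by rewrite addnS.
    rewrite /= mulrBl l''E; move: mm; rewrite mulrDr => /eqP; rewrite addrC -subr_eq => /eqP <-.
    by ring.
- pose l'' := l' * w2 F / (r * w1 E).
  have l''E : r * (l'' * w1 E) = l' * w2 F.
    by rewrite mulrCA divfK// gt_eqF// mulr_gt0.
  have l''0 : 0 < l'' by rewrite divr_gt0// !mulr_gt0.
  have l''l : l'' < l by rewrite ltr_pdivrMr ?mulr_gt0// mulrCA.
  have -> : slab_oc x l E = slab_oc x l'' E `|` slab_oc (x + l'') (l - l'') E.
    apply/seteqP; split => [z [/andP[yz zl] zF]|z [[/andP[yz zl] zF]|[/andP[yz zl] zF]]].
    + have [zy|zy] := lerP z.1 (x + l''); [left|right]; split => //; first by rewrite yz.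
      by rewrite zy /= -addrA subrKC.
    + by split => //; rewrite yz (le_trans zl)// lerD2l ltW.
    + split => //; rewrite (lt_trans _ yz) ?ltrDl//.
      by rewrite -addrA subrKC in zl.
  rewrite -setUA.
  have ft1' : slabs_from ok1 w1 d (x + l'') ((x + l'', l - l'', E) :: t1).
    split => //=; first by rewrite subr_gt0 l''l (le_trans _ ld)// gerBl ltW.
    by rewrite -addrA subrKC.
  have -> : K * (l * w1 E + mass w1 t1) =
      K * (l'' * w1 E) + K * mass w1 ((x + l'', l - l'', E) :: t1) by rewrite /=; ring.
  apply: (@ValU _ _ _ _ (x + l'') (y + l')).
  + by move=> z [/andP[]].
  + by move=> z; apply: (graph_oc_gt (l := (x + l'', l - l'', E) :: t1) ft1').
  + exact: lt_co.
  + by move=> z; apply: graph_co_ge ft2.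
  + apply: Val_slab => //; by [rewrite l''0 (le_trans (ltW l''l))|rewrite l'0].
  + apply: (IH ((x + l'', l - l'', E) :: t1) t2 _ _ _ ft1' ft2) => //.
    by move: mm l''E => /=; lra.
- rewrite mulrDr; apply: (@ValU _ _ _ _ (x + l) (y + l')) => //.
  + by move=> z; apply: graph_oc_gt ft1.
  + by move=> z; apply: graph_co_ge ft2.
  + by apply: Val_slab => //; rewrite ?l0 ?l'0.
  + apply: (IH t1 t2 _ _ _ ft1 ft2); first exact: ltnW.
    by move: mm; rewrite mulrDr AB => /addrI.
Qed.

End staircase.

(** * The solvable factor NA *)

Section cube_inequalities.
Variable R : realFieldType.

Lemma amgm3 (x y z m : R) : 0 <= x -> 0 <= y -> 0 <= z -> 0 <= m ->
  m ^+ 3 <= x * y * z -> 3 * m <= x + y + z.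
Proof.
move=> x0 y0 z0 m0 mxyz.
have agm : 27 * (x * y * z) <= (x + y + z) ^+ 3.
  have h1 : 0 <= (x + y + z) * ((x - y) ^+ 2 + (y - z) ^+ 2 + (z - x) ^+ 2).
    by rewrite mulr_ge0 ?addr_ge0 ?sqr_ge0.
  have h2 : 0 <= x * (y - z) ^+ 2 + y * (z - x) ^+ 2 + z * (x - y) ^+ 2.
    by apply: addr_ge0; [apply: addr_ge0|]; apply: mulr_ge0 => //; exact: sqr_ge0.
  by move: h1 h2; lra.
rewrite leNgt; apply/negP => lt_m.
have s0 : 0 <= x + y + z by rewrite !addr_ge0.
have : (x + y + z) ^+ 3 < (3 * m) ^+ 3 by rewrite ltr_pXn2r ?nnegrE ?mulr_ge0.
rewrite exprMn; move: agm mxyz; lra.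
Qed.

(** After expansion, the mixed terms form two sums of three, and each is bounded by the inequality
    of arithmetic and geometric means. *)
Lemma hoelder3 (x1 x2 x3 y1 y2 y3 p q m : R) :
  0 <= x1 -> 0 <= x2 -> 0 <= x3 -> 0 <= y1 -> 0 <= y2 -> 0 <= y3 ->
  0 <= p -> 0 <= q -> 0 <= m ->
  x1 * x2 * x3 = p ^+ 3 * m -> y1 * y2 * y3 = q ^+ 3 * m ->
  m * (p + q) ^+ 3 <= (x1 + y1) * (x2 + y2) * (x3 + y3).
Proof.
move=> x10 x20 x30 y10 y20 y30 p0 q0 m0 xE yE.
have h1 : 3 * (p ^+ 2 * q * m) <= x1 * x2 * y3 + x1 * y2 * x3 + y1 * x2 * x3.
  apply: amgm3; rewrite ?mulr_ge0 ?exprn_ge0//.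
  have -> : x1 * x2 * y3 * (x1 * y2 * x3) * (y1 * x2 * x3) =
    (x1 * x2 * x3) ^+ 2 * (y1 * y2 * y3) by ring.
  rewrite xE yE; lra.
have h2 : 3 * (p * q ^+ 2 * m) <= x1 * y2 * y3 + y1 * x2 * y3 + y1 * y2 * x3.
  apply: amgm3; rewrite ?mulr_ge0 ?exprn_ge0//.
  have -> : x1 * y2 * y3 * (y1 * x2 * y3) * (y1 * y2 * x3) =
    (x1 * x2 * x3) * (y1 * y2 * y3) ^+ 2 by ring.
  rewrite xE yE; lra.
have -> : (x1 + y1) * (x2 + y2) * (x3 + y3) = x1 * x2 * x3 + y1 * y2 * y3
  + (x1 * x2 * y3 + x1 * y2 * x3 + y1 * x2 * x3)
  + (x1 * y2 * y3 + y1 * x2 * y3 + y1 * y2 * x3) by ring.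
rewrite xE yE; move: h1 h2; lra.
Qed.

End cube_inequalities.

Definition cbrt (R : realType) (x : R) : R := x `^ 3^-1.

Lemma cbrt_ge0 (R : realType) (x : R) : 0 <= cbrt x.
Proof. exact: powR_ge0. Qed.

Lemma cbrtK (R : realType) (x : R) : 0 <= x -> cbrt x ^+ 3 = x.
Proof.
move=> x0; rewrite /cbrt -powR_mulrn ?powR_ge0// -powRrM mulVf ?powRr1//.
Qed.

Section solvable_level.
Context (R : realType) (G : topologicalGroupType) (c : iwasawa_chart R G).
Local Notation T := (borelType G).
Local Notation RR := (measurableTypeR R).
Local Notation leb := (@lebesgue_measure R).
Variable mu : {measure set T -> \bar R}.
Hypothesis Hmu : haar_measure mu.

Definition unit_oc : set RR := `]0, 1]%classic.
Definition vol : R := fine (unit_vol c mu).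
Definition width (E : set RR) : R := fine (leb E).
Definition ok_fibre (E : set RR) : Prop := compact (E : set R).

Lemma unit_volE : unit_vol c mu = vol%:E.
Proof. by rewrite fineK// ge0_fin_numE ?measure_ge0//; exact: unit_vol_lty. Qed.

Lemma vol_ge0 : 0 <= vol. Proof. by rewrite fine_ge0// measure_ge0. Qed.

Lemma fibre_measurable E : ok_fibre E -> measurable E.
Proof. exact: compact_measurable. Qed.

Lemma widthE E : ok_fibre E -> leb E = (width E)%:E.
Proof.
move=> cE; rewrite fineK// ge0_fin_numE//; exact: compact_finite_measure.
Qed.

(* The coordinates (u, v) of the products n(x) a(u1) a(u2) n(y). *)
Definition solvable_product (S S' : set (R * set RR)) : set (RR * RR) :=
  [set z | exists u1 u2 E F x y, [/\ S (u1, E), S' (u2, F), E x, F y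
     & z = (u1 + u2, x + expR (u1 + u2) * y)]].

(* The sections over D of two adjacent k-slabs, of lengths i in the first factor
   and i' in the second one, have total measure at least m. *)
Definition solvable_bound (i i' : R) (S S' : set (R * set RR)) (m : R) : Prop :=
  exists D M, [/\ measurable D, bounded_by M D, D `<=` solvable_product S S'
    & (m%:E <= i%:E * mu (left_slab c D unit_oc) + i'%:E * mu (right_slab c D unit_oc))%E].

Lemma munit_oc : measurable unit_oc. Proof. exact: measurable_itv. Qed.

Lemma bounded_byU (M M' : R) (D D' : set (RR * RR)) : bounded_by M D -> bounded_by M' D' ->
  bounded_by (Num.max M M') (D `|` D').
Proof.
by move=> DM DM' u v [/DM|/DM'] [uM vM]; rewrite !le_max ?uM ?vM ?orbT.
Qed.

Lemma haar_left_slabU (D D' : set (RR * RR)) : measurable D -> measurable D' -> D `&` D' = set0 ->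
  mu (left_slab c (D `|` D') unit_oc) =
  (mu (left_slab c D unit_oc) + mu (left_slab c D' unit_oc))%E.
Proof.
move=> mD mD' DD'; rewrite -measureU; last 3 first.
- exact: left_slab_measurable munit_oc.
- exact: left_slab_measurable munit_oc.
- apply/seteqP; split => // g [[Dg _] [D'g _]].
  by have : (D `&` D') (cu c g, cv c g) by []; rewrite DD'.
congr (mu _); apply/seteqP; split => [g [[Dg|Dg] Ig]|g [[Dg Ig]|[Dg Ig]]].
- by left.
- by right.
- by split => //; left.
- by split => //; right.
Qed.

Lemma haar_right_slabU (D D' : set (RR * RR)) : measurable D -> measurable D' -> D `&` D' = set0 ->
  mu (right_slab c (D `|` D') unit_oc) =
  (mu (right_slab c D unit_oc) + mu (right_slab c D' unit_oc))%E.
Proof.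
move=> mD mD' DD'; rewrite -measureU; last 3 first.
- exact: right_slab_measurable munit_oc.
- exact: right_slab_measurable munit_oc.
- apply/seteqP; split => // g [[Dg _] [D'g _]].
  by have : (D `&` D') (ku c g, kv c g) by []; rewrite DD'.
congr (mu _); apply/seteqP; split => [g [[Dg|Dg] Ig]|g [[Dg Ig]|[Dg Ig]]].
- by left.
- by right.
- by split => //; left.
- by split => //; right.
Qed.

Section fixed_slabs.
Variables i i' : R.
Hypotheses (i0 : 0 < i) (i'0 : 0 < i').

Lemma solvable_bound0 : solvable_bound i i' set0 set0 0.
Proof.
exists set0, 0; split => //.
by rewrite adde_ge0// mule_ge0 ?measure_ge0 ?lee_fin ?ltW.
Qed.

Lemma solvable_product_subset S S' U U' :
  S `<=` U -> S' `<=` U' -> solvable_product S S' `<=` solvable_product U U'.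
Proof.
move=> SU SU' z [u1 [u2 [E [F [x [y [/SU ? /SU' ? ? ? ->]]]]]]].
by exists u1, u2, E, F, x, y.
Qed.

(** The first coordinate of a product is u1 + u2. Both terms increase from the first pair to the
    second, so the two product sets lie over disjoint sets of u. *)
Lemma solvable_boundU (S S' U U' : set (R * set RR)) x y m m' :
  (forall z, S z -> z.1 <= x) -> (forall z, S' z -> x < z.1) ->
  (forall z, U z -> z.1 < y) -> (forall z, U' z -> y <= z.1) ->
  solvable_bound i i' S U m -> solvable_bound i i' S' U' m' ->
  solvable_bound i i' (S `|` S') (U `|` U') (m + m').
Proof.
move=> Sx Sx' Uy Uy' [D [M [mD DM DP mle]]] [D' [M' [mD' DM' DP' mle']]].
have DD' : D `&` D' = set0.
  apply/seteqP; split => // z [/DP[u1 [u2 [E [F [x1 [y1 [S1 U1 _ _ ->]]]]]]]].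
  move=> /DP'[u1' [u2' [E' [F' [x1' [y1' [S1' U1' _ _ [uE _]]]]]]]].
  have := Sx _ S1; have := Sx' _ S1'; have := Uy _ U1; have := Uy' _ U1' => /=.
  by move: uE; lra.
exists (D `|` D'), (Num.max M M'); split.
- exact: measurableU.
- exact: bounded_byU.
- move=> z [/DP|/DP']; apply: solvable_product_subset => ? ?; by [left|right].
- rewrite haar_left_slabU// haar_right_slabU// !ge0_muleDr ?measure_ge0// EFinD addeACA.
  exact: leeD.
Qed.

(** Left slabs carry the measure du dv and right slabs e^(-u) du dv, up to [vol]. The sections of
    the product over u have length at least |E| + e^u |F|, and u runs over an interval of length len
    + len'. Freezing e^u at the left end [z0] leaves (i + e^(-z0) i') (|E| + e^z0 |F|) (len + len'),
    to which [hoelder3] applies with m = len |E|; the exponentials cancel in the second triple. *)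
Lemma solvable_bound_slab (r d : R) x len (E : set RR) y len' (F : set RR) : 0 < r ->
  ok_fibre E -> ok_fibre F ->
  0 < len <= d -> 0 < len' <= d -> 0 < width E -> 0 < width F ->
  len' * width F = r * (len * width E) ->
  solvable_bound i i' (slab_oc x len E) (slab_co y len' F)
    (vol * expR (- (2 * d)) * (cbrt i + cbrt (i' * r)) ^+ 3 * (len * width E)).
Proof.
move=> r0 cE cF /andP[l0 ld] /andP[l'0 l'd] wE wF mm.
have nonempty (A : set RR) : ok_fibre A -> 0 < width A -> (A : set R) !=set0.
  move=> cA; have [->|/set0P//] := eqVneq A set0.
  by rewrite /width measure0 ltxx.
have [e eE e_max] := compact_EVT_max (nonempty _ cE wE) cE
  (continuous_subspaceT (fun x => @cvg_id _ (nbhs x))).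
have [f fF f_min] := compact_EVT_min (nonempty _ cF wF) cF
  (continuous_subspaceT (fun x => @cvg_id _ (nbhs x))).
move: eE fF => /set_mem eE /set_mem fF.
have {}e_max v : E v -> v <= e by move=> Ev; apply: e_max; exact/mem_set.
have {}f_min v : F v -> f <= v by move=> Fv; apply: f_min; exact/mem_set.
pose z0 := x + y; pose z1 := x + len + (y + len').
have z01 : z0 < z1 by rewrite /z0 /z1; lra.
pose Z : set RR := `]z0, z1[%classic.
have mZ : measurable Z by exact: measurable_itv.
have lebZ : leb Z = (z1 - z0)%:E by rewrite lebesgue_measure_itv/= lte_fin z01.
have [ME [_ EM]] := compact_bounded cE; have [MF [_ FM]] := compact_bounded cF.
pose M := Num.max (`|z0| + `|z1|) (Num.max (`|ME| + 1) (`|MF| + 1)).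
have ZM u : Z u -> `|u| <= M.
  rewrite /Z /= in_itv/= => /andP[u0 u1]; rewrite le_max; apply/orP; left.
  have := ler_norm z1; have := ler_norm (- z0); rewrite normrN => h0 h1.
  have := normr_ge0 z0; have := normr_ge0 z1 => h2 h3.
  by rewrite ler_norml; apply/andP; split; lra.
have {}EM v : E v -> `|v| <= M.
  move=> Ev; have ME1 : ME < `|ME| + 1 by rewrite (le_lt_trans (ler_norm _))// ltrDl.
  by rewrite !le_max (EM _ ME1 v Ev) !orbT.
have {}FM v : F v -> `|v| <= M.
  move=> Fv; have MF1 : MF < `|MF| + 1 by rewrite (le_lt_trans (ler_norm _))// ltrDl.
  by rewrite !le_max (FM _ MF1 v Fv) !orbT.
have mE := fibre_measurable cE; have mF := fibre_measurable cF.
pose F' : set RR := F `\` [set f].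
have mF' : measurable F' by apply: measurableD => //; exact: measurable_set1.
have lebF' : leb F' = (width F)%:E.
  have mf1 : measurable ([set f] : set RR) by exact: measurable_set1.
  have -> : leb F' = (leb F - leb (F `&` [set f]))%E.
    by rewrite /F' measureD//; exact: compact_finite_measure.
  have -> : F `&` [set f] = [set f] by apply/seteqP; split => [v []|v /= ->].
  by rewrite lebesgue_measure_set1 sube0 widthE.
have F'M v : F' v -> `|v| <= M by move=> [/FM].
have negZM u : negate Z u -> `|u| <= M by move=> /ZM; rewrite normrN.
pose D1 : set (RR * RR) := [set z | Z z.1 /\ E (z.2 - expR z.1 * f)].
pose D2 : set (RR * RR) := [set z | Z z.1 /\ F' (expR (- z.1) * (z.2 - e))].
have expK (u v : R) : expR u * (expR (- u) * v) = v.
  by rewrite mulrA -expRD subrr expR0 mul1r.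
(* Either u2 rests at the left end of its slab while u1 moves, or u1 rests at the right end of its
   slab while u2 moves. *)
have split_u (u : R) : Z u -> exists u1 u2 : R, [/\ x < u1 <= x + len, y <= u2 < y + len'
    & u = u1 + u2].
  rewrite /Z /= in_itv/= => /andP[]; rewrite /z0 /z1 => u0 u1.
  have [ux|ux] := lerP (u - y) (x + len).
    by exists (u - y), y; split; [apply/andP; split; lra|apply/andP; split; lra|rewrite subrK].
  by exists (x + len), (u - (x + len)); split; [apply/andP; split; lra|
    apply/andP; split; lra|rewrite addrC subrK].
have DP1 : D1 `<=` solvable_product (slab_oc x len E) (slab_co y len' F).
  move=> [u v] [/= /split_u[u1 [u2 [h1 h2 uE]]] Ev].
  exists u1, u2, E, F, (v - expR u * f), f; split => //.
  by rewrite -uE subrK.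
have DP2 : D2 `<=` solvable_product (slab_oc x len E) (slab_co y len' F).
  move=> [u v] [/= /split_u[u1 [u2 [h1 h2 uE]]] [Fv _]].
  exists u1, u2, E, F, e, (expR (- u) * (v - e)); split => //.
  by rewrite -uE expK addrC subrK.
have D12 : D1 `&` D2 = set0.
  apply/seteqP; split => // -[u v] [[/= _ Ev] [/= _ [Fv fv]]].
  have := e_max _ Ev; have : f < expR (- u) * (v - e).
    by rewrite lt_neqAle f_min// andbT; apply/eqP => fE; apply: fv.
  rewrite -(ltr_pM2l (expR_gt0 u)) expK; lra.
have mexp1 : measurable_fun setT (fun z : RR * RR => expR z.1 : RR).
  exact: (measurableT_comp (@measurable_expR R) measurable_fst).
have mD1 : measurable D1.
  apply: measurableI; first exact: (measurable_preimage measurable_fst mZ).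
  suff : measurable_fun setT (fun z : RR * RR => z.2 - expR z.1 * f : RR).
    by move/measurable_preimage; exact.
  apply: (@measurable_funB _ (RR * RR)%type R setT snd (fun z => expR z.1 * f)).
    exact: measurable_snd.
  exact: (@measurable_funM _ (RR * RR)%type R setT (fun z => expR z.1) (cst f)).
have mD2 : measurable D2.
  apply: measurableI; first exact: (measurable_preimage measurable_fst mZ).
  suff : measurable_fun setT (fun z : RR * RR => expR (- z.1) * (z.2 - e) : RR).
    by move/measurable_preimage; exact.
  apply: (@measurable_funM _ (RR * RR)%type R setT (fun z => expR (- z.1))
      (fun z => z.2 - e)).
    apply: (measurableT_comp (@measurable_expR R)).
    exact: (@measurable_funN _ (RR * RR)%type R setT fst measurable_fst).
  exact: (@measurable_funB _ (RR * RR)%type R setT snd (cst e) measurable_snd).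
(* One-dimensional Brunn-Minkowski in the fibre over u: E + e^u min F and
   max E + e^u F meet in a single point, which is dropped from the second set. *)
exists (D1 `|` D2), (expR M * M + M); split.
- exact: measurableU.
- have M0 : 0 <= M by exact: le_trans (normr_ge0 e) (EM _ eE).
  have expM u : Z u -> expR u <= expR M.
    by move=> /ZM uM; rewrite ler_expR (le_trans (ler_norm _)).
  have leM u : Z u -> `|u| <= expR M * M + M.
    by move=> /ZM uM; rewrite ler_wpDl// mulr_ge0 ?expR_ge0.
  move=> u v [[/= Zu Ev]|[/= Zu Fv]]; split; try exact: leM.
    rewrite -[v](subrK (expR u * f)) addrC (le_trans (ler_normD _ _))// lerD ?EM//.
    by rewrite normrM (gtr0_norm (expR_gt0 _)) ler_pM ?expR_ge0 ?expM ?FM.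
  rewrite -[v](subrK e) (le_trans (ler_normD _ _))// lerD ?EM//.
  rewrite -(expK u (v - e)) normrM (gtr0_norm (expR_gt0 _)).
  by rewrite ler_pM ?expR_ge0 ?expM ?F'M.
- by move=> z [/DP1|/DP2].
(* Two of the four measures are exact. The other two, [A2] and [B1], involve an exponential of u,
   bounded below by its value at an end of [Z]. *)
have A1 : mu (left_slab c D1 unit_oc) = (vol * (z1 - z0) * width E)%:E.
  by rewrite (haar_left_slab_shear c Hmu f mZ mE ZM EM) unit_volE lebZ widthE// !EFinM.
have B2 : mu (right_slab c D2 unit_oc) = (vol * (z1 - z0) * width F)%:E.
  by rewrite (haar_right_slab_scale c Hmu e mZ mF' ZM) unit_volE lebZ lebF' !EFinM.
have hge Y y1 : measurable Y -> leb Y = (z1 - z0)%:E -> (forall u, Y u -> `|u| <= M) ->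
    (forall u, Y u -> u <= y1) ->
    ((expR (- y1) * (vol * (z1 - z0)))%:E <= hvol c mu Y)%E.
  move=> mY lebY YM Yy1; have := hvol_ge c Hmu mY YM Yy1.
  rewrite lebY unit_volE -EFinM => h.
  have := lee_wpmul2l (_ : 0%E <= (expR (- y1))%:E)%E h.
  rewrite lee_fin expR_ge0 => /(_ isT).
  by rewrite muleA -!EFinM -expRD addNr expR0 mul1e.
have A2 : ((expR z0 * (vol * (z1 - z0)) * width F)%:E <= mu (left_slab c D2 unit_oc))%E.
  rewrite (haar_left_slab_scale c Hmu e mZ mF' ZM F'M) lebF' EFinM lee_wpmul2r//.
    by rewrite lee_fin ltW.
  rewrite -{1}[z0]opprK; apply: hge => //.
  - exact: negate_measurable.
  - by rewrite lebesgue_negate.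
  - by move=> u; rewrite /negate /Z /= in_itv/= => /andP[+ _]; lra.
have B1 : ((expR (- z1) * (vol * (z1 - z0)) * width E)%:E <= mu (right_slab c D1 unit_oc))%E.
  have th_m : measurable_fun setT (fun u : RR => - (expR u * f) : RR).
    apply: (@measurable_funN _ RR R setT (fun u => expR u * f)).
    exact: (@measurable_funM _ RR R setT expR (cst f)).
  rewrite (haar_right_slab_shear c Hmu mZ mE ZM th_m) widthE// EFinM lee_wpmul2r//.
    by rewrite lee_fin ltW.
  by apply: hge => // u; rewrite /Z /= in_itv/= => /andP[_ /ltW].
rewrite haar_left_slabU// haar_right_slabU// A1 B2.
rewrite (@le_trans _ _ (i%:E * ((vol * (z1 - z0) * width E)%:E
  + (expR z0 * (vol * (z1 - z0)) * width F)%:E) +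
  i'%:E * ((expR (- z1) * (vol * (z1 - z0)) * width E)%:E
  + (vol * (z1 - z0) * width F)%:E))%E)//; last first.
  have ie : (0 <= i%:E)%E by rewrite lee_fin ltW.
  have i'e : (0 <= i'%:E)%E by rewrite lee_fin ltW.
  by apply: leeD; apply: lee_wpmul2l => //; apply: leeD.
rewrite lee_fin.
(* The ratio of the extreme values of e^u on [Z]; it is at least e^(-2 d) since both lengths are at
   most [d]. *)
pose kap := expR (z0 - z1).
have kap1 : kap <= 1 by rewrite -expR0 ler_expR subr_le0 ltW.
have kap2 : expR (- (2 * d)) <= kap by rewrite ler_expR /z0 /z1; lra.
have kapz : expR (- z1) = kap * expR (- z0) by rewrite /kap -expRD; congr expR; lra.
have ez : expR z0 * expR (- z0) = 1 by rewrite -expRD subrr expR0.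
have H : len * width E * (cbrt i + cbrt (i' * r)) ^+ 3 <=
    (i + expR (- z0) * i') * (width E + expR z0 * width F) * (len + len').
  apply: hoelder3; rewrite ?cbrt_ge0 ?mulr_ge0 ?expR_ge0 ?ltW//.
  - by rewrite cbrtK ?ltW//; ring.
  - rewrite cbrtK ?mulr_ge0 ?ltW//.
    transitivity ((expR z0 * expR (- z0)) * i' * (len' * width F)); first by ring.
    by rewrite ez mm; ring.
have ll : z1 - z0 = len + len' by rewrite /z0 /z1; lra.
rewrite ll.
have v0 := vol_ge0.
set P := cbrt i + cbrt (i' * r) in H *.
have P0 : 0 <= P ^+ 3 by rewrite exprn_ge0 ?addr_ge0 ?cbrt_ge0.
have e0 : 0 <= expR (- z0) by exact: expR_ge0.
have e1 : 0 <= expR z0 by exact: expR_ge0.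
rewrite (@le_trans _ _ (vol * kap *
    ((i + expR (- z0) * i') * (width E + expR z0 * width F) * (len + len'))))//.
  rewrite -!(mulrA vol) ler_wpM2l// -mulrA (mulrC (P ^+ 3)); apply: ler_pM => //.
  by apply: mulr_ge0 => //; apply: mulr_ge0; apply: ltW.
rewrite kapz.
have k0 : 0 <= kap by exact: expR_ge0.
have L0 : 0 <= len + len' by rewrite addr_ge0 ?ltW.
have [i0' i'0'] := (ltW i0, ltW i'0); have [E0' F0'] := (ltW wE, ltW wF).
have Q1 : 0 <= vol * (len + len') * i * width E by do 3?[apply: mulr_ge0 => //].
have Q2 : 0 <= expR z0 * (vol * (len + len') * i * width F).
  by do 4?[apply: mulr_ge0 => //].
have Q3 : 0 <= vol * (len + len') * i' * width F by do 3?[apply: mulr_ge0 => //].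
have h1 := ler_wpM2r Q1 kap1; have h2 := ler_wpM2r Q2 kap1.
have h3 := ler_wpM2r Q3 kap1.
(* Of the four terms of the expansion, the last one is attained exactly by [kapz]; the others only
   need [kap] at most 1. *)
have -> : vol * kap * ((i + expR (- z0) * i') * (width E + expR z0 * width F) * (len + len'))
  = kap * (vol * (len + len') * i * width E)
  + kap * (expR z0 * (vol * (len + len') * i * width F))
  + (expR z0 * expR (- z0)) * (kap * (vol * (len + len') * i' * width F))
  + kap * expR (- z0) * (vol * (len + len') * i' * width E) by ring.
rewrite ez mul1r; move: h1 h2 h3; lra.
Qed.

End fixed_slabs.
End solvable_level.

(** * The group *)

Section group_level.
Context (R : realType) (G : topologicalGroupType) (c : iwasawa_chart R G).
Local Notation k := (ck c).
Local Notation n := (cn c).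
Local Notation a := (ca c).
Local Notation T := (borelType G).
Local Notation RR := (measurableTypeR R).
Local Notation leb := (@lebesgue_measure R).
Variable mu : {measure set T -> \bar R}.
Hypothesis Hmu : haar_measure mu.
Local Notation vol := (vol c mu).

Definition ok_section (d : R) (A : seq (R * R * set RR)) : Prop :=
  exists x, slabs_from (@ok_fibre R) (@width R) d x A.
Definition area (A : seq (R * R * set RR)) : R := mass (@width R) A.

Lemma cbrtM (x y : R) : 0 <= x -> 0 <= y -> cbrt (x * y) = cbrt x * cbrt y.
Proof. by move=> x0 y0; rewrite /cbrt powRM. Qed.

Lemma solvable_bound_graph (d i i' : R) A B : 0 < i -> 0 < i' -> ok_section d A -> ok_section d B ->
  0 < area A -> 0 < area B ->
  solvable_bound c mu i i' (graph_oc A) (graph_co B)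
    (vol * expR (- (2 * d)) * (cbrt i + cbrt (i' * (area B / area A))) ^+ 3 * area A).
Proof.
move=> i0 i'0 [x okA] [y okB] A0 B0.
have r0 : 0 < area B / area A by rewrite divr_gt0.
apply: (staircase r0 _ _ _ okA okB).
- exact: solvable_bound0.
- exact: solvable_boundU.
- by move=> *; exact: solvable_bound_slab.
- by rewrite -/(area A) -/(area B) divfK// gt_eqF.
Qed.

Definition group_product (S S' : set (R * seq (R * R * set RR))) : set G :=
  [set g | exists s A t B z, [/\ S (s, A), S' (t, B), solvable_product (graph_oc A) (graph_co B) z
     & g = (k s * (n z.2 * a z.1) * k t)%g]].

Definition group_bound (S S' : set (R * seq (R * R * set RR))) (m : R) : Prop :=
  exists D : set T, [/\ measurable D, D `<=` group_product S S' & (m%:E <= mu D)%E].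

(* The first factor rotates further only if the second one rotates less: the
   rotation coordinate increases along right translation by rotations. *)
Lemma rotated_slabs_disjoint s t s' t' v u v' u' : s <= s' -> t < t' ->
  (k s * (n v * a u) * k t)%g <> (k s' * (n v' * a u') * k t')%g.
Proof.
move=> ss tt e.
have : (k s * (n v * a u) = k s' * (n v' * a u' * k (t' - t)))%g.
  by apply: (mulIg (k t)); rewrite e ckD ckN !mulgA mulgVK.
move/(congr1 (cs c)); rewrite csE cs_mulk => sE.
have := cs_na_k_gt0 c v' u' (_ : 0 < t' - t); rewrite subr_gt0 => /(_ tt).
by move: ss sE; lra.
Qed.

Lemma group_bound0 : group_bound set0 set0 0.
Proof. by exists set0; split => //; rewrite measure0. Qed.

Lemma group_product_subset S S' U U' :
  S `<=` U -> S' `<=` U' -> group_product S S' `<=` group_product U U'.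
Proof.
by move=> SU SU' z [s [A [t [B [w [/SU ? /SU' ? ? ->]]]]]]; exists s, A, t, B, w.
Qed.

Lemma group_boundU S S' U U' x y m m' :
  (forall z, S z -> z.1 <= x) -> (forall z, S' z -> x < z.1) ->
  (forall z, U z -> z.1 < y) -> (forall z, U' z -> y <= z.1) ->
  group_bound S U m -> group_bound S' U' m' -> group_bound (S `|` S') (U `|` U') (m + m').
Proof.
move=> Sx Sx' Uy Uy' [D [mD DP mle]] [D' [mD' DP' mle']].
have DD' : D `&` D' = set0.
  apply/seteqP; split => // g [/DP[s [A [t [B [z [Ss Ut _ ->]]]]]]].
  move=> /DP'[s' [A' [t' [B' [z' [Ss' Ut' _]]]]]]; apply: rotated_slabs_disjoint.
    exact: ltW (le_lt_trans (Sx _ Ss) (Sx' _ Ss')).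
  exact: lt_le_trans (Uy _ Ut) (Uy' _ Ut').
exists (D `|` D'); split.
- exact: measurableU.
- move=> z [/DP|/DP']; apply: group_product_subset => ? ?; by [left|right].
- by rewrite measureU// EFinD leeD.
Qed.

(** Since i' area(B) = r i area(A), the sum of cube roots given by [solvable_bound_graph] is cbrt(i)
    (1 + cbrt r), so the bound is linear in the mass i area(A), as the second matching requires. *)
Lemma group_bound_slab (r d : R) x i A y i' B : 0 < r ->
  ok_section d A -> ok_section d B ->
  0 < i <= d -> 0 < i' <= d -> 0 < area A -> 0 < area B ->
  i' * area B = r * (i * area A) ->
  group_bound (slab_oc x i A) (slab_co y i' B)
    (vol * expR (- (2 * d)) * (1 + cbrt r) ^+ 3 * (i * area A)).
Proof.
move=> r0 okA okB /andP[i0 _] /andP[i'0 _] A0 B0 mm.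
have [D [M [mD DM DP]]] := solvable_bound_graph i0 i'0 okA okB A0 B0.
have -> : i' * (area B / area A) = r * i.
  by rewrite mulrA mm mulrA mulfK// gt_eqF.
rewrite (cbrtM (ltW r0) (ltW i0)).
have -> : (cbrt i + cbrt r * cbrt i) ^+ 3 = (1 + cbrt r) ^+ 3 * i.
  by rewrite -[in RHS](cbrtK (ltW i0)); ring.
move=> mle.
pose I : set RR := `]x, x + i]%classic; pose J : set RR := `]y, y + i'[%classic.
have mI : measurable I by exact: measurable_itv.
have mJ : measurable J by exact: measurable_itv.
have lI : leb I = i%:E by rewrite lebesgue_measure_itv/= lte_fin ltrDl i0 -EFinB addrC addKr.
have lJ : leb J = i'%:E by rewrite lebesgue_measure_itv/= lte_fin ltrDl i'0 -EFinB addrC addKr.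
have mA := left_slab_measurable c mD mI; have mB := right_slab_measurable c mD mJ.
(* D1 is swept out by the rotations of the first factor followed by the first
   rotation of the second one, D2 by the last rotation of the first factor
   followed by those of the second one; rotated_slabs_disjoint keeps them apart. *)
pose D1 : set T := [set g : T | left_slab c D I (g * k (- y))%g].
pose D2 : set T := [set g : T | right_slab c D J (k (- (x + i)) * g)%g].
have mD1 : measurable D1 by exact: (measurable_preimage (rmulg_measurable _) mA).
have mD2 : measurable D2 by exact: (measurable_preimage (lmulg_measurable _) mB).
have muD1 : mu D1 = (mu (left_slab c D (@unit_oc R)) * i%:E)%E.
  by rewrite (right_invariant c Hmu _ mA) (haar_left_slab c Hmu mD DM mI) lI.
have muD2 : mu D2 = (mu (right_slab c D (@unit_oc R)) * i'%:E)%E.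
  have lmu : left_invariant mu by case: Hmu.
  by rewrite (left_invariant_preimage _ lmu mB) (haar_right_slab c Hmu mD DM mJ) lJ.
have D1E g : D1 g -> exists s z, [/\ x < s <= x + i, D z & g = k s * (n z.2 * a z.1) * k y]%g.
  rewrite /D1 /left_slab /I /= in_itv/= => -[Dg sg].
  exists (cs c (g * k (- y))%g), (cu c (g * k (- y))%g, cv c (g * k (- y))%g).
  by split => //=; rewrite -chartE ckN mulgVK.
have D2E g : D2 g -> exists t z, [/\ y < t < y + i', D z
    & g = k (x + i) * (n z.2 * a z.1) * k t]%g.
  rewrite /D2 /right_slab /J /= in_itv/= => -[Dg sg].
  exists (kt c (k (- (x + i)) * g)%g), (ku c (k (- (x + i)) * g)%g, kv c (k (- (x + i)) * g)%g).
  by split => //=; rewrite /kv -ca_cn -mulgA -ank_coordinates ckN mulVKg.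
exists (D1 `|` D2); split.
- exact: measurableU.
- move=> g [/D1E[s [z [sx /DP Dz ->]]]|/D2E[t [z [ty /DP Dz ->]]]].
    by exists s, A, y, B, z; split => //; split => //=; rewrite lexx ltrDl.
  exists (x + i), A, t, B, z; split => //; split => //=; rewrite ?lexx ?ltrDl ?i0//.
  by case/andP: ty => /ltW -> ->.
- have D12 : D1 `&` D2 = set0.
    apply/seteqP; split => // g [/D1E[s [z [/andP[_ sx] _ ->]]]].
    by move=> /D2E[t [z' [/andP[ty _] _]]]; exact: rotated_slabs_disjoint.
  apply: (@le_trans _ _ (mu D1 + mu D2)%E); last by rewrite measureU.
  rewrite muD1 muD2 !(muleC (mu _)); apply: le_trans mle.
  by rewrite lee_fin le_eqVlt; apply/orP; left; apply/eqP; ring.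
Qed.

Lemma group_bound_graph (d x y : R) L L' :
  slabs_from (ok_section d) area d x L -> slabs_from (ok_section d) area d y L' ->
  0 < mass area L -> 0 < mass area L' ->
  group_bound (graph_oc L) (graph_co L')
    (expR (- (2 * d)) * (cbrt (vol * mass area L) + cbrt (vol * mass area L')) ^+ 3).
Proof.
move=> okL okL' L0 L'0.
set r := mass area L' / mass area L.
have r0 : 0 < r by rewrite divr_gt0.
have v0 : 0 <= vol by exact: vol_ge0.
have -> : mass area L' = r * mass area L by rewrite divfK// gt_eqF.
rewrite (mulrCA vol) (cbrtM (ltW r0)) ?mulr_ge0 ?(ltW L0)//.
have -> : expR (- (2 * d)) * (cbrt (vol * mass area L) + cbrt r * cbrt (vol * mass area L)) ^+ 3 =
    vol * expR (- (2 * d)) * (1 + cbrt r) ^+ 3 * mass area L.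
  transitivity (expR (- (2 * d)) * (1 + cbrt r) ^+ 3 * cbrt (vol * mass area L) ^+ 3).
    by ring.
  by rewrite cbrtK; [ring|rewrite mulr_ge0// ltW].
apply: (staircase r0 _ _ _ okL okL').
- exact: group_bound0.
- exact: group_boundU.
- by move=> *; exact: group_bound_slab.
- by rewrite divfK// gt_eqF.
Qed.

End group_level.

(** * Approximation of compact sets by boxes *)

Section grid.
Context (R : realType) (T : Type) (ok : T -> Prop) (w : T -> R) (b d : R).
Hypothesis d0 : 0 < d.

(** Cells of weight 0 are dropped because [slabs_from] demands positive weights; the mass is
    unaffected. *)
Definition grid (E : nat -> T) (m N : nat) : seq (R * R * T) :=
  [seq (b + i%:R * d, d, E i) | i <- iota m N & 0 < w (E i)].

Lemma slabs_from_le d' x y (l : seq (R * R * T)) : x <= y ->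
  slabs_from ok w d' y l -> slabs_from ok w d' x l.
Proof. by case: l => [//|[[z len] E] l] xy [yz *]; split => //; exact: le_trans yz. Qed.

Lemma grid_slabs E m N : (forall i, ok (E i)) ->
  slabs_from ok w d (b + m%:R * d) (grid E m N).
Proof.
move=> okE; elim: N m => [//|N IH] m; rewrite /grid /=.
have e : b + m%:R * d + d = b + m.+1%:R * d by rewrite -addrA -natr1 mulrDl mul1r.
case: ifPn => [wm|_] /=; first by split; rewrite ?d0 ?lexx// e; exact: IH.
by apply: slabs_from_le (IH m.+1); rewrite lerD2l ler_pM2r// ler_nat.
Qed.

Lemma mass_grid E m N : (forall i, 0 <= w (E i)) ->
  mass w (grid E m N) = \sum_(i <- iota m N) d * w (E i).
Proof.
move=> w0; elim: N m => [|N IH] m; first by rewrite big_nil.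
rewrite /= big_cons -IH /grid /=; case: ifPn => [//|].
by rewrite -leNgt => wm; rewrite (_ : w (E m) = 0) ?mulr0 ?add0r//; apply/le_anti/andP.
Qed.

Lemma graph_grid E m N z : graph_oc (grid E m N) z \/ graph_co (grid E m N) z ->
  exists2 i, b + i%:R * d <= z.1 <= b + i%:R * d + d & z.2 = E i.
Proof.
elim: N m => [|N IH] m; first by case.
rewrite /grid /=; case: ifPn => [_|_]; last exact: IH.
rewrite /= => -[] [|h].
- by move=> [/andP[z1 z2] zE]; exists m; rewrite ?z2 ?(ltW z1).
- by apply: (IH m.+1); left.
- by move=> [/andP[z1 z2] zE]; exists m; rewrite ?z1 ?(ltW z2).
- by apply: (IH m.+1); right.
Qed.

Lemma grid_cover N t : 0 < t <= N%:R * d ->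
  exists2 i, (i < N)%N & i%:R * d < t <= i%:R * d + d.
Proof.
elim: N => [|N IH] /andP[t0 tN]; first by move: tN; rewrite mul0r leNgt t0.
have [tN'|tN'] := lerP t (N%:R * d); last first.
  by exists N => //; rewrite tN'/=; move: tN; rewrite -natr1 mulrDl mul1r.
by have [|i iN it] := IH; [rewrite t0|exists i => //; exact: ltnW].
Qed.

End grid.

Section grid_approximation.
Context (R : realType) (G : topologicalGroupType) (c : iwasawa_chart R G).
Local Notation T := (borelType G).
Local Notation RR := (measurableTypeR R).
Local Notation leb := (@lebesgue_measure R).
Variable mu : {measure set T -> \bar R}.
Local Notation vol := (vol c mu).
(** Instantiated by ([cs], [cu], [cv]) for the first factor and by ([kt], [ku], [kw]) for the second
    one; [haar_cell] holds in both systems with the same constant. *)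
Variables f1 f2 f3 : G -> R.
Hypotheses (f1_continuous : continuous f1) (f2_continuous : continuous f2)
  (f3_continuous : continuous f3).
Hypothesis haar_cell : forall I J E : set RR, measurable I -> measurable J ->
  ok_fibre E ->
  (exists M : R, forall u, J u -> `|u| <= M) ->
  mu [set g | [/\ I (f1 g), J (f2 g) & E (f3 g)]] =
  (vol%:E * leb I * leb J * leb E)%E.

Lemma width_ge0 (E : set RR) : 0 <= width E.
Proof. by rewrite /width fine_ge0. Qed.

(** The fibre over a cell is the image under [f3] of the part of [X] above the closed cell: compact,
    and large enough for the boxes over half-open cells to cover [X]. A point of a box thus has
    exactly the third coordinate of some point of [X], and its first two coordinates are off by at
    most [d]. *)
Lemma grid_approximation (X : set G) (d : R) : compact X -> measurable (X : set T) ->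
  0 < d ->
  exists (x : R) (L : seq (R * R * seq (R * R * set RR))),
  [/\ slabs_from (@ok_section R d) (@area R) d x L,
      (mu X <= (vol * mass (@area R) L)%:E)%E
    & forall s A u E v,
      graph_oc L (s, A) \/ graph_co L (s, A) ->
      graph_oc A (u, E) \/ graph_co A (u, E) -> E v ->
      exists g, [/\ X g, `|s - f1 g| <= d, `|u - f2 g| <= d & v = f3 g]].
Proof.
move=> cX mX d0.
have bounded (f : G -> R) : continuous f -> exists M : R, forall g, X g -> `|f g| <= M.
  move=> cf; have /compact_bounded[M [_ fM]] : compact (f @` X).
    by apply: continuous_compact => //; exact: continuous_subspaceT.
  exists (M + 1) => g Xg; apply: (fM (M + 1)); first by rewrite ltrDl.
  by exists g.
have [M1 X1] := bounded _ f1_continuous; have [M2 X2] := bounded _ f2_continuous.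
have M1M : M1 <= Num.max M1 M2 by rewrite le_max lexx.
have M2M : M2 <= Num.max M1 M2 by rewrite le_max lexx orbT.
(* The added 1 keeps the values strictly above the left end [b], as half-open cells require. *)
pose M : R := Num.max M1 M2 + 1; pose b : R := - M; pose N := (Num.trunc (2 * M / d)).+1.
have cover (f : G -> R) (M' : R) g : M' <= Num.max M1 M2 -> `|f g| <= M' ->
    exists2 i, (i < N)%N & b + i%:R * d < f g <= b + i%:R * d + d.
  move=> M'M /ler_normlP[fg1 fg2].
  have fN : 0 < f g - b <= N%:R * d.
    apply/andP; split; first by rewrite /b /M; lra.
    have := truncnS_gt (2 * M / d); rewrite -/N ltr_pdivrMr// => h.
    by move: h; rewrite /b /M; lra.
  have [i iN /andP[i1 i2]] := grid_cover fN.
  by exists i => //; apply/andP; split; lra.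
pose cell (i : nat) : set R := `[b + i%:R * d, b + i%:R * d + d]%classic.
pose fib (i j : nat) : set RR := f3 @` (X `&` (f1 @^-1` cell i `&` f2 @^-1` cell j)).
have okfib i j : ok_fibre (fib i j).
  apply: continuous_compact; first exact: continuous_subspaceT.
  apply: compact_closedI => //; apply: closedI; apply: preimage_closed;
    [by move=> g _; exact: f1_continuous|exact: interval_closed
    |by move=> g _; exact: f2_continuous|exact: interval_closed].
pose A i := grid (@width R) b d (fib i) 0 N.
have okA i : ok_section d (A i) by eexists; exact: grid_slabs.
have areaE i : area (A i) = \sum_(j < N) d * width (fib i j).
  rewrite /area mass_grid => [|j]; last exact: width_ge0.
  by rewrite -[RHS](big_mkord xpredT (fun j => d * width (fib i j))) /index_iota subn0.
have area_ge0 i : 0 <= area (A i).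
  by rewrite areaE sumr_ge0// => j _; rewrite mulr_ge0 ?width_ge0 ?ltW.
exists (b + 0%:R * d), (grid (@area R) b d A 0 N); split.
- exact: grid_slabs.
- rewrite mass_grid//.
  have -> : \sum_(i <- iota 0 N) d * area (A i) =
      \sum_(i < N) \sum_(j < N) d * (d * width (fib i j)).
    rewrite -[LHS]/(\sum_(i <- iota 0 N) _).
    rewrite -(subn0 N) -/(index_iota 0 N) big_mkord; apply: eq_bigr => i _.
    by rewrite areaE mulr_sumr.
  pose I (i : nat) : set RR := `]b + i%:R * d, b + i%:R * d + d]%classic.
  have mI i : measurable (I i) by exact: measurable_itv.
  have lI i : leb (I i) = d%:E.
    by rewrite lebesgue_measure_itv/= lte_fin ltrDl d0 -EFinB addrC addKr.
  have bI i : exists M : R, forall u, I i u -> `|u| <= M.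
    exists (`|b + i%:R * d| + d) => u; rewrite /I /= in_itv/= => /andP[u1 u2].
    have := ler_norm (b + i%:R * d); have := ler_norm (- (b + i%:R * d)).
    rewrite normrN => h1 h2; have := normr_ge0 (b + i%:R * d) => h3.
    by rewrite ler_norml; apply/andP; split; lra.
  pose C i j : set T := [set g | [/\ I i (f1 g), I j (f2 g) & fib i j (f3 g)]].
  have muC i j : mu (C i j) = (vol * (d * (d * width (fib i j))))%:E.
    rewrite haar_cell// !lI widthE// -!EFinM; congr EFin; ring.
  have mf (f : G -> R) : continuous f -> measurable_fun setT (f : T -> RR).
    by move=> cf; exact: continuous_borelR.
  have mC i j : measurable (C i j).
    have -> : C i j = f1 @^-1` I i `&` (f2 @^-1` I j `&` f3 @^-1` fib i j).
      by apply/seteqP; split => [g [? ? ?]|g [? [? ?]]].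
    apply: measurableI; [|apply: measurableI]; apply: measurable_preimage;
      by [exact: mf|exact: mI|exact: fibre_measurable].
  pose S i := \big[setU/set0]_(j < N) C i j.
  have mS i : measurable (S i) by exact: bigsetU_measurable.
  have XS : X `<=` \big[setU/set0]_(i < N) S i.
    move=> g Xg.
    have [i iN /andP[i1 i2]] := cover f1 M1 g M1M (X1 g Xg).
    have [j jN /andP[j1 j2]] := cover f2 M2 g M2M (X2 g Xg).
    rewrite -(bigcup_mkord N S); exists i => //=; rewrite /S -(bigcup_mkord N (C i)).
    exists j => //=; split; rewrite /I /= ?in_itv/= ?i1 ?j1//.
    exists g => //; split => //; split; rewrite /cell /= in_itv/=.
      by rewrite i2 ltW.
    by rewrite j2 ltW.
  apply: (@le_trans _ _ (mu (\big[setU/set0]_(i < N) S i))).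
    apply: le_measure => //; rewrite inE//; exact: bigsetU_measurable.
  apply: (le_trans (Boole_inequality _ _)) => //.
  rewrite mulr_sumr -sumEFin; apply: lee_sum => i _.
  apply: (le_trans (Boole_inequality _ _)) => //.
  rewrite mulr_sumr -sumEFin; apply: lee_sum => j _.
  by rewrite le_eqVlt; apply/orP; left; apply/eqP; exact: muC.
- move=> s B u E v /graph_grid[i /= si ->] /graph_grid[j /= uj ->] [g [Xg [gi gj]] <-].
  exists g; split => //; move: gi gj si uj; rewrite /cell /= !in_itv/=.
    by move=> /andP[? ?] _ /andP[? ?] _; rewrite ler_norml; apply/andP; split; lra.
  by move=> _ /andP[? ?] _ /andP[? ?]; rewrite ler_norml; apply/andP; split; lra.
Qed.

End grid_approximation.

(** * Compact sets and small displacements of products *)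

Section compact_sets.
Context (R : realType) (G : topologicalGroupType) (c : iwasawa_chart R G).
Local Notation k := (ck c).
Local Notation n := (cn c).
Local Notation a := (ca c).
Local Notation T := (borelType G).
Local Notation RR := (measurableTypeR R).
Local Notation leb := (@lebesgue_measure R).

(** The chart is injective and continuous into a Hausdorff space, so [X] is the preimage of a
    compact, hence closed, set. *)
Lemma compact_borel (X : set G) : compact X -> measurable (X : set T).
Proof.
move=> cX; apply: closed_borel.
have cto : continuous (to_chart c).
  move=> g; apply: continuous_pair; first exact: cs_continuous.
  by apply: continuous_pair; [exact: cu_continuous|exact: cv_continuous].
have -> : X = to_chart c @^-1` (to_chart c @` X).
  apply/seteqP; split => [g Xg|g [h Xh hg]]; first by exists g.
  by rewrite -(to_chartK c g) -hg to_chartK.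
apply: preimage_closed => [g _|]; first exact: cto.
apply: compact_closed; first exact: norm_hausdorff.
by apply: continuous_compact => //; exact: continuous_subspaceT.
Qed.

Lemma kt_continuous : continuous (kt c).
Proof.
move=> g; apply: (@continuousN _ R G (fun g => cs c (g^-1)%g)).
apply: (@continuous_comp _ _ _ (fun g : G => (g^-1)%g) (cs c)).
  exact: invg_continuous.
exact: cs_continuous.
Qed.

Lemma ku_continuous : continuous (ku c).
Proof.
move=> g; apply: (@continuousN _ R G (fun g => cu c (g^-1)%g)).
apply: (@continuous_comp _ _ _ (fun g : G => (g^-1)%g) (cu c)).
  exact: invg_continuous.
exact: cu_continuous.
Qed.

Lemma kw_continuous : continuous (kw c).
Proof.
move=> g; apply: (@continuousN _ R G (fun g => cv c (g^-1)%g)).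
apply: (@continuous_comp _ _ _ (fun g : G => (g^-1)%g) (cv c)).
  exact: invg_continuous.
exact: cv_continuous.
Qed.

(** Boxes approximate only the K and A coordinates, so only these are displaced; the N coordinates
    are exact. *)
Definition shifted_product (e : (R * R) * (R * R)) (z : G * G) : G :=
  (k (cs c z.1 + e.1.1) * n (cv c z.1) * a (cu c z.1 + e.1.2)
   * a (ku c z.2 + e.2.1) * n (kw c z.2) * k (kt c z.2 + e.2.2))%g.

Lemma shifted_product0 z : shifted_product ((0, 0), (0, 0)) z = (z.1 * z.2)%g.
Proof.
rewrite /shifted_product !addr0 [in RHS](chartE c z.1).
by rewrite [in RHS](ank_coordinates c z.2) !mulgA.
Qed.

Lemma shifted_product_continuous :
  continuous (fun w : (G * G) * ((R * R) * (R * R)) => shifted_product w.2 w.1).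
Proof.
move=> w.
have c1 (f : G -> R) (phi : R -> G) (sh : (R * R) * (R * R) -> R) (pr : G * G -> G) :
    continuous f -> continuous phi -> continuous sh -> continuous pr ->
    {for w, continuous (fun w : (G * G) * ((R * R) * (R * R)) =>
      phi (f (pr w.1) + sh w.2))}.
  move=> cf cphi csh cpr.
  apply: (@continuous_comp _ _ _ (fun w : (G * G) * ((R * R) * (R * R)) =>
    f (pr w.1) + sh w.2) phi); last exact: cphi.
  apply: (@continuousD _ R _ (fun w : (G * G) * ((R * R) * (R * R)) => f (pr w.1))
    (fun w => sh w.2)).
    apply: (@continuous_comp _ _ _ fst (f \o pr)); first exact: cvg_fst.
    by apply: (@continuous_comp _ _ _ pr f); [exact: cpr|exact: cf].
  by apply: (@continuous_comp _ _ _ snd sh); [exact: cvg_snd|exact: csh].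
have c11 : continuous (fun e : (R * R) * (R * R) => e.1.1).
  by move=> e; apply: (@continuous_comp _ _ _ fst fst); exact: cvg_fst.
have c12 : continuous (fun e : (R * R) * (R * R) => e.1.2).
  by move=> e; apply: (@continuous_comp _ _ _ fst snd); [exact: cvg_fst|exact: cvg_snd].
have c21 : continuous (fun e : (R * R) * (R * R) => e.2.1).
  by move=> e; apply: (@continuous_comp _ _ _ snd fst); [exact: cvg_snd|exact: cvg_fst].
have c22 : continuous (fun e : (R * R) * (R * R) => e.2.2).
  by move=> e; apply: (@continuous_comp _ _ _ snd snd); exact: cvg_snd.
have cf : continuous (@fst G G) by move=> z; exact: cvg_fst.
have cs' : continuous (@snd G G) by move=> z; exact: cvg_snd.
have c0 : continuous (fun _ : (R * R) * (R * R) => 0 : R) by move=> e; exact: cst_continuous.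
have e0 : (fun w : (G * G) * ((R * R) * (R * R)) => shifted_product w.2 w.1) =
    (fun w => k (cs c w.1.1 + w.2.1.1) * n (cv c w.1.1 + 0) * a (cu c w.1.1 + w.2.1.2)
   * a (ku c w.1.2 + w.2.2.1) * n (kw c w.1.2 + 0) * k (kt c w.1.2 + w.2.2.2))%g.
  by apply/funext => z; rewrite !addr0.
rewrite e0.
have h1 := c1 _ _ _ _ (@cs_continuous _ _ c) (@ck_continuous _ _ c) c11 cf.
have h2 := c1 _ _ _ _ (@cv_continuous _ _ c) (@cn_continuous _ _ c) c0 cf.
have h3 := c1 _ _ _ _ (@cu_continuous _ _ c) (@ca_continuous _ _ c) c12 cf.
have h4 := c1 _ _ _ _ ku_continuous (@ca_continuous _ _ c) c21 cs'.
have h5 := c1 _ _ _ _ kw_continuous (@cn_continuous _ _ c) c0 cs'.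
have h6 := c1 _ _ _ _ kt_continuous (@ck_continuous _ _ c) c22 cs'.
have cM f g := @continuous_mulg G _ f g w.
exact: (cM _ _ (cM _ _ (cM _ _ (cM _ _ (cM _ _ h1 h2) h3) h4) h5) h6).
Qed.

(** A tube argument: compactness of [X] times [Y] gives one bound on the displacements for all
    pairs. *)
Lemma shifted_product_open (X Y O : set G) : compact X -> compact Y -> open O ->
  (forall x y, X x -> Y y -> O (x * y)%g) ->
  exists2 e : R, 0 < e & forall x y s u u' t, X x -> Y y ->
    `|s| < e -> `|u| < e -> `|u'| < e -> `|t| < e ->
    O (shifted_product ((s, u), (u', t)) (x, y)).
Proof.
move=> cX cY oO XYO.
have /compact_near_coveringP cover := compact_setX cX cY.
have /nbhs_ballP[e /= e0 eO] : nbhs (((0, 0), (0, 0)) : (R * R) * (R * R))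
    (fun e => X `*` Y `<=` (fun z => O (shifted_product e z))).
  apply: (cover ((R * R) * (R * R))%type (nbhs (((0, 0), (0, 0)) : (R * R) * (R * R)))
    (fun e z => O (shifted_product e z)) _) => z [Xz Yz].
  have zO : nbhs (shifted_product ((0, 0), (0, 0)) z) O.
    by rewrite shifted_product0; apply: open_nbhs_nbhs; split => //; exact: XYO.
  exact: (@shifted_product_continuous (z, ((0, 0), (0, 0))) O zO).
exists e => // x y s u u' t Xx Yy se ue u'e te.
have : ball (((0, 0), (0, 0)) : (R * R) * (R * R)) e ((s, u), (u', t)).
  by split; split; rewrite /ball /= /ball_ /= sub0r normrN.
by move/eO; apply.
Qed.

Variable mu : {measure set T -> \bar R}.
Hypothesis Hmu : haar_measure mu.

Lemma haar_cell_left (I J E : set RR) : measurable I -> measurable J ->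
  ok_fibre E -> (exists M : R, forall u, J u -> `|u| <= M) ->
  mu [set g | [/\ I (cs c g), J (cu c g) & E (cv c g)]] =
  ((vol c mu)%:E * leb I * leb J * leb E)%E.
Proof.
move=> mI mJ cE [M JM]; have mE := fibre_measurable cE.
have [ME [_ EM]] := compact_bounded cE.
have {}EM v : E v -> `|v| <= ME + 1 by apply: EM; rewrite ltrDl.
pose N : R := Num.max M (ME + 1).
have JN u : J u -> `|u| <= N by move=> /JM uM; rewrite le_max uM.
have EN v : E v -> `|v| <= N by move=> /EM vM; rewrite le_max vM orbT.
pose D : set (RR * RR) := [set z | J z.1 /\ E z.2].
have mD : measurable D.
  by apply: measurableI; [exact: (measurable_preimage measurable_fst mJ)|
    exact: (measurable_preimage measurable_snd mE)].
have -> : [set g | [/\ I (cs c g), J (cu c g) & E (cv c g)]] = left_slab c D I.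
  by apply/seteqP; split => [g [? ? ?]|g [[? ?] ?]].
rewrite (@haar_left_slab _ _ c _ Hmu D N)//; last first.
  by move=> u v [/= /JN ? /EN ?].
have -> : D = [set z | J z.1 /\ E (z.2 - expR z.1 * 0)].
  by apply/seteqP; split => z; rewrite /D /= mulr0 subr0.
rewrite (haar_left_slab_shear c Hmu 0 mJ mE JN EN) unit_volE//.
by rewrite muleAC (muleAC _ _ (leb I)).
Qed.

Lemma haar_cell_right (I J E : set RR) : measurable I -> measurable J ->
  ok_fibre E -> (exists M : R, forall u, J u -> `|u| <= M) ->
  mu [set g | [/\ I (kt c g), J (ku c g) & E (kw c g)]] =
  ((vol c mu)%:E * leb I * leb J * leb E)%E.
Proof.
move=> mI mJ cE [M JM]; have mE := fibre_measurable cE.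
have [ME [_ EM]] := compact_bounded cE.
have {}EM v : E v -> `|v| <= ME + 1 by apply: EM; rewrite ltrDl.
pose D : set (RR * RR) := [set z | J z.1 /\ E (expR (- z.1) * (z.2 - 0))].
have expK (u v : R) : expR u * (expR (- u) * v) = v.
  by rewrite mulrA -expRD subrr expR0 mul1r.
have expNK (u v : R) : expR (- u) * (expR u * v) = v.
  by rewrite mulrA -expRD addNr expR0 mul1r.
have mD : measurable D.
  apply: measurableI; first exact: (measurable_preimage measurable_fst mJ).
  suff : measurable_fun setT (fun z : RR * RR => expR (- z.1) * (z.2 - 0) : RR).
    by move/measurable_preimage; exact.
  apply: (@measurable_funM _ (RR * RR)%type R setT (fun z => expR (- z.1))
      (fun z => z.2 - 0)).
    apply: (measurableT_comp (@measurable_expR R)).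
    exact: (@measurable_funN _ (RR * RR)%type R setT fst measurable_fst).
  exact: (@measurable_funB _ (RR * RR)%type R setT snd (cst 0) measurable_snd).
have -> : [set g | [/\ I (kt c g), J (ku c g) & E (kw c g)]] = right_slab c D I.
  apply/seteqP; split => [g [? ? ?]|g [[? +] ?]].
    by split => //; split => //; rewrite /= subr0 /kv expNK.
  by rewrite /= subr0 /kv expNK.
rewrite (@haar_right_slab _ _ c _ Hmu D (Num.max M (expR M * (ME + 1))))//; last first.
  move=> u v [/= /JM uM]; rewrite subr0 => /EM vM; split; rewrite le_max ?uM//.
  apply/orP; right; rewrite -(expK u v) normrM (gtr0_norm (expR_gt0 _)).
  by apply: ler_pM => //; rewrite ler_expR (le_trans (ler_norm _)).
rewrite (haar_right_slab_scale c Hmu 0 mJ mE JM) unit_volE//.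
by rewrite muleAC (muleAC _ _ (leb I)).
Qed.

End compact_sets.

(** * The inequality for neighbourhoods of the product *)

Section product_of_compacts.
Context (R : realType) (G : topologicalGroupType) (c : iwasawa_chart R G).
Local Notation k := (ck c).
Local Notation n := (cn c).
Local Notation a := (ca c).
Local Notation T := (borelType G).
Variable mu : {measure set T -> \bar R}.
Hypothesis Hmu : haar_measure mu.
Local Notation vol := (vol c mu).

Lemma cbrt_le (x y : R) : 0 <= x -> x <= y -> cbrt x <= cbrt y.
Proof.
move=> x0 xy; apply: (ge0_ler_powR _ _ _ xy); rewrite ?invr_ge0 ?nnegrE//.
exact: le_trans xy.
Qed.

Lemma cbrt_exp3 (x : R) : 0 <= x -> cbrt (x ^+ 3) = x.
Proof. by move=> x0; rewrite /cbrt -powR_mulrn// -powRrM mulfV// powRr1. Qed.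

Lemma fine_haar_compact (X : set G) : compact X -> mu X = (fine (mu X))%:E.
Proof.
by move=> cX; rewrite fineK// ge0_fin_numE//; exact: haar_compact_lty Hmu _ cX.
Qed.

(** At every mesh [d] below [e] the boxes have masses at least mu(X) and mu(Y), and their products
    stay inside [O]. This gives the bound up to the factor e^(-2 d), and [d] tends to 0. *)
Lemma haar_open_superset_ge (X Y O : set G) : compact X -> compact Y -> open O ->
  (0 < mu X)%E -> (0 < mu Y)%E ->
  (forall x y, X x -> Y y -> O (x * y)%g) ->
  (((cbrt (fine (mu X)) + cbrt (fine (mu Y))) ^+ 3)%:E <= mu O)%E.
Proof.
move=> cX cY oO X0 Y0 XYO.
have [e e0 eO] := shifted_product_open c cX cY oO XYO.
set p := fine (mu X); set q := fine (mu Y); set B := (_ + _) ^+ 3.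
have muX := fine_haar_compact cX; have muY := fine_haar_compact cY.
have p0 : 0 < p by rewrite -lte_fin -muX.
have q0 : 0 < q by rewrite -lte_fin -muY.
have main d : 0 < d -> d < e -> ((expR (- (2 * d)) * B)%:E <= mu O)%E.
  move=> d0 de.
  have [x [L [okL XL Lcell]]] := grid_approximation (@cs_continuous _ _ c)
    (@cu_continuous _ _ c) (@cv_continuous _ _ c) (haar_cell_left c Hmu)
    cX (compact_borel c cX) d0.
  have [y [L' [okL' YL' L'cell]]] := grid_approximation (@kt_continuous _ _ c)
    (@ku_continuous _ _ c) (@kw_continuous _ _ c) (haar_cell_right c Hmu)
    cY (compact_borel c cY) d0.
  have pos (l : seq (R * R * seq (R * R * set (measurableTypeR R)))) (r z : R) :
      0 < r -> r <= vol * mass (@area R) l ->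
      slabs_from (@ok_section R d) (@area R) d z l -> 0 < mass (@area R) l.
    move=> r0 rl okl; rewrite lt_neqAle (mass_ge0 okl) andbT; apply/eqP => m0.
    by move: rl; rewrite -m0 mulr0 leNgt r0.
  move: XL YL'; rewrite muX muY !lee_fin -/p -/q => XL YL'.
  have L0 := pos _ _ _ p0 XL okL; have L'0 := pos _ _ _ q0 YL' okL'.
  have [D [mD DP leD]] := group_bound_graph c Hmu okL okL' L0 L'0.
  apply: (@le_trans _ _ (mu D)).
    apply: le_trans leD; rewrite lee_fin ler_wpM2l ?expR_ge0//.
    by rewrite lerXn2r ?nnegrE ?addr_ge0 ?cbrt_ge0// lerD// cbrt_le// ltW.
  apply: le_measure; rewrite ?inE//; first exact: open_borel.
  move=> g /DP[s [A [t [A' [z [LA LA' [u1 [u2 [E [F [v [w [AE A'F Ev Fw ->]]]]]]]]]]]]] ->.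
  have [g1 [Xg1 sg1 ug1 ->]] := Lcell _ _ _ _ _ (or_introl LA) (or_introl AE) Ev.
  have [g2 [Yg2 tg2 ug2 ->]] := L'cell _ _ _ _ _ (or_intror LA') (or_intror A'F) Fw.
  have := eO g1 g2 (s - cs c g1) (u1 - cu c g1) (u2 - ku c g2) (t - kt c g2) Xg1 Yg2
    (le_lt_trans sg1 de) (le_lt_trans ug1 de) (le_lt_trans ug2 de) (le_lt_trans tg2 de).
  rewrite /shifted_product /= !subrKC; congr O.
  (* The factor e^(u1 + u2) in the coordinate v disappears when n is moved to the right of a(u1)
     a(u2). *)
  by rewrite cnD !mulgA -(mulgA _ (n (expR _ * _)%R)) -ca_cn caD !mulgA.
have B0 : 0 < B.
  by rewrite exprn_gt0// addr_gt0// powR_gt0.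
have [->|mOy] := eqVneq (mu O) +oo%E; first exact: leey.
have mO : mu O = (fine (mu O))%:E by rewrite fineK// ge0_fin_numE// lt_neqAle mOy leey.
rewrite mO lee_fin leNgt; apply/negP => mB; set m := fine (mu O) in mO mB.
(* Then 2 d B is at most (B - m) / 2, so that e^(-2 d) B >= (1 - 2 d) B > m, a contradiction. *)
pose d : R := Num.min (e / 2) ((B - m) / (4 * B)).
have B4 : 0 < 4 * B by rewrite mulr_gt0.
have d0 : 0 < d by rewrite lt_min; apply/andP; split; apply: divr_gt0; rewrite ?subr_gt0.
have de : d < e by rewrite gt_min; apply/orP; left; lra.
have := main d d0 de; rewrite mO lee_fin; apply/negP; rewrite -ltNge.
have dB : d * (4 * B) <= B - m.
  by rewrite -ler_pdivlMr// ge_min lexx orbT.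
have := expR_ge1Dx (- (2 * d)) => h; have := ler_wpM2r (ltW B0) h.
by move: dB mB; lra.
Qed.

End product_of_compacts.

Theorem theorem6p2 (R : realType) (G : topologicalGroupType)
    (p : {multiplicative G -> PSL2 R}) (Gp : universal_cover R p)
    (mu : {measure set (borelType G) -> \bar R}) (Hmu : haar_measure mu)
    (X Y : set G) (cX : compact X) (cY : compact Y)
    (X0 : (0 < mu X)%E) (Y0 : (0 < mu Y)%E) :
  (mu X `^ 3^-1 + mu Y `^ 3^-1
     <= mu [set (x * y)%g | x in X & y in Y] `^ 3^-1)%E.
Proof.
have [c] := universal_cover_chart Gp.
set XY := [set (x * y)%g | x in X & y in Y].
(* Compactness makes the product set Borel, so that outer regularity applies to it, and of finite
   measure, so that the inequality is one between real numbers. *)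
have cXY : compact (XY : set G).
  have -> : XY = (fun z : G * G => (z.1 * z.2)%g) @` (X `*` Y).
    by apply/seteqP; split => [_ [x Xx [y Yy <-]]|_ [[x y] [Xx Yy] <-]];
      [exists (x, y)|exists x => //; exists y].
  apply: continuous_compact; last exact: compact_setX.
  by apply: continuous_subspaceT; exact: mulg_continuous.
have key : (((cbrt (fine (mu X)) + cbrt (fine (mu Y))) ^+ 3)%:E <= mu XY)%E.
  have [_ _ _ reg _] := Hmu; rewrite (reg _ (compact_borel c cXY)).
  apply: le_ereal_inf_tmp => _ [U [oU XYU] <-].
  apply: (haar_open_superset_ge c Hmu) => // x y Xx Yy; apply: XYU.
  by exists x => //; exists y.
rewrite (fine_haar_compact Hmu cXY) in key *.
rewrite (fine_haar_compact Hmu cX) (fine_haar_compact Hmu cY).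
rewrite !poweR_EFin -EFinD lee_fin -!/(cbrt _); rewrite lee_fin in key.
have s0 : 0 <= cbrt (fine (mu X)) + cbrt (fine (mu Y)) by rewrite addr_ge0 ?cbrt_ge0.
by rewrite -(cbrt_exp3 s0) cbrt_le// exprn_ge0.
Qed.
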